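(* For $\varepsilon>0$ let $(u_1^\varepsilon,u_2^\varepsilon)$ be the smooth solution of the penalized system $$\begin{cases} u_1^\varepsilon+H_1(x,Du_1^\varepsilon)+\gamma^\varepsilon(u_1^\varepsilon-u_2^\varepsilon-\psi_1)=\varepsilon\Delta u_1^\varepsilon \\ {} u_2^\varepsilon+H_2(x,Du_2^\varepsilon)+\gamma^\varepsilon(u_2^\varepsilon-u_1^\varepsilon-\psi_2)=\varepsilon\Delta u_2^\varepsilon\end{cases}\ \text{in }U,\qquad u_1^\varepsilon=u_2^\varepsilon=0\text{ on }\partial U,$$ under the hypotheses listed in the context. Then there exists a positive constant $C$, independent of $\varepsilon$, such that $$\|Du_1^\varepsilon\|_{L^\infty},\ \|Du_2^\varepsilon\|_{L^\infty}\le C.$$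
   Context: $U\subset\mathbb R^n$ ($n\ge2$) is an open bounded domain with smooth boundary; $H_1,H_2:\overline U\times\mathbb R^n\to\mathbb R$ and $\psi_1,\psi_2:\overline U\to\mathbb R$ are smooth, $\psi_1,\psi_2\ge\alpha$ in $\overline U$ for some $\alpha>0$. Standing assumptions ($j=1,2$): (1) $H_j(x,\cdot)$ is convex for every $x\in\overline U$; (2) $\lim_{|p|\to\infty}H_j(x,p)/|p|=+\infty$ uniformly in $x$; (3) $|D_xH_j|$ is bounded on $\overline U\times\mathbb R^n$; (4) there are $\Phi_1,\Phi_2\in C^2(U)\cap C^1(\overline U)$ with $\Phi_j=0$ on $\partial U$, $-\psi_2\le\Phi_1-\Phi_2\le\psi_1$ and $\Phi_j+H_j(x,D\Phi_j)<0$ in $\overline U$. $\gamma:\mathbb R\to[0,+\infty)$ is smooth and convex with $\gamma(s)=0$ for $s\le0$, $\gamma(s)>0$ and $0<\gamma'(s)\le1$ for $s>0$, $\lim_{s\to+\infty}\gamma(s)=+\infty$; $\gamma^\varepsilon(s):=\gamma(s/\varepsilon)$. *)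

(* Defs.v *)
From mathcomp Require Import all_boot all_order all_algebra.
From mathcomp Require Import all_classical all_reals all_analysis.

Set Implicit Arguments.
Unset Strict Implicit.
Unset Printing Implicit Defensive.

Import Order.TTheory GRing.Theory Num.Theory.
Import numFieldNormedType.Exports.

Local Open Scope classical_set_scope.
Local Open Scope ring_scope.

(* The library norm on 'rV[R]_n is the sup norm, so the Euclidean length |p|
   is defined separately. The topology, balls and bounded sets are the
   library ones. *)
Definition norm2 (R : realType) (n : nat) (p : 'rV[R]_n) : R :=
  Num.sqrt (\sum_(i < n) p 0 i ^+ 2).

Definition boundary (T : topologicalType) (U : set T) : set T :=
  closure U `\` U°.

(* pder [:: i1; ...; ik] f is the iterated partial derivative
   d_{i1} (... (d_{ik} f)). *)
Fixpoint pder (R : realType) (n : nat) (s : seq 'I_n) (f : 'rV[R]_n -> R) :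
    'rV[R]_n -> R :=
  if s is i :: s' then 'D_(delta_mx 0 i) (pder s' f) else f.

Definition grad (R : realType) (n : nat) (f : 'rV[R]_n -> R) (x : 'rV[R]_n) :
  'rV[R]_n := \row_i pder [:: i] f x.

Definition laplacian (R : realType) (n : nat) (f : 'rV[R]_n -> R)
  (x : 'rV[R]_n) : R := \sum_(i < n) pder [:: i; i] f x.

(* The space C^k(U), for U open. *)
Definition Ck (R : realType) (n : nat) (U : set 'rV[R]_n) (k : nat)
    (f : 'rV[R]_n -> R) : Prop :=
  forall s : seq 'I_n,
    ((size s <= k)%N -> forall x, U x -> {for x, continuous (pder s f)}) /\
    ((size s < k)%N -> forall x, U x -> forall i : 'I_n,
       derivable (pder s f) x (delta_mx 0 i)).

Definition smooth (R : realType) (n : nat) (U : set 'rV[R]_n)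
    (f : 'rV[R]_n -> R) : Prop :=
  forall k, Ck U k f.

(* The extension of f from U to closure U by limits taken from inside U. *)
Definition closure_ext (R : realType) (n : nat) (U : set 'rV[R]_n)
    (f : 'rV[R]_n -> R) (x : 'rV[R]_n) : R :=
  lim (f y @[y --> within U (nbhs x)]).

(* The space C^k(closure U): f is C^k in U and all its partial derivatives of
   order at most k extend continuously to closure U, the extension of f itself
   being f. Only the values of f on closure U matter. *)
Definition Ck_closure (R : realType) (n : nat) (U : set 'rV[R]_n) (k : nat)
    (f : 'rV[R]_n -> R) : Prop :=
  [/\ Ck U k f,
      forall s : seq 'I_n, (size s <= k)%N ->
        {within closure U, continuous (closure_ext U (pder s f))} &
      forall x, closure U x -> closure_ext U f x = f x].

Definition smooth_closure (R : realType) (n : nat) (U : set 'rV[R]_n)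
    (f : 'rV[R]_n -> R) : Prop :=
  forall k, Ck_closure U k f.

(* The gradient of a C^1(closure U) function at a point of closure U. *)
Definition grad_closure (R : realType) (n : nat) (U : set 'rV[R]_n)
    (f : 'rV[R]_n -> R) (x : 'rV[R]_n) : 'rV[R]_n :=
  \row_i closure_ext U (pder [:: i] f) x.

(* Smoothness of (x, p) |-> H x p on closure U x R^n, the pair (x, p) being
   the concatenated vector row_mx x p. *)
Definition smooth_hamiltonian (R : realType) (n : nat) (U : set 'rV[R]_n)
    (H : 'rV[R]_n -> 'rV[R]_n -> R) : Prop :=
  smooth_closure [set z : 'rV[R]_(n + n) | U (lsubmx z)]
    (fun z => H (lsubmx z) (rsubmx z)).

(* U has smooth boundary: near each boundary point, up to the choice of a
   coordinate axis i and of its orientation s, U is the strict epigraph of a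
   smooth function g of the n - 1 remaining coordinates. *)
Definition smooth_boundary (R : realType) (n : nat) (U : set 'rV[R]_n) :
    Prop :=
  forall x0, boundary U x0 ->
    exists (r : R) (i : 'I_n) (s : bool) (g : 'rV[R]_n.-1 -> R),
      [/\ 0 < r, smooth setT g &
          U `&` ball x0 r =
          ball x0 r `&`
            [set x : 'rV[R]_n | 0 < (-1) ^+ s * (x 0 i - g (col' i x))]].

(* The derivative in x is in the closure sense since x ranges over closure U. *)
Definition hamiltonian_assumptions (R : realType) (n : nat)
    (U : set 'rV[R]_n) (H : 'rV[R]_n -> 'rV[R]_n -> R) : Prop :=
  [/\ smooth_hamiltonian U H,
      forall x, closure U x -> convex_function [set: 'rV[R]_n] (H x),
      forall M : R, exists rho : R, 0 < rho /\
        forall x p, closure U x -> rho < norm2 p -> M <= H x p / norm2 p &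
      exists K : R, forall x p, closure U x ->
        norm2 (grad_closure U (fun y => H y p) x) <= K].

Definition obstacle_assumptions (R : realType) (n : nat)
    (U : set 'rV[R]_n) (psi1 psi2 : 'rV[R]_n -> R) : Prop :=
  [/\ smooth_closure U psi1, smooth_closure U psi2 &
      exists alpha : R, 0 < alpha /\
        forall x, closure U x -> alpha <= psi1 x /\ alpha <= psi2 x].

Definition strict_subsolution (R : realType) (n : nat) (U : set 'rV[R]_n)
    (H : 'rV[R]_n -> 'rV[R]_n -> R) (Phi : 'rV[R]_n -> R) : Prop :=
  [/\ Ck U 2 Phi, Ck_closure U 1 Phi,
      forall x, boundary U x -> Phi x = 0 &
      forall x, closure U x -> Phi x + H x (grad_closure U Phi x) < 0].

Definition penalty_function (R : realType) (gamma : R -> R) : Prop :=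
  [/\ forall k s, derivable (derive1n k gamma) s 1,
      convex_function [set: R] gamma,
      forall s, s <= 0 -> gamma s = 0,
      forall s, 0 < s ->
        [/\ 0 < gamma s, 0 < derive1 gamma s & derive1 gamma s <= 1] &
      gamma s @[s --> +oo] --> +oo].

Definition penalized_solution (R : realType) (n : nat) (U : set 'rV[R]_n)
    (H1 H2 : 'rV[R]_n -> 'rV[R]_n -> R) (psi1 psi2 : 'rV[R]_n -> R)
    (gamma : R -> R) (eps : R) (u1 u2 : 'rV[R]_n -> R) : Prop :=
  [/\ smooth_closure U u1, smooth_closure U u2,
      forall x, U x ->
        u1 x + H1 x (grad u1 x) + gamma ((u1 x - u2 x - psi1 x) / eps)
        = eps * laplacian u1 x,
      forall x, U x ->
        u2 x + H2 x (grad u2 x) + gamma ((u2 x - u1 x - psi2 x) / eps)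
        = eps * laplacian u2 x &
      forall x, boundary U x -> u1 x = 0 /\ u2 x = 0].

(* The library has no Lebesgue measure on R^n: null sets are the sets covered
   by countably many boxes of arbitrarily small total volume. *)
Definition lebesgue_null (R : realType) (n : nat) (A : set 'rV[R]_n) : Prop :=
  forall delta : R, 0 < delta ->
    exists a b : nat -> 'rV[R]_n,
      [/\ forall k i, a k 0 i <= b k 0 i,
          A `<=`
            \bigcup_k [set x : 'rV[R]_n | forall i, a k 0 i < x 0 i < b k 0 i] &
          (\sum_(0 <= k <oo) (\prod_(i < n) (b k 0 i - a k 0 i))%:E
             <= delta%:E)%E].

(* The L^oo(U) norm of a vector field: the infimum of its essential bounds. *)
Definition Linfty_norm (R : realType) (n : nat) (U : set 'rV[R]_n)
    (F : 'rV[R]_n -> 'rV[R]_n) : \bar R :=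
  ereal_inf [set M : \bar R | (0 <= M)%E /\
    lebesgue_null [set x : 'rV[R]_n | U x /\ (M < (norm2 (F x))%:E)%E]].

(* Main.v *)
Require Import Defs.
From mathcomp Require Import all_boot all_order all_algebra.
From mathcomp Require Import all_classical all_reals all_analysis.
From mathcomp Require Import ring lra.

(** The constant is found in three steps: an estimate |u_j(x)| <= C |x - z| for
    every boundary point z, which bounds the gradients on the boundary, and then
    Bernstein's method, which bounds them inside. All constants have to be
    uniform over the whole half-line eps > 0.

    Comparison. At the largest value of w_j - u_j over both components the two
    penalty terms are ordered the right way, so the maximum principle applies to
    the system as it does to one equation ([system_comparison]). Constants give a
    bound of the u_j independent of eps ([sup_bound]).

    Barriers. Near a boundary point let sigma be a smooth defining function of U.
    The function A (sigma - k sigma^2) + B |x - z|^2 vanishes at z, is at least 1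
    at a fixed distance from z, and has as negative a Laplacian, relative to its
    gradient, as is wanted ([barrier_exists]). A large multiple of it lies above
    the solution for every eps, by coercivity of H ([upper_bound_local]). From
    below there are three regimes. When eps is large, eps times the Laplacian of
    a fixed barrier dominates H ([lower_bound_large]). When eps is near a given
    es > 0, the solution for es minus a small multiple of a barrier is a strict
    subsolution, the convexity of H providing the Lipschitz bound in p
    ([lower_bound_mid]). When eps tends to 0, the strict subsolutions Phi_j are
    used; their second derivatives may blow up at the boundary, so near a
    boundary point they are replaced by c_j sigma - k |x - y|^2, where
    D Phi_j = c_j D sigma at that point ([chart_boundary_gradient]). The same
    functions show that Phi_j exceeds u_j by little ([small_eps_global]) and then
    serve as barriers ([lower_bound_small]). Compactness of the boundary and of
    the remaining interval of eps gives one constant ([distance_bound]), and a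
    mean value argument in a ball touching the boundary turns it into a bound of
    the gradient there ([boundary_gradient]).

    Interior. At an interior maximum of |Du_j|^2 over j and x, the equation
    differentiated along Du_j loses its drift. Since |Du_k| <= |Du_j|, the coupling
    term is bounded below by - |D psi| |Du_j| / eps, a quantity that is unbounded as
    eps tends to 0. It is absorbed by eps |D^2 u_j|^2, which is at least
    (eps Laplacian u_j)^2 / (n eps), that is, of order |Du_j|^2 / eps by the equation
    and coercivity ([interior_gradient_bound]).

    The sup norm is used on vectors: its balls are cubes, so walking along the
    coordinate axes stays inside them, and partial derivatives are all that is
    needed. *)

Set Implicit Arguments.
Unset Strict Implicit.
Unset Printing Implicit Defensive.

Import Order.TTheory GRing.Theory Num.Theory.
Import numFieldNormedType.Exports.

Local Open Scope classical_set_scope.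
Local Open Scope ring_scope.

(** * Calculus along the coordinate axes *)

Section Coordinates.
Context {R : realType} {n : nat}.
Implicit Types (x y z v w : 'rV[R]_n) (f : 'rV[R]_n -> R).

Lemma rV_coord_le x i : `|x 0 i| <= `|x|.
Proof.
rewrite [leRHS]/Num.Def.normr /= mx_normrE.
by apply/bigmax_geP; right; exists (0, i).
Qed.

Lemma rV_norm_le x (r : R) : 0 <= r -> (forall i, `|x 0 i| <= r) -> `|x| <= r.
Proof.
move=> r0 xr; rewrite /Num.Def.normr /= mx_normrE.
by apply: bigmax_le => // -[i j] _ /=; rewrite (ord1 i).
Qed.

Lemma rV_norm_lt x (r : R) : 0 < r -> (forall i, `|x 0 i| < r) -> `|x| < r.
Proof.
move=> r0 xr; rewrite /Num.Def.normr /= mx_normrE.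
by apply: bigmax_lt => // -[i j] _ /=; rewrite (ord1 i).
Qed.

Lemma is_derive_dirZ f x v (t df : R) :
  is_derive x v f df -> is_derive x (t *: v) f (t * df).
Proof.
move=> [fx <-].
have [->|t0] := eqVneq t 0.
  by rewrite scale0r mul0r; exact: is_derive0.
have H : h^-1 *: ((f \o shift x) (h *: (t *: v)) - f x) @[h --> 0^'] --> t * 'D_v f x.
  have -> : (fun h => h^-1 *: ((f \o shift x) (h *: (t *: v)) - f x)) =
     (fun h => t * h^-1 *: ((f \o shift x) (h *: v) - f x)) \o (fun h => h * t).
    apply/funext => h /=; rewrite scalerA invfM.
    by rewrite mulrCA mulfV// mulr1.
  apply: (@cvg_comp _ _ _ _ _ _ (0 : R)^'); last first.
    have -> : (fun h => t * h^-1 *: ((f \o shift x) (h *: v) - f x)) =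
      (fun h => t * (h^-1 *: ((f \o shift x) (h *: v) - f x))).
      by apply/funext => h; rewrite -[in RHS]/(t *: _) scalerA.
    by apply: cvgM; [exact: cvg_cst|exact: fx].
  move=> A [e /= e0 eA]; exists (e / `|t|) => /=; first by rewrite divr_gt0 // normr_gt0.
  move=> h /=; rewrite /ball_ /= !sub0r !normrN => he h0.
  apply: eA; rewrite /ball_ /= ?sub0r ?normrN ?mulf_neq0 //.
  by rewrite normrM -ltr_pdivlMr ?normr_gt0.
apply: DeriveDef; last exact/cvg_lim.
by apply/cvg_ex; exists (t * 'D_v f x).
Qed.

Lemma is_derive_line f x v (t df : R) :
  is_derive (x + t *: v) v f df -> is_derive t 1 (fun s => f (x + s *: v)) df.
Proof.
move=> [fx <-].
have E : (fun h => h^-1 *: (((fun s => f (x + s *: v)) \o shift t) (h *: 1) - f (x + t *: v))) =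
     (fun h => h^-1 *: ((f \o shift (x + t *: v)) (h *: v) - f (x + t *: v))).
  apply/funext => h /=; congr (_ *: (f _ - _)).
  by rewrite [h *: 1]mulr1 scalerDl addrCA.
by apply: DeriveDef; rewrite /derivable ?/derive E.
Qed.

Lemma is_derive_line0 (f : 'rV[R]_n -> R) x v (df : R) :
  is_derive (0 : R) 1 (fun s : R => f (x + s *: v)) df -> is_derive x v f df.
Proof.
move=> [fx <-].
have E : (fun h : R => h^-1 *: ((f \o shift x) (h *: v) - f x)) =
  (fun h : R => h^-1 *: (((fun s => f (x + s *: v)) \o shift 0) (h *: 1) - f (x + 0 *: v))).
  apply/funext => h /=; rewrite scale0r !addr0 [h *: 1]mulr1.
  by congr (_ *: (f _ - _)); rewrite addrC.
by apply: DeriveDef; rewrite /derivable ?/derive E.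
Qed.

(** The mean value theorem along a segment; continuity is only asked on the
    closed segment, so that an endpoint may lie on the boundary of the domain
    of differentiability. *)
Lemma line_MVT f (df : R -> R) x w :
  (forall s : R, 0 < s < 1 -> is_derive (x + s *: w) w f (df s)) ->
  {within `[0, 1], continuous (fun s : R => f (x + s *: w))} ->
  exists2 s, 0 < s < 1 & f (x + w) - f x = df s.
Proof.
move=> fd fc.
have fd' (s : R) : s \in `]0, 1[%R -> is_derive s 1 (fun s => f (x + s *: w)) (df s).
  by rewrite in_itv /= => s01; apply: is_derive_line; exact: fd.
have [s] := MVT ltr01 fd' fc.
rewrite in_itv /= => s01 /=.
by rewrite scale1r scale0r addr0 subr0 mulr1 => H; exists s.
Qed.

Lemma line_MVT_der f (df : R -> R) x w :
  (forall s : R, 0 <= s <= 1 -> is_derive (x + s *: w) w f (df s)) ->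
  exists2 s, 0 < s < 1 & f (x + w) - f x = df s.
Proof.
move=> fd; apply: line_MVT.
  by move=> s /andP[s0 s1]; apply: fd; rewrite !ltW.
apply: derivable_within_continuous => s; rewrite in_itv /= => s01.
have [//] := @is_derive_line f x w s (df s) (fd _ s01).
Qed.

(** Walking along the coordinate axes stays in a ball of the sup norm. *)
Lemma coord_lipschitz f (d : 'rV[R]_n -> 'I_n -> R) x0 (r L : R) :
  (forall z, `|z - x0| < r -> forall i,
     is_derive z (delta_mx 0 i) f (d z i) /\ `|d z i| <= L) ->
  forall x y, `|x - x0| < r -> `|y - x0| < r ->
  `|f y - f x| <= n%:R * L * `|y - x|.
Proof.
move=> fd x y xr yr.
have r0 : 0 < r by apply: le_lt_trans xr.
pose z (k : nat) : 'rV[R]_n := \row_i (if (i < k)%N then y 0 i else x 0 i).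
have zE (k : 'I_n) : z k.+1 = z k + (y 0 k - x 0 k) *: delta_mx 0 k.
  apply/rowP => i; rewrite !mxE eqxx /= eq_sym ltnS.
  case: (ltngtP i k) => ik.
  - by rewrite (_ : (k == i) = false) ?mulr0 ?addr0 //; apply/negbTE; rewrite neq_ltn ik orbT.
  - by rewrite (_ : (k == i) = false) ?mulr0 ?addr0 //; apply/negbTE; rewrite neq_ltn ik.
  - by rewrite (val_inj ik) eqxx mulr1 addrC subrK.
suff H k : (k <= n)%N -> `|f (z k) - f x| <= k%:R * L * `|y - x|.
  have := H n (leqnn _); congr (`|f _ - _| <= _).
  by apply/rowP => i; rewrite !mxE ltn_ord.
elim: k => [_|k IH kn].
  rewrite (_ : z 0%N = x) ?subrr ?normr0 ?mul0r //.
  by apply/rowP => i; rewrite !mxE.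
have -> : f (z k.+1) - f x = (f (z k.+1) - f (z k)) + (f (z k) - f x) by ring.
apply: le_trans (ler_normD _ _) _.
rewrite -addn1 natrD addrC !mulrDl mul1r lerD ?IH //; first exact: ltnW.
pose ko := Ordinal kn.
rewrite -[k]/(val ko) addn1 zE /=.
set w := _ *: delta_mx 0 ko.
have seg (s : R) : 0 <= s <= 1 -> `|z k + s *: w - x0| < r.
  move=> s01; apply: rV_norm_lt => // i; rewrite !mxE eqxx /=.
  have xi : `|x 0 i - x0 0 i| < r.
    by apply: le_lt_trans xr; have := rV_coord_le (x - x0) i; rewrite !mxE.
  have yi : `|y 0 i - x0 0 i| < r.
    by apply: le_lt_trans yr; have := rV_coord_le (y - x0) i; rewrite !mxE.
  have [/eqP E|] := boolP (i == ko); last first.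
    by move=> _; rewrite !mulr0 addr0; case: ifP.
  rewrite E /= ltnn mulr1 -E.
  move: xi yi; rewrite !ltr_norml => /andP[? ?] /andP[? ?].
  case/andP: s01 => s0 s1.
  by have [xy|xy] := leP (x 0 i) (y 0 i); apply/andP; split; nra.
have [s s01 ->] := @line_MVT_der f (fun s => (y 0 ko - x 0 ko) * d (z k + s *: w) ko) (z k) w
  (fun s s01 => is_derive_dirZ _ (fd _ (seg s s01) ko).1).
rewrite normrM mulrC ler_pM //.
  by apply: (fd _ (seg s _) ko).2; case/andP: s01 => *; rewrite !ltW.
by have := rV_coord_le (y - x) ko; rewrite !mxE.
Qed.

End Coordinates.

Section Calculus.
Context {R : realType} {n : nat}.
Implicit Types (x y z v w : 'rV[R]_n) (f : 'rV[R]_n -> R).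
Local Notation e_ i := (delta_mx (0 : 'I_1) i).

Lemma is_derive_translate f x v c (df : R) :
  is_derive (x + c) v f df -> is_derive x v (fun y => f (y + c)) df.
Proof.
move=> [fx <-].
have E : (fun h => h^-1 *: (((fun y => f (y + c)) \o shift x) (h *: v) - f (x + c))) =
     (fun h => h^-1 *: ((f \o shift (x + c)) (h *: v) - f (x + c))).
  by apply/funext => h /=; rewrite addrA.
by apply: DeriveDef; rewrite /derivable ?/derive E.
Qed.

Lemma is_derive_coord x v i : is_derive x v (fun y => y 0 i : R) (v 0 i).
Proof.
have E : (fun h : R => h^-1 *: (((fun y => y 0 i : R) \o shift x) (h *: v) - x 0 i))
   @ 0^' --> v 0 i.
  apply: cvg_near_cst; near=> h => /=.
  rewrite !mxE addrK -[LHS]/(h^-1 * (h * v 0 i)) mulrA mulVf ?mul1r //.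
  by near: h; exact: nbhs_dnbhs_neq.
apply: DeriveDef; last exact/cvg_lim.
by apply/cvg_ex; exists (v 0 i).
Unshelve. all: by end_near. Qed.

Lemma is_derive_linear (a : 'I_n -> R) x v :
  is_derive x v (fun y => \sum_i a i * y 0 i) (\sum_i a i * v 0 i).
Proof.
have -> : (fun y => \sum_i a i * y 0 i) = (\sum_i (a i \*: (fun y => y 0 i : R))).
  by apply/funext => y; rewrite fct_sumE.
apply: (@is_derive_sum _ _ _ _ _ _ _ (fun i => a i * v 0 i)) => i.
exact: (@is_deriveZ _ _ _ _ (a i) x v _ (is_derive_coord x v i)).
Qed.

(** The first-order remainder has small partial derivatives near x, hence a small
    Lipschitz constant there. *)
Lemma C1_near_linear (U : set 'rV[R]_n) f x : open U -> Ck U 1 f -> U x ->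
  forall eta : R, 0 < eta -> \forall y \near x,
  `|f y - f x - \sum_i pder [:: i] f x * (y - x) 0 i| <= eta * `|y - x|.
Proof.
move=> oU fC Ux eta eta0.
pose eta' := eta / n.+1%:R.
have eta'0 : 0 < eta' by rewrite divr_gt0.
have : \forall y \near x, U y /\
    forall i : 'I_n, `|pder [:: i] f x - pder [:: i] f y| < eta'.
  have Hc : \forall y \near x, forall i : 'I_n, `|pder [:: i] f x - pder [:: i] f y| < eta'.
    apply: (@filter_forall _ _ _ (nbhs x)) => i.
    have [] := fC [:: i] => /(_ isT _ Ux) ci _.
    by move/cvgrPdist_lt : ci; exact.
  near=> y; split; last by near: y.
  by near: y; exact: open_nbhs_nbhs.
move=> /nbhs_ballP[r /= r0 Hr].
apply/nbhs_ballP; exists r => //= y yr.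
pose g y := f y - \sum_i pder [:: i] f x * y 0 i.
have -> : f y - f x - \sum_i pder [:: i] f x * (y - x) 0 i = g y - g x.
  rewrite /g (_ : \sum_i _ * (y - x) 0 i =
    \sum_i pder [:: i] f x * y 0 i - \sum_i pder [:: i] f x * x 0 i).
    by ring.
  by rewrite -sumrB; apply: eq_bigr => i _; rewrite !mxE mulrBr.
have dg z : `|z - x| < r -> forall i,
    is_derive z (e_ i) g (pder [:: i] f z - pder [:: i] f x) /\
    `|pder [:: i] f z - pder [:: i] f x| <= eta'.
  move=> zr i; have [Uz Hz] : U z /\ forall i : 'I_n, `|pder [:: i] f x - pder [:: i] f z| < eta'.
    by apply: Hr; rewrite -ball_normE /= distrC.
  split; last by rewrite distrC ltW.
  have fz : is_derive z (e_ i) f (pder [:: i] f z).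
    by apply: derivableP; have [_] := fC [::]; apply.
  have lz := is_derive_linear (fun i => pder [:: i] f x) z (e_ i).
  apply: (is_derive_eq (is_deriveB fz lz)); congr (_ - _).
  rewrite (bigD1 i) //= mxE !eqxx mulr1 big1 ?addr0 // => j ji.
  by rewrite mxE eqxx /= (negbTE ji) mulr0.
have := coord_lipschitz dg (x := x) (y := y).
rewrite subrr normr0 => /(_ r0); rewrite (distrC y x).
move: yr; rewrite -ball_normE /= => yr /(_ yr) /le_trans; apply.
rewrite ler_wpM2r // /eta' mulrCA ler_piMr ?(ltW eta0) //.
by rewrite ler_pdivrMr // mul1r ler_nat.
Unshelve. all: by end_near. Qed.

(** Only partial derivatives are given, so the chain rule goes through the
    first-order remainder estimate. *)
Lemma is_derive_curve (U : set 'rV[R]_n) f (c : R -> 'rV[R]_n) (c' : 'rV[R]_n) t :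
  open U -> Ck U 1 f -> U (c t) ->
  (forall i, is_derive t 1 (fun s => c s 0 i) (c' 0 i)) ->
  is_derive t 1 (f \o c) (\sum_i pder [:: i] f (c t) * c' 0 i).
Proof.
move=> oU fC Uc dc.
have derc : derivable c t 1.
  by apply/derivable_mxP => i j; rewrite (ord1 i); have [] := dc j.
have dcE : 'D_1 c t = c'.
  by rewrite derive_mx //; apply/rowP => i; rewrite mxE; have [_] := dc i.
pose q (h : R) := h^-1 *: (c (h + t) - c t).
have qc : q h @[h --> 0^'] --> c'.
  rewrite -dcE (_ : q = (fun h => h^-1 *: ((c \o shift t) (h *: 1) - c t))) //.
  by apply/funext => h; rewrite /= [h *: 1]mulr1.
have cc : {for t, continuous c}.
  by apply: differentiable_continuous; apply/derivable1_diffP.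
pose a i := pder [:: i] f (c t).
pose rem h := h^-1 * (f (c (h + t)) - f (c t) - \sum_i a i * (c (h + t) - c t) 0 i).
have rem0 : rem h @[h --> 0^'] --> 0.
  apply/cvgr0Pnorm_le => e e0.
  pose eta := e / (`|c'| + 1).
  have eta0 : 0 < eta by rewrite divr_gt0 // ltr_wpDl.
  have C : \forall h \near 0^', `|f (c (h + t)) - f (c t) - \sum_i a i * (c (h + t) - c t) 0 i| <= eta * `|c (h + t) - c t|.
    have := C1_near_linear oU fC Uc eta0.
    have cc0 : c (h + t) @[h --> 0^'] --> c t.
      apply: cvg_trans cc.
      move=> A; rewrite !nbhs_simpl /= => -[d /= d0 dA].
      exists d => //= h; rewrite /ball_ /= sub0r normrN => hd _; apply: dA.
      by rewrite /ball_ /= opprD addrCA subrr addr0 normrN.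
    by move=> /cc0.
  near=> h.
  have h0 : h != 0 by near: h; exact: nbhs_dnbhs_neq.
  have qh : `|q h| <= `|c'| + 1.
    have : `|c' - q h| <= 1 by near: h; move/cvgrPdist_le : qc => /(_ 1 ltr01).
    move=> H; rewrite -(subrK c' (q h)) addrC.
    by apply: le_trans (ler_normD _ _) _; rewrite lerD2l distrC.
  rewrite /rem normrM normfV ler_pdivrMl ?normr_gt0 //.
  apply: le_trans (near C h _) _ => //.
  have -> : c (h + t) - c t = h *: q h by rewrite /q scalerA mulfV // scale1r.
  rewrite normrZ mulrCA ler_wpM2l //.
  by rewrite -ler_pdivlMl // /eta invf_div divfK ?gt_eqF.
have L : h^-1 *: (((f \o c) \o shift t) (h *: 1) - (f \o c) t) @[h --> 0^'] -->
    \sum_i a i * c' 0 i.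
  have -> : (fun h => h^-1 *: (((f \o c) \o shift t) (h *: 1) - (f \o c) t)) =
    (fun h => \sum_i a i * q h 0 i + rem h).
    apply/funext => h /=; rewrite [h *: 1]mulr1 /rem mulrBr mulr_sumr addrCA.
    rewrite (_ : \sum_i a i * q h 0 i = \sum_i h^-1 * (a i * (c (h + t) - c t) 0 i)) ?subrr ?addr0 //.
    by apply: eq_bigr => i _; rewrite /q mxE mulrCA.
  rewrite -[X in _ --> X]addr0; apply: cvgD => //.
  apply: cvg_big => [|i _]; first exact: add_continuous.
  apply: cvgM; first exact: cvg_cst.
  apply: (@cvg_comp _ _ _ q (fun M : 'rV[R]_n => M 0 i) _ _ _ qc).
  exact: coord_continuous.
apply: DeriveDef; last exact/cvg_lim.
by apply/cvg_ex; exists (\sum_i a i * c' 0 i).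
Unshelve. all: by end_near. Qed.

(** Two applications of the mean value theorem, along the i-th axis to the
    increment in the j-th direction, then along the j-th axis. *)
Lemma second_difference (U : set 'rV[R]_n) f x (r : R) (i j : 'I_n) :
  0 < r -> (forall y, `|y - x| < 3 * r -> U y) -> Ck U 2 f ->
  exists2 z, `|z - x| < 3 * r &
   f (x + r *: e_ i + r *: e_ j) - f (x + r *: e_ i) - (f (x + r *: e_ j) - f x)
   = r * (r * pder [:: j; i] f z).
Proof.
move=> r0 BU fC.
have near2 (s t : R) : 0 <= s <= 1 -> 0 <= t <= 1 ->
    `|x + s *: (r *: e_ i) + t *: (r *: e_ j) - x| < 3 * r.
  move=> /andP[s0 s1] /andP[t0 t1].
  rewrite addrAC [x + _]addrC addrK.
  apply: le_lt_trans (ler_normD _ _) _.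
  have ne k : `|e_ k : 'rV[R]_n| <= 1.
    by apply: rV_norm_le => // l; rewrite mxE; case: (_ && _); rewrite ?normr1 ?normr0.
  rewrite !normrZ !(gtr0_norm r0) (ger0_norm s0) (ger0_norm t0).
  have ra k : r * `|e_ k : 'rV[R]_n| <= r by rewrite ler_piMr // ltW.
  have ra0 k : 0 <= r * `|e_ k : 'rV[R]_n| by rewrite mulr_ge0 // ltW.
  have le1 (c : R) k : 0 <= c -> c <= 1 -> c * (r * `|e_ k : 'rV[R]_n|) <= r.
    by move=> c0 c1; apply: le_trans (ra k); rewrite ler_piMl.
  by have := le1 s i s0 s1; have := le1 t j t0 t1; lra.
have df y k : U y -> is_derive y (e_ k) f (pder [:: k] f y).
  by move=> Uy; apply: derivableP; have [_] := fC [::]; apply.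
have ddf y k l : U y -> is_derive y (e_ k) (pder [:: l] f) (pder [:: k; l] f y).
  by move=> Uy; apply: derivableP; have [_] := fC [:: l]; apply.
have D1 (s : R) : 0 <= s <= 1 ->
   is_derive (x + s *: (r *: e_ i)) (r *: e_ i) (fun y => f (y + r *: e_ j) - f y)
    (r * (pder [:: i] f (x + s *: (r *: e_ i) + r *: e_ j) - pder [:: i] f (x + s *: (r *: e_ i)))).
  move=> s01; apply: is_derive_dirZ.
  have h1 := near2 s 1 s01; have h0 := near2 s 0 s01.
  rewrite scale1r lexx ler01 in h1; rewrite scale0r addr0 lexx ler01 in h0.
  apply: is_deriveB; last exact/df/BU/h0.
  exact/is_derive_translate/df/BU/h1.
have [s /andP[s0 s1] E1] := line_MVT_der D1.
have s01 : 0 <= s <= 1 by rewrite !ltW.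
have D2 (t : R) : 0 <= t <= 1 ->
   is_derive (x + s *: (r *: e_ i) + t *: (r *: e_ j)) (r *: e_ j) (pder [:: i] f)
     (r * pder [:: j; i] f (x + s *: (r *: e_ i) + t *: (r *: e_ j))).
  by move=> t01; apply: is_derive_dirZ; exact/ddf/BU/near2.
have [t /andP[t0 t1] E2] := line_MVT_der D2.
exists (x + s *: (r *: e_ i) + t *: (r *: e_ j)).
  by apply: near2 => //; rewrite !ltW.
by rewrite -E2 -E1.
Qed.

(** Schwarz's theorem, by writing a second difference in two ways. *)
Lemma pder_swap (U : set 'rV[R]_n) f x (i j : 'I_n) :
  open U -> Ck U 2 f -> U x -> pder [:: i; j] f x = pder [:: j; i] f x.
Proof.
move=> oU fC Ux; apply/eqP; rewrite -subr_eq0 -normr_le0.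
apply/ler_addgt0Pl => e e0; rewrite addr0.
have e20 : 0 < e / 2 by rewrite divr_gt0.
have cont k l : \forall y \near x, `|pder [:: k; l] f x - pder [:: k; l] f y| < e / 2.
  have [] := fC [:: k; l] => /(_ isT _ Ux) ci _.
  by move/cvgrPdist_lt : ci; exact.
have : \forall y \near x, [/\ U y, `|pder [:: i; j] f x - pder [:: i; j] f y| < e / 2
   & `|pder [:: j; i] f x - pder [:: j; i] f y| < e / 2].
  have c0 : \forall y \near x, U y by exact: open_nbhs_nbhs.
  by apply: filterS3 c0 (cont i j) (cont j i) => y.
move=> /nbhs_ballP[d /= d0]; rewrite -ball_normE => Hd.
pose r := d / 3.
have r0 : 0 < r by rewrite divr_gt0.
have rd y : `|y - x| < 3 * r -> `|x - y| < d.
  by rewrite distrC /r mulrC divfK.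
have BU y : `|y - x| < 3 * r -> U y by move=> /rd /Hd[].
have [z1 /rd /Hd[_ h1 _] E1] := @second_difference U f x r j i r0 BU fC.
have [z2 /rd /Hd[_ _ h2] E2] := @second_difference U f x r i j r0 BU fC.
have E : pder [:: i; j] f z1 = pder [:: j; i] f z2.
  apply: (mulfI (lt0r_neq0 r0)); apply: (mulfI (lt0r_neq0 r0)).
  have C : x + r *: e_ j + r *: e_ i = x + r *: e_ i + r *: e_ j by rewrite addrAC.
  rewrite C in E1.
  apply: etrans (esym E1) _; apply: etrans _ E2.
  set a := f _; set b := f _; set c := f (_ + _); set d' := f x.
  by rewrite opprB addrACA [in RHS]opprB [in RHS]addrACA [- c + _]addrC.
have {}h2 : `|pder [:: j; i] f x - pder [:: i; j] f z1| < e / 2 by rewrite E.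
rewrite [e]splitr; apply: le_trans (ler_distD (pder [:: i; j] f z1) _ _) _.
by apply: lerD; [exact: ltW h1|rewrite distrC; exact: ltW h2].
Qed.

(** If d2 were positive, dh would be positive just to the right of 0, where h would
    then increase. *)
Lemma max_derive2 (h dh : R -> R) (d2 r : R) : 0 < r ->
  (forall t : R, `|t| < r -> is_derive t 1 h (dh t)) -> is_derive (0 : R) 1 dh d2 ->
  (forall t, `|t| < r -> h t <= h 0) -> dh 0 = 0 /\ d2 <= 0.
Proof.
move=> r0 hd [ddh dE] hmax.
have itvE t : t \in `](- r), r[%R -> `|t| < r by rewrite in_itv /= ltr_norml.
have dh0 : dh 0 = 0.
  have r00 : 0 \in `](- r), r[%R by rewrite in_itv /= oppr_lt0 r0.
  have rr : - r <= r by rewrite ge0_cp // ltW.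
  have dd t : t \in `](- r), r[%R -> derivable h t 1 by move=> /itvE /hd[].
  have mm t : t \in `](- r), r[%R -> h t <= h 0 by move=> /itvE /hmax.
  have [_ E] := derive1_at_max rr dd r00 mm.
  have r0' : `|0 : R| < r by rewrite normr0.
  by have [_ E2] := hd 0 r0'; rewrite -E2 E.
split=> //; rewrite leNgt; apply/negP => d2pos.
have : h^-1 *: ((dh \o shift 0) (h *: 1) - dh 0) @[h --> 0^'] --> d2.
  by rewrite -dE; exact: ddh.
move=> /cvgrPdist_lt /(_ _ d2pos).
rewrite /= => -[e /= e0 He].
pose m := Num.min e r.
have m0 : 0 < m by rewrite lt_min e0.
have dpos t : 0 < t -> t < m -> 0 < dh t.
  rewrite lt_min => t0 /andP[te tr].
  have := He t; rewrite /ball_ /= sub0r normrN gtr0_norm // => /(_ te (lt0r_neq0 t0)).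
  rewrite [t *: 1]mulr1 addr0 dh0 subr0 => H.
  have : 0 < t^-1 * dh t.
    by move: H; rewrite ltr_norml => /andP[_]; rewrite gtrBl.
  by rewrite pmulr_rgt0 ?invr_gt0.
have m20 : 0 < m / 2 by rewrite divr_gt0.
have m2m : m / 2 < m by rewrite ltr_pdivrMr // mulr_natr mulr2n ltrDl.
have mr : m <= r by rewrite ge_min lexx orbT.
have tr t : 0 <= t -> t <= m / 2 -> `|t| < r.
  by move=> t0 tm; rewrite ger0_norm // (le_lt_trans tm) // (lt_le_trans m2m).
have [|c|c] := @MVT R h dh 0 (m / 2) m20.
- by move=> t; rewrite in_itv /= => /andP[t0 t1]; apply/hd/tr; rewrite ltW.
- apply: derivable_within_continuous => t; rewrite in_itv /= => /andP[t0 t1].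
  by have [] := hd t (tr _ t0 t1).
- rewrite in_itv /= subr0 => /andP[c0 c1] E.
  have := hmax (m / 2) (tr _ (ltW m20) (lexx _)).
  rewrite -subr_le0 E leNgt mulr_gt0 // dpos //.
  exact: lt_trans m2m.
Qed.

End Calculus.

(** * Jets and maximum principles *)

Section Jets.
Context {R : realType} {n : nat}.
Implicit Types (x y z : 'rV[R]_n) (f u v w : 'rV[R]_n -> R)
  (g : 'rV[R]_n -> 'rV[R]_n) (l : 'rV[R]_n -> R) (K V U : set 'rV[R]_n).
Local Notation e_ i := (delta_mx (0 : 'I_1) i).

(** The pair (g, l) is the gradient and the Laplacian of f on V; only
    differentiability along the coordinate axes is involved, which is all that
    the maximum principle uses. *)
Definition has_jet V f g l := forall x, V x ->
  exists h : 'I_n -> R, [/\ forall i, is_derive x (e_ i) f (g x 0 i),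
    forall i, is_derive x (e_ i) (fun y => g y 0 i) (h i) & l x = \sum_i h i].

Lemma jet_subset V V' f g l : V' `<=` V -> has_jet V f g l -> has_jet V' f g l.
Proof. by move=> VV' J x /VV'; exact: J. Qed.

Lemma jet_cst V (c : R) : has_jet V (fun=> c) (fun=> 0) (fun=> 0).
Proof.
move=> x _; exists (fun=> 0); split=> [i|i|]; last by rewrite big1.
  by rewrite mxE; exact: is_derive_cst.
by rewrite (_ : (fun _ => _) = cst 0) //; [exact: is_derive_cst|apply/funext => y; rewrite mxE].
Qed.

Lemma jet_lin V (a b : R) f1 g1 l1 f2 g2 l2 :
  has_jet V f1 g1 l1 -> has_jet V f2 g2 l2 ->
  has_jet V (fun x => a * f1 x + b * f2 x) (fun x => a *: g1 x + b *: g2 x)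
    (fun x => a * l1 x + b * l2 x).
Proof.
move=> J1 J2 x Vx; have [h1 [d1 dd1 ->]] := J1 x Vx; have [h2 [d2 dd2 ->]] := J2 x Vx.
exists (fun i => a * h1 i + b * h2 i); split=> [i|i|].
- rewrite !mxE.
  exact: (is_deriveD (is_deriveZ a (d1 i)) (is_deriveZ b (d2 i))).
- rewrite (_ : (fun y => _) = (a \*: (fun y => g1 y 0 i)) + (b \*: (fun y => g2 y 0 i))).
    exact: (is_deriveD (is_deriveZ a (dd1 i)) (is_deriveZ b (dd2 i))).
  by apply/funext => y; rewrite !mxE.
- by rewrite big_split /= -!mulr_sumr.
Qed.

Lemma jet_sqr V f g l : has_jet V f g l ->
  has_jet V (fun x => f x ^+ 2) (fun x => (2 * f x) *: g x)
    (fun x => 2 * f x * l x + 2 * \sum_i g x 0 i ^+ 2).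
Proof.
move=> J x Vx; have [h [d dd ->]] := J x Vx.
exists (fun i => 2 * f x * h i + 2 * g x 0 i ^+ 2); split=> [i|i|].
- have := is_deriveM (d i) (d i).
  rewrite (_ : (f * f) = (fun x => f x ^+ 2)); last by apply/funext => y; rewrite expr2.
  move=> D; apply: (is_derive_eq D).
  by rewrite !mxE -[_ *: _]/(_ * _); ring.
- have := is_deriveM (is_deriveZ 2 (d i)) (dd i).
  rewrite (_ : _ * _ = (fun y => ((2 * f y) *: g y) 0 i)); last by apply/funext => y; rewrite mxE.
  move=> D; apply: (is_derive_eq D).
  by rewrite /GRing.scale /= -[2 *: f x]/(2 * f x); ring.
- by rewrite big_split /= -!mulr_sumr.
Qed.

Definition sqdist z x : R := \sum_i (x 0 i - z 0 i) ^+ 2.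

Lemma jet_sqdist V z : has_jet V (sqdist z) (fun x => 2 *: (x - z)) (fun=> 2 * n%:R).
Proof.
move=> x _.
have dc i k : is_derive x (e_ i) (fun y => y 0 k - z 0 k : R) ((i == k)%:R : R).
  have := is_deriveB (is_derive_coord x (e_ i) k) (is_derive_cst (z 0 k) x (e_ i)).
  by move=> D; apply: (is_derive_eq D); rewrite subr0 mxE eqxx eq_sym.
exists (fun=> 2); split=> [i|i|].
- have := is_derive_sum (fun k => is_deriveM (dc i k) (dc i k)).
  rewrite (_ : \sum_k _ = sqdist z).
    move=> D; apply: (is_derive_eq D); rewrite !mxE (bigD1 i) //= big1 ?addr0.
      by rewrite eqxx /GRing.scale /=; ring.
    by move=> k ki; rewrite eq_sym (negbTE ki) !scaler0 addr0.
  by apply/funext => y; rewrite fct_sumE /sqdist; apply: eq_bigr => k _; rewrite expr2.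
- have := is_deriveZ 2 (dc i i).
  rewrite (_ : _ \*: _ = (fun y => (2 *: (y - z)) 0 i)); last by apply/funext => y; rewrite !mxE.
  by move=> D; apply: (is_derive_eq D); rewrite eqxx -[_ *: _]/(_ * _) mulr1.
- by rewrite sumr_const card_ord mulr_natr.
Qed.

Lemma jet_Ck U u : Ck U 2 u -> has_jet U u (grad u) (laplacian u).
Proof.
move=> uC x Ux; exists (fun i => pder [:: i; i] u x); split=> // i.
  by rewrite mxE; apply: derivableP; have [_] := uC [::]; apply.
rewrite (_ : (fun y => _) = pder [:: i] u); last by apply/funext => y; rewrite mxE.
by apply: derivableP; have [_] := uC [:: i]; apply.
Qed.

Lemma jet_max V f g l x : open V -> has_jet V f g l -> V x ->
  (forall y, V y -> f y <= f x) -> g x = 0 /\ l x <= 0.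
Proof.
move=> oV J Vx fx.
have /nbhs_ballP[r /= r0 rV] : nbhs x V by exact: open_nbhs_nbhs.
have H i d2 : is_derive x (e_ i) (fun y => g y 0 i) d2 -> g x 0 i = 0 /\ d2 <= 0.
  move=> dd.
  have inV (t : R) : `|t| < r -> V (x + t *: e_ i).
    move=> tr; apply: rV; rewrite -ball_normE /= opprD addrA subrr sub0r normrN.
    apply: rV_norm_lt => // k; rewrite !mxE eqxx normrM.
    by apply: le_lt_trans tr; rewrite ler_piMr //; case: (_ == _); rewrite ?normr1 ?normr0.
  have := @max_derive2 R (fun t => f (x + t *: e_ i)) (fun t => g (x + t *: e_ i) 0 i) d2 r r0.
  rewrite scale0r addr0; apply.
  - move=> t /inV Vt; apply: is_derive_line; have [h [+ _ _]] := J _ Vt; exact.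
  - apply: (@is_derive_line _ _ (fun y => g y 0 i) x (e_ i) 0).
    by rewrite scale0r addr0.
  - by move=> t /inV /fx.
have [h [_ dd ->]] := J x Vx; split.
  by apply/rowP => i; rewrite mxE; have [] := H i _ (dd i).
by apply: sumr_le0 => i _; have [] := H i _ (dd i).
Qed.

Lemma bool_max K (f : bool -> 'rV[R]_n -> R) : K !=set0 -> compact K ->
  (forall j, {within K, continuous (f j)}) ->
  exists j c, K c /\ forall j' t, K t -> f j' t <= f j c.
Proof.
move=> K0 cK cf.
have H j : exists2 c, K c & forall t, K t -> f j t <= f j c.
  have [c cK' cm] := compact_EVT_max K0 cK (cf j).
  by exists c; [rewrite inE in cK'|move=> t Kt; apply: cm; rewrite inE].
have [ct Kt mt] := H true; have [cf' Kf mf] := H false.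
have [tf|ft] := leP (f true ct) (f false cf').
  exists false, cf'; split=> // -[] t Kt'; last exact: mf.
  exact: le_trans (mt _ Kt') tf.
exists true, ct; split=> // -[] t Kt'; first exact: mt.
exact: le_trans (mf _ Kt') (ltW ft).
Qed.

(** Comparison for the weakly coupled system. At the largest value of w_j - u_j
    over both components, w_j - w_k >= u_j - u_k, so the monotone penalty of w
    dominates the one of u. *)
Lemma system_comparison K V (Ham : bool -> 'rV[R]_n -> 'rV[R]_n -> R)
    (psi : bool -> 'rV[R]_n -> R) (gam : R -> R) (eps : R)
    (u w : bool -> 'rV[R]_n -> R) gu lu gw lw :
  0 < eps -> {homo gam : s t / s <= t} ->
  compact K -> open V -> V `<=` K ->
  (forall j, {within K, continuous (u j)}) ->
  (forall j, {within K, continuous (w j)}) ->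
  (forall j, has_jet V (u j) (gu j) (lu j)) ->
  (forall j, has_jet V (w j) (gw j) (lw j)) ->
  (forall j x, V x -> u j x + Ham j x (gu j x)
     + gam ((u j x - u (~~ j) x - psi j x) / eps) = eps * lu j x) ->
  (forall j x, V x -> w j x + Ham j x (gw j x)
     + gam ((w j x - w (~~ j) x - psi j x) / eps) < eps * lw j x) ->
  (forall j x, K x -> ~ V x -> w j x <= u j x) ->
  forall j x, K x -> w j x <= u j x.
Proof.
move=> eps0 gam_homo cK oV VK cu cw Ju Jw equ subw bd j x Kx.
pose f j x := w j x - u j x.
have cf j' : {within K, continuous (f j')}.
  by move=> y; apply: continuousB; [exact: cw|exact: cu].
have [i [c [Kc cm]]] : exists i c, K c /\ forall j' t, K t -> f j' t <= f i c.
  by apply: bool_max => //; exists x.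
rewrite -subr_le0; apply: le_trans (cm j x Kx) _.
rewrite leNgt; apply/negP => fpos.
have Vc : V c by apply: contrapT => /(bd i c Kc); rewrite -subr_le0 leNgt fpos.
have [y Vy|/eqP gE lE] := jet_max oV (jet_lin 1 (-1) (Jw i) (Ju i)) Vc.
  by rewrite !mul1r !mulN1r; exact/cm/VK.
have {}gE : gw i c = gu i c by apply/eqP; rewrite -subr_eq0; move: gE; rewrite scale1r scaleN1r.
rewrite mul1r mulN1r subr_le0 in lE.
have := subw i c Vc; rewrite ltNge => /negP; apply.
apply: (@le_trans _ _ (eps * lu i c)); first by rewrite ler_pM2l.
rewrite -equ // -gE; apply: lerD.
  by rewrite lerD2r -subr_ge0 ltW.
apply: gam_homo; rewrite ler_pM2r ?invr_gt0 // lerD2r.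
by have := cm (~~ i) c Kc; rewrite /f !lerBlDr => H; lra.
Qed.

(** At a positive maximum of u - w the gradients agree and the Laplacians are
    ordered, which the strict inequality for w forbids. *)
Lemma scalar_comparison K V (Ham : 'rV[R]_n -> 'rV[R]_n -> R) (eps : R)
    u w gu lu gw lw :
  0 < eps -> compact K -> open V -> V `<=` K ->
  {within K, continuous u} -> {within K, continuous w} ->
  has_jet V u gu lu -> has_jet V w gw lw ->
  (forall x, V x -> u x + Ham x (gu x) <= eps * lu x) ->
  (forall x, V x -> eps * lw x < w x + Ham x (gw x)) ->
  (forall x, K x -> ~ V x -> u x <= w x) ->
  forall x, K x -> u x <= w x.
Proof.
move=> eps0 cK oV VK cu cw Ju Jw subu supw bd x Kx.
have cf : {within K, continuous (fun x => u x - w x)}.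
  by move=> y; apply: continuousB; [exact: cu|exact: cw].
have [c Kc cm] : exists2 c, c \in K & forall t, t \in K -> u t - w t <= u c - w c.
  by apply: compact_EVT_max => //; exists x.
rewrite inE in Kc.
rewrite -subr_le0; apply: le_trans (cm x _) _; first by rewrite inE.
rewrite leNgt; apply/negP => fpos.
have Vc : V c by apply: contrapT => /(bd c Kc); rewrite -subr_le0 leNgt fpos.
have [y Vy|/eqP gE lE] := jet_max oV (jet_lin 1 (-1) Ju Jw) Vc.
  by rewrite !mul1r !mulN1r; apply: cm; rewrite inE; exact: VK.
have {}gE : gu c = gw c by apply/eqP; rewrite -subr_eq0; move: gE; rewrite scale1r scaleN1r.
rewrite mul1r mulN1r subr_le0 in lE.
have := supw c Vc; rewrite ltNge => /negP; apply.
apply: (@le_trans _ _ (eps * lu c)); last by rewrite ler_pM2l.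
apply: le_trans (subu c Vc).
by rewrite -gE lerD2r -subr_ge0 ltW.
Qed.

End Jets.

(** * The domain, its boundary, and functions smooth up to it *)

Section Topology.
Context {R : realType} {n : nat}.
Implicit Types (x y z : 'rV[R]_n) (f u : 'rV[R]_n -> R) (K V U : set 'rV[R]_n).

Lemma dist_continuous z : continuous (fun x : 'rV[R]_n => `|x - z|).
Proof.
move=> x; apply/(@cvgrPdist_lt _ _ _ (nbhs x) (nbhs_filter x)) => e e0; apply/nbhs_ballP; exists e => //= y.
rewrite -ball_normE /=; apply: le_lt_trans.
by rewrite (le_trans (ler_dist_dist _ _)) // opprB addrA subrK.
Qed.

Lemma closed_rV_ball z (r : R) : closed [set x : 'rV[R]_n | `|x - z| <= r].
Proof.
have -> : [set x : 'rV[R]_n | `|x - z| <= r] = (fun x => `|x - z|) @^-1` [set t | t <= r] by [].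
by apply: closed_comp; [move=> x _; exact: dist_continuous|exact: closed_le].
Qed.

Lemma compact_bound (T : topologicalType) (K : set T) (f : T -> R) : compact K -> {within K, continuous f} ->
  exists C : R, 0 < C /\ forall t, K t -> `|f t| <= C.
Proof.
move=> cK cf; have := compact_bounded (continuous_compact cf cK).
move=> [M [Mr HM]].
exists (`|M| + 1); split; first by rewrite ltr_wpDl.
move=> t Kt; apply: HM; last by exists t.
by rewrite (le_lt_trans (ler_norm M)) // ltrDl.
Qed.

Lemma within_continuous_near K f x0 : {within K, continuous f} -> K x0 ->
  forall e : R, 0 < e -> \forall x \near x0, K x -> `|f x - f x0| < e.
Proof.
move=> /subspace_continuousP /(_ x0) cf Kx e e0.
have /cvgrPdist_lt /(_ _ e0) := cf Kx.
by rewrite near_withinE; apply: filterS => y + Ky => /(_ Ky); rewrite distrC.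
Qed.

Section Domain.
Context (U : set 'rV[R]_n) (oU : open U) (bU : bounded_set U).

Lemma boundaryE : boundary U = closure U `\` U.
Proof. by have /interior_id UE := oU; rewrite /boundary UE. Qed.

Lemma closure_inside_or_boundary x : closure U x -> U x \/ boundary U x.
Proof. by rewrite boundaryE => cx; case: (pselect (U x)); [left|right]. Qed.

Lemma boundary_closure x : boundary U x -> closure U x.
Proof. by move=> []. Qed.

Lemma domain_bounded : exists M : R, 0 < M /\ forall x, closure U x -> `|x| <= M.
Proof.
have [M [Mr HM]] := bU.
exists (`|M| + 1); split; first by rewrite ltr_wpDl.
move=> x; have : closure U `<=` [set y : 'rV[R]_n | `|y - 0| <= `|M| + 1].
  rewrite [X in _ `<=` X](_ : _ = closure [set y : 'rV[R]_n | `|y - 0| <= `|M| + 1]); last first.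
    by apply/closure_id/closed_rV_ball.
  apply: closure_subset => y Uy /=; rewrite subr0; apply: HM => //.
  by rewrite (le_lt_trans (ler_norm M)) // ltrDl.
by move=> H /H /=; rewrite subr0.
Qed.

Lemma compact_closure : compact (closure U).
Proof.
apply: bounded_closed_compact; last exact: closed_closure.
have [M [M0 HM]] := domain_bounded.
exists M; split; first exact: gtr0_real.
by move=> r Mr x /HM /le_trans; apply; exact: ltW.
Qed.

Lemma compact_boundary : compact (boundary U).
Proof.
apply: (@subclosed_compact _ _ (closure U)).
- by rewrite boundaryE setDE; apply: closedI; [exact: closed_closure|rewrite closedC].
- exact: compact_closure.
- by move=> x [].
Qed.

(** z is a point of the complement nearest to x: it exists by compactness, and
    the segment from x to z approaches it from inside U. *)
Lemma nearest_boundary_point x : (0 < n)%N -> U x ->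
  exists z, [/\ boundary U z, 0 < `|x - z| & forall y, `|y - x| < `|x - z| -> U y].
Proof.
move=> n0 Ux; have [M [M0 HM]] := domain_bounded.
pose p : 'rV[R]_n := const_mx (M + 1).
have pU : ~ U p.
  move=> Up; have := HM p (subset_closure Up); apply/negP; rewrite -ltNge.
  apply: lt_le_trans (rV_coord_le p (Ordinal n0)); rewrite mxE.
  by rewrite ger0_norm ?ltrDl // addr_ge0 // ltW.
pose K := ~` U `&` [set y : 'rV[R]_n | `|y - x| <= `|p - x|].
have cK : compact K.
  apply: bounded_closed_compact; last first.
    by apply: closedI; [rewrite closedC|exact: closed_rV_ball].
  exists (`|p - x| + `|x|); split; first exact: ger0_real.
  move=> r hr y [_ /= yp]; apply/ltW; apply: le_lt_trans hr.
  by rewrite -{1}(subrK x y); apply: le_trans (ler_normD _ _) _; rewrite lerD2r.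
have cf : {within K, continuous (fun y : 'rV[R]_n => `|y - x|)}.
  exact/continuous_subspaceT/dist_continuous.
have [|z zK zm] := compact_EVT_min _ cK cf.
  by exists p; split => //=.
rewrite inE in zK; case: zK => zU zp.
have dpos : 0 < `|x - z| by rewrite normr_gt0 subr_eq0; apply/eqP => E; apply: zU; rewrite -E.
have inU y : `|y - x| < `|x - z| -> U y.
  move=> yz; apply: contrapT => nUy.
  have : K y.
    split=> //=; apply: ltW; apply: lt_le_trans yz _; rewrite distrC; exact: zp.
  move=> Ky; have := zm y; rewrite inE => /(_ Ky); rewrite leNgt => /negP; apply.
  by rewrite (distrC z x).
exists z; split=> //; rewrite boundaryE; split=> // B /nbhs_ballP[r /= r0 rB].
pose d := `|x - z|.
pose s := Num.min (r / d) 1 / 2.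
have s0 : 0 < s by rewrite divr_gt0 // lt_min ltr01 divr_gt0.
have s1 : s <= 1 / 2 by rewrite ler_pM2r ?invr_gt0 // ge_min lexx orbT.
have sr : s * d < r.
  have : s < r / d.
    apply: (@lt_le_trans _ _ (Num.min (r / d) 1)); last by rewrite ge_min lexx.
    by rewrite ltr_pdivrMr // mulr_natr mulr2n ltrDl lt_min ltr01 divr_gt0.
  by rewrite ltr_pdivlMr.
exists (z + s *: (x - z)); split.
  apply: inU; rewrite (_ : _ - x = (1 - s) *: (z - x)).
    rewrite normrZ (distrC z x) gtr0_norm; last by lra.
    by rewrite gtr_pMl //; lra.
  by rewrite scalerBl scale1r -[x - z]opprB scalerN addrAC.
apply: rB; rewrite -ball_normE /= opprD addrA subrr sub0r normrN normrZ gtr0_norm //.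
Qed.

End Domain.

Section ClosureExtension.
Context (U : set 'rV[R]_n) (oU : open U).

Lemma closure_ext_inside f x : U x -> {for x, continuous f} -> closure_ext U f x = f x.
Proof.
move=> Ux cf; rewrite /closure_ext.
have -> : within U (nbhs x) = nbhs x.
  apply/seteqP; split=> A; rewrite /within /=.
    move=> HA; have : nbhs x U by exact: open_nbhs_nbhs.
    by move=> HU; near=> y; have := near HA y; apply => //; exact: (near HU y).
  by apply: filterS => y.
exact/cvg_lim.
Unshelve. all: by end_near. Qed.

Lemma Ck_continuous k f s : Ck U k f -> (size s <= k)%N ->
  forall x, U x -> {for x, continuous (pder s f)}.
Proof. by move=> /(_ s)[+ _] sk; apply. Qed.

Lemma Ck_closure_pderE k f s x : Ck_closure U k f -> (size s <= k)%N -> U x ->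
  closure_ext U (pder s f) x = pder s f x.
Proof. by case=> fC _ _ sk Ux; apply: closure_ext_inside => //; exact: (Ck_continuous fC). Qed.

Lemma Ck_closure_continuous k f : Ck_closure U k f -> {within closure U, continuous f}.
Proof.
case=> _ /(_ [::] isT) cf fE.
apply: subspace_eq_continuous cf => x; rewrite inE => /fE /= E.
exact: E.
Qed.

Lemma Ck_closure_near k f s x0 : Ck_closure U k f -> (size s <= k)%N -> closure U x0 ->
  forall e : R, 0 < e ->
  \forall x \near x0, U x -> `|pder s f x - closure_ext U (pder s f) x0| < e.
Proof.
move=> fC sk cx e e0; have [_ /(_ s sk) cf _] := fC.
have := within_continuous_near cf cx e0; apply: filterS => x + Ux.
by move=> /(_ (subset_closure Ux)); rewrite (Ck_closure_pderE fC).
Qed.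

Lemma Ck_closure_bounded k f s : bounded_set U -> Ck_closure U k f -> (size s <= k)%N ->
  exists C : R, 0 < C /\ forall x, U x -> `|pder s f x| <= C.
Proof.
move=> bU fC sk; have [_ /(_ s sk) cf _] := fC.
have [C [C0 HC]] := compact_bound (compact_closure bU) cf.
exists C; split=> // x Ux; rewrite -(Ck_closure_pderE fC sk Ux).
exact/HC/subset_closure.
Qed.

End ClosureExtension.
End Topology.

(** * The Hamiltonian *)

Section Hamiltonian.
Context {R : realType} {n : nat} (U : set 'rV[R]_n) (oU : open U) (bU : bounded_set U).
Context (H : 'rV[R]_n -> 'rV[R]_n -> R) (HH : hamiltonian_assumptions U H).
Implicit Types (x y z p q : 'rV[R]_n).
Local Notation e_ i := (delta_mx (0 : 'I_1) i).

Local Notation UU := ([set z | U (lsubmx z)] : set 'rV[R]_(n + n)).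
Local Notation Hz := (fun z : 'rV[R]_(n + n) => H (lsubmx z) (rsubmx z)).

Lemma norm2_coord_le p i : `|p 0 i| <= norm2 p.
Proof.
rewrite /norm2 -sqrtr_sqr ler_wsqrtr // (bigD1 i) //= lerDl.
by apply: sumr_ge0 => k _; exact: sqr_ge0.
Qed.

Lemma norm2_ge_norm p : `|p| <= norm2 p.
Proof. by apply: rV_norm_le => [|i]; [exact: sqrtr_ge0|exact: norm2_coord_le]. Qed.

Lemma row_mx_norm_lt x p (d : R) : 0 < d -> `|x| < d -> `|p| < d -> `|row_mx x p| < d.
Proof.
move=> d0 xd pd; apply: rV_norm_lt => // i; rewrite mxE; case: splitP => k _.
  exact: le_lt_trans (rV_coord_le x k) xd.
exact: le_lt_trans (rV_coord_le p k) pd.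
Qed.

Lemma closure_phase_space x p : closure U x -> closure UU (row_mx x p).
Proof.
move=> cx B /nbhs_ballP[r /= r0 rB].
have [y [Uy]] : U `&` ball x r !=set0 by apply: cx; exact: nbhsx_ballx.
rewrite -ball_normE /= => xy.
exists (row_mx y p); split; first by rewrite /= row_mxKl.
apply: rB; rewrite -ball_normE /= opp_row_mx add_row_mx subrr.
by apply: row_mx_norm_lt; rewrite ?normr0.
Qed.

(** Continuity is joint in (x, p) and holds up to the boundary in x, because H is
    its own continuous extension to the closure of the phase space. *)
Lemma ham_continuous x0 p0 : closure U x0 -> forall e : R, 0 < e ->
  exists d : R, 0 < d /\ forall x p, closure U x -> `|x - x0| < d -> `|p - p0| < d ->
  `|H x p - H x0 p0| < e.
Proof.
move=> cx e e0; have [Hs _ _ _] := HH.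
have cH : {within closure UU, continuous Hz}.
  exact: (Ck_closure_continuous (Hs 0%N)).
have := within_continuous_near cH (@closure_phase_space x0 p0 cx) e0.
move=> /nbhs_ballP[d /= d0 Hd]; exists d; split=> // x p cx' xd pd.
have := Hd (row_mx x p); rewrite -ball_normE /= opp_row_mx add_row_mx.
rewrite !row_mxKl !row_mxKr; apply.
  by apply: row_mx_norm_lt; rewrite // distrC.
exact: closure_phase_space.
Qed.

Lemma ham_bounded (P : R) : exists S : R, 0 < S /\
  forall x p, closure U x -> `|p| <= P -> `|H x p| <= S.
Proof.
pose B := [set p : 'rV[R]_n | `|p| <= P].
have cB : compact B.
  apply: bounded_closed_compact.
    exists P; split; first exact: num_real.
    by move=> r Pr p /= /le_trans; apply; exact: ltW.
  have := @closed_rV_ball R n 0 P; congr closed.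
  by apply/seteqP; split=> p /=; rewrite subr0.
have cK := compact_setX (compact_closure bU) cB.
have [|S [S0 HS]] := compact_bound (f := fun xp : 'rV[R]_n * 'rV[R]_n => H xp.1 xp.2) cK.
  apply/subspace_continuousP => -[x p] [/= cx pB].
  apply/cvgrPdist_lt => e e0.
  have [d [d0 Hd]] := ham_continuous p cx e0.
  rewrite near_withinE; apply/nbhs_ballP; exists d => //= -[x' p'] [].
  rewrite -!ball_normE /= => xx pp [cx' _].
  by rewrite distrC; apply: Hd => //; rewrite distrC.
by exists S; split=> // x p cx pP; apply: (HS (x, p)).
Qed.

Lemma ham_coercive (M : R) : 0 <= M -> exists rho : R, 0 < rho /\
  forall x p, closure U x -> rho <= `|p| -> M * `|p| <= H x p.
Proof.
move=> M0; have [_ _ /(_ M)[rho [rho0 Hr]] _] := HH.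
exists (rho + 1); split; first by rewrite addr_gt0.
move=> x p cx pr.
have p2 := norm2_ge_norm p.
have rp : rho < norm2 p by apply: lt_le_trans p2; apply: lt_le_trans pr; rewrite ltrDl.
have := Hr x p cx rp; rewrite ler_pdivlMr; last exact: lt_trans rp.
by apply: le_trans; rewrite ler_wpM2l.
Qed.

(** Convexity replaces a bound on the derivative in p: a small step t q costs at
    most t times the oscillation over the unit step q. *)
Lemma ham_convex x p q (t : R) : closure U x -> 0 <= t -> t <= 1 ->
  H x (p + t *: q) <= H x p + t * (H x (p + q) - H x p).
Proof.
move=> cx t0 t1; have [_ /(_ x cx) Hc _ _] := HH.
have := Hc (Itv01 t0 t1) (p + q) p; rewrite !inE => /(_ I I).
rewrite convRE /= /unstable.onem /conv /= /unstable.onem.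
rewrite (_ : t *: (p + q) + (1 - t) *: p = p + t *: q); last first.
  by rewrite scalerDr scalerBl scale1r addrC addrA subrK.
by move=> /le_trans; apply; rewrite mulrBl mul1r mulrBr; lra.
Qed.

Lemma pder_phase_space x p (k : 'I_n) :
  pder [:: lshift n k] Hz (row_mx x p) = pder [:: k] (fun y => H y p) x.
Proof.
have E : (fun h : R => h^-1 *: ((Hz \o shift (row_mx x p)) (h *: delta_mx 0 (lshift n k)) - Hz (row_mx x p))) =
  (fun h : R => h^-1 *: (((fun y => H y p) \o shift x) (h *: e_ k) - H x p)).
  apply/funext => h /=; rewrite row_mxKl row_mxKr; congr (_ *: (H _ _ - _)).
    by apply/rowP => i; rewrite [LHS]mxE [LHS]mxE row_mxEl !mxE eqxx (inj_eq (@lshift_inj _ _)).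
  apply/rowP => i; rewrite [LHS]mxE [LHS]mxE row_mxEr !mxE eqxx.
  by rewrite eq_rlshift mulr0 add0r.
by rewrite /= /derive E.
Qed.

Lemma ham_Dx_bounded : exists K : R, 0 < K /\
  forall x p (k : 'I_n), U x -> `|pder [:: lshift n k] Hz (row_mx x p)| <= K.
Proof.
have [Hs _ _ [K HK]] := HH.
exists (`|K| + 1); split; first by rewrite ltr_wpDl.
move=> x p k Ux.
have cont : {for x, continuous (pder [:: k] (fun y => H y p))}.
  rewrite (_ : pder [:: k] (fun y => H y p) = fun y => pder [:: lshift n k] Hz (row_mx y p)); last first.
    by apply/funext => y; rewrite pder_phase_space.
  have [HC _ _] := Hs 1%N.
  have Uz : UU (row_mx x p) by rewrite /= row_mxKl.
  have := Ck_continuous HC (s := [:: lshift n k]) isT Uz.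
  move=> /(@cvgrPdist_lt _ _ _ (nbhs (row_mx x p)) (nbhs_filter _)) cH.
  apply/(@cvgrPdist_lt _ _ _ (nbhs x) (nbhs_filter x)) => e e0.
  have /nbhs_ballP[r /= r0 Hr] := cH e e0.
  apply/nbhs_ballP; exists r => //= y; rewrite -ball_normE /= => xy.
  apply: Hr; rewrite -ball_normE /= opp_row_mx add_row_mx subrr.
  by apply: row_mx_norm_lt; rewrite ?normr0.
rewrite pder_phase_space.
have := HK x p (subset_closure Ux).
move=> /(le_trans (norm2_coord_le _ k)); rewrite mxE closure_ext_inside //.
move=> /le_trans; apply.
by rewrite (le_trans (ler_norm K)) // lerDl.
Qed.

Lemma open_phase_space : open UU.
Proof.
rewrite openE => z Uz.
have /nbhs_ballP[r /= r0 rU] : nbhs (lsubmx z) U by exact: open_nbhs_nbhs.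
apply/nbhs_ballP; exists r => //= z'; rewrite -ball_normE /= => zz.
apply: rU; rewrite -ball_normE /=; apply: rV_norm_lt => // i.
by apply: le_lt_trans zz; have := rV_coord_le (z - z') (lshift n i); rewrite !mxE.
Qed.

(** The drift b is the same for every direction k; it has no bound, but multiplies
    the Hessian of u, which contracts to zero against the gradient at a maximum of
    |Du|^2. The x-part a is bounded by [ham_Dx_bounded]. *)
Lemma ham_chain_rule u x : Ck U 2 u -> U x ->
  exists (a b : 'I_n -> R), (forall k, a k = pder [:: lshift n k] Hz (row_mx x (grad u x))) /\
  forall k, is_derive x (e_ k) (fun y => H y (grad u y))
    (a k + \sum_i b i * pder [:: k; i] u x).
Proof.
move=> uC Ux.
exists (fun k => pder [:: lshift n k] Hz (row_mx x (grad u x))).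
exists (fun i => pder [:: rshift n i] Hz (row_mx x (grad u x))); split=> // k.
have [Hs _ _ _] := HH; have [HC _ _] := Hs 1%N.
apply: is_derive_line0.
pose c (t : R) : 'rV[R]_(n + n) := row_mx (x + t *: e_ k) (grad u (x + t *: e_ k)).
pose c' : 'rV[R]_(n + n) := row_mx (e_ k) (\row_i pder [:: k; i] u x).
have c0 : c 0 = row_mx x (grad u x) by rewrite /c scale0r addr0.
have Uc : UU (c 0) by rewrite c0 /UU /= row_mxKl.
have dc i : is_derive (0 : R) 1 (fun s => c s 0 i) (c' 0 i).
  rewrite /c /c' mxE; case: splitP => l il.
    have -> : (fun s : R => row_mx (x + s *: e_ k) (grad u (x + s *: e_ k)) 0 i) =
       (fun s : R => (x + s *: e_ k) 0 l).
      by apply/funext => s; rewrite (_ : i = lshift n l) ?row_mxEl //; exact: val_inj.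
    apply: (@is_derive_line _ _ (fun y => y 0 l)); exact: is_derive_coord.
  have -> : (fun s : R => row_mx (x + s *: e_ k) (grad u (x + s *: e_ k)) 0 i) =
     (fun s : R => pder [:: l] u (x + s *: e_ k)).
    by apply/funext => s; rewrite (_ : i = rshift n l) ?row_mxEr ?mxE //; exact: val_inj.
  rewrite mxE; apply: is_derive_line; rewrite scale0r addr0.
  by apply: derivableP; have [_] := uC [:: l]; apply.
have := is_derive_curve open_phase_space HC Uc dc.
rewrite (_ : Hz \o c = (fun s : R => H (x + s *: e_ k) (grad u (x + s *: e_ k)))); last first.
  by apply/funext => s; rewrite /= /c row_mxKl row_mxKr.
move=> D; apply: (is_derive_eq D).
rewrite c0 big_split_ord /=; congr (_ + _); last first.
  by apply: eq_bigr => i _; rewrite /c' row_mxEr mxE.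
rewrite (bigD1 k) //= big1 ?addr0 /c' ?row_mxEl ?mxE ?eqxx ?mulr1 // => i ik.
by rewrite row_mxEl mxE eqxx (negbTE ik) mulr0.
Qed.

End Hamiltonian.

(** * Charts of the boundary *)

(** The graph description of the boundary turned into a defining function
    sigma = sg (x_i - g(x')), with gradient gs and Laplacian ls; keeping sigma
    rather than g makes the axis and the orientation disappear from most
    arguments. *)
Record boundary_chart (R : realType) (n : nat) (U : set 'rV[R]_n) (x0 : 'rV[R]_n)
    (r L : R) (i : 'I_n) (sg : R) (sigma : 'rV[R]_n -> R)
    (gs : 'rV[R]_n -> 'rV[R]_n) (ls : 'rV[R]_n -> R) : Prop := BoundaryChart {
  chart_r : 0 < r;
  chart_L : 0 < L;
  chart_sg : sg ^+ 2 = 1;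
  chart_in : forall x : 'rV[R]_n, `|x - x0| < r -> U x <-> 0 < sigma x;
  chart_jet : has_jet setT sigma gs ls;
  chart_slope : forall x : 'rV[R]_n, gs x 0 i = sg;
  chart_bounds : forall x : 'rV[R]_n, `|x - x0| < r -> `|gs x| <= L /\ `|ls x| <= L;
  chart_grad_cont : forall e : R, 0 < e -> \forall x \near x0, `|gs x - gs x0| < e;
  chart_cont : continuous sigma;
  chart_axis : forall (x : 'rV[R]_n) (t : R), sigma (x + t *: delta_mx 0 i) = sigma x + sg * t }.

Section ChartExistence.
Context {R : realType} {n : nat}.
Local Notation e_ i := (delta_mx (0 : 'I_1) i).

Lemma is_derive_col' (i : 'I_n) (F : 'rV[R]_n.-1 -> R) (x v : 'rV[R]_n) (df : R) :
  is_derive (col' i x) (col' i v) F df -> is_derive x v (fun y => F (col' i y)) df.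
Proof.
move=> [fx <-].
have E : (fun h : R => h^-1 *: (((fun y => F (col' i y)) \o shift x) (h *: v) - F (col' i x))) =
     (fun h : R => h^-1 *: ((F \o shift (col' i x)) (h *: col' i v) - F (col' i x))).
  apply/funext => h /=; congr (_ *: (F _ - _)).
  by apply/rowP => k; rewrite !mxE.
by apply: DeriveDef; rewrite /derivable ?/derive E.
Qed.

Lemma col'_delta_lift (i : 'I_n) (k : 'I_n.-1) :
  col' i (e_ (lift i k) : 'rV[R]_n) = e_ k.
Proof. by apply/rowP => l; rewrite !mxE eqxx (inj_eq lift_inj). Qed.

Lemma col'_delta_id (i : 'I_n) : col' i (e_ i : 'rV[R]_n) = 0.
Proof. by apply/rowP => l; rewrite !mxE eqxx eq_sym (negbTE (neq_lift _ _)). Qed.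

Lemma continuous_col' (i : 'I_n) (F : 'rV[R]_n.-1 -> R) (x : 'rV[R]_n) :
  {for col' i x, continuous F} -> {for x, continuous (fun y : 'rV[R]_n => F (col' i y))}.
Proof.
move=> /(@cvgrPdist_lt _ _ _ (nbhs (col' i x)) (nbhs_filter _)) cF.
apply/(@cvgrPdist_lt _ _ _ (nbhs x) (nbhs_filter x)) => e e0.
have /nbhs_ballP[d /= d0 Hd] := cF e e0.
apply/nbhs_ballP; exists d => //= y; rewrite -ball_normE /= => xy.
apply: Hd; rewrite -ball_normE /=; apply: rV_norm_lt => // k.
by apply: le_lt_trans xy; have := rV_coord_le (x - y) (lift i k); rewrite !mxE.
Qed.

Lemma continuous_affine (a b : R) (f : 'rV[R]_n -> R) (x : 'rV[R]_n) :
  {for x, continuous f} -> {for x, continuous (fun y : 'rV[R]_n => a * (b - f y))}.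
Proof.
move=> cf.
apply: (@cvgM _ _ (nbhs x) (nbhs_filter x) (cst a) (fun y => b - f y) a (b - f x)).
  exact: (@cvg_cst _ _ _ (nbhs x) (nbhs_filter x)).
apply: (@cvgB _ _ _ (nbhs x) (nbhs_filter x) (cst b) f) => //.
exact: (@cvg_cst _ _ _ (nbhs x) (nbhs_filter x)).
Qed.

Lemma chart_exists (U : set 'rV[R]_n) (x0 : 'rV[R]_n) :
  smooth_boundary U -> boundary U x0 ->
  exists r L i sg sigma gs ls, @boundary_chart R n U x0 r L i sg sigma gs ls.
Proof.
move=> sU bx; have [r [i [s [g [r0 gC UE]]]]] := sU x0 bx.
pose sg : R := (-1) ^+ s.
have sg2 : sg ^+ 2 = 1 by rewrite /sg sqrr_sign.
pose sigma (x : 'rV[R]_n) := sg * (x 0 i - g (col' i x)).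
pose dG (x : 'rV[R]_n) k := if unlift i k is Some k' then pder [:: k'] g (col' i x) else 0.
pose ddG (x : 'rV[R]_n) k := if unlift i k is Some k' then pder [:: k'; k'] g (col' i x) else 0.
pose gs (x : 'rV[R]_n) : 'rV[R]_n := \row_k (sg * ((k == i)%:R - dG x k)).
pose ls (x : 'rV[R]_n) := \sum_k sg * (0 - ddG x k).
have gcont t : continuous (pder t g).
  by move=> y; have [+ _] := gC (size t) t => /(_ (leqnn _) y I).
have gder t k y : is_derive y (e_ k) (pder t g) (pder (k :: t) g y).
  by apply: derivableP; have [_] := gC (size t).+1 t => /(_ (leqnn _) y I k).
have dGd t k (x : 'rV[R]_n) : is_derive x (e_ k) (fun y => pder t g (col' i y))
    (if unlift i k is Some k' then pder (k' :: t) g (col' i x) else 0).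
  apply: is_derive_col'; case: unliftP => [k' ->|->].
    by rewrite col'_delta_lift; exact: gder.
  by rewrite col'_delta_id; exact: is_derive0.
have J : has_jet setT sigma gs ls.
  move=> x _; exists (fun k => sg * (0 - ddG x k)); split=> // k.
    rewrite mxE.
    have D := is_deriveZ sg (is_deriveB (is_derive_coord x (e_ k) i) (dGd [::] k x)).
    by apply: (is_derive_eq D); rewrite mxE eqxx eq_sym.
  rewrite (_ : (fun y => gs y 0 k) = (fun y => sg * ((k == i)%:R - dG y k))); last first.
    by apply/funext => y; rewrite mxE.
  have DG : is_derive x (e_ k) (fun y => dG y k) (ddG x k).
    rewrite /dG /ddG; case E: (unlift i k) => [k'|]; last exact: is_derive_cst.
    by have := dGd [:: k'] k x; rewrite E.
  exact: (is_deriveZ sg (is_deriveB (is_derive_cst ((k == i)%:R : R) x (e_ k)) DG)).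
have gsc k : {for x0, continuous (fun x => gs x 0 k)}.
  rewrite (_ : (fun y => gs y 0 k) = (fun y => sg * ((k == i)%:R - dG y k))); last first.
    by apply/funext => y; rewrite mxE.
  apply: continuous_affine.
  rewrite /dG; case: (unlift i k) => [k'|]; first exact/continuous_col'/gcont.
  exact: (@cvg_cst _ _ _ (nbhs x0) (nbhs_filter x0)).
have lsc : {for x0, continuous ls}.
  apply: (@cvg_big _ _ _ _ _ _ _ (nbhs x0)) => [|k _]; first exact: add_continuous.
  apply: continuous_affine.
  rewrite /ddG; case: (unlift i k) => [k'|]; first exact/continuous_col'/gcont.
  exact: (@cvg_cst _ _ _ (nbhs x0) (nbhs_filter x0)).
have gsn (e : R) : 0 < e -> \forall x \near x0, `|gs x - gs x0| < e.
  move=> e0.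
  have : \forall x \near x0, forall k, `|gs x0 0 k - gs x 0 k| < e.
    apply: (@filter_forall _ _ _ (nbhs x0)) => k.
    have /(@cvgrPdist_lt _ _ _ (nbhs x0) (nbhs_filter _)) := gsc k.
    exact.
  apply: filterS => x Hx; apply: rV_norm_lt => // k.
  by have := Hx k; rewrite distrC !mxE.
have lsn : \forall x \near x0, `|ls x0 - ls x| < 1.
  have /(@cvgrPdist_lt _ _ _ (nbhs x0) (nbhs_filter _)) := lsc.
  by apply.
have : \forall x \near x0, `|gs x - gs x0| < 1 /\ `|ls x0 - ls x| < 1.
  by have := gsn 1 ltr01; apply: filterS2 lsn => x.
move=> /nbhs_ballP[d /= d0 Hd].
exists (Num.min r d), (`|gs x0| + `|ls x0| + 1), i, sg, sigma, gs, ls; split=> //.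
- by rewrite lt_min r0.
- move=> x; rewrite lt_min => /andP[xr _].
  have xb : ball x0 r x by rewrite -ball_normE /= distrC.
  split=> [Ux|sx].
    by have : (U `&` ball x0 r) x by []; rewrite UE => -[].
  by have : (ball x0 r `&` [set x : 'rV[R]_n | 0 < (-1) ^+ s * (x 0 i - g (col' i x))]) x by []; rewrite -UE => -[].
- by move=> x; rewrite mxE eqxx /dG unlift_none subr0 mulr1.
- move=> x; rewrite lt_min => /andP[_ xd].
  have [g1 l1] : `|gs x - gs x0| < 1 /\ `|ls x0 - ls x| < 1.
    by apply: (Hd x); rewrite -ball_normE /= distrC.
  split.
    rewrite -(subrK (gs x0) (gs x)); apply: le_trans (ler_normD _ _) _.
    by move: g1 (normr_ge0 (ls x0)); lra.
  rewrite -(subrK (ls x0) (ls x)); apply: le_trans (ler_normD _ _) _.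
  by rewrite distrC in l1; move: l1 (normr_ge0 (gs x0)); lra.
- move=> x.
  apply: (@cvgM _ _ (nbhs x) (nbhs_filter x) (cst sg) (fun y : 'rV[R]_n => y 0 i - g (col' i y))).
    exact: (@cvg_cst _ _ _ (nbhs x) (nbhs_filter x)).
  apply: (@cvgB _ _ _ (nbhs x) (nbhs_filter x) (fun y : 'rV[R]_n => y 0 i) (fun y => g (col' i y))).
    exact: coord_continuous.
  exact/continuous_col'/(gcont [::]).
- move=> x t; rewrite /sigma (_ : col' i (x + t *: e_ i) = col' i x).
    by rewrite !mxE !eqxx /=; ring.
  apply/rowP => k; have /rowP/(_ k) := col'_delta_id i.
  by rewrite !mxE => ->; rewrite mulr0 addr0.
Qed.

End ChartExistence.

Section Chart.
Context {R : realType} {n : nat} (U : set 'rV[R]_n) (oU : open U).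
Context (x0 : 'rV[R]_n) (r L : R) (i : 'I_n) (sg : R) (sigma : 'rV[R]_n -> R).
Context (gs : 'rV[R]_n -> 'rV[R]_n) (ls : 'rV[R]_n -> R).
Context (C : boundary_chart U x0 r L i sg sigma gs ls).
Implicit Types (x y z : 'rV[R]_n).
Local Notation e_ i := (delta_mx (0 : 'I_1) i).

Lemma chart_sgE : `|sg| = 1.
Proof.
by move/eqP: (chart_sg C); rewrite sqrf_eq1 => /orP[] /eqP ->; rewrite ?normrN normr1.
Qed.

Lemma chart_closure x : closure U x -> `|x - x0| < r -> 0 <= sigma x.
Proof.
move=> cx xr; rewrite leNgt; apply/negP => sx.
have /(@cvgrPdist_lt _ _ _ (nbhs x) (nbhs_filter _)) cs := chart_cont C (x := x).
have d0 : 0 < - sigma x by rewrite oppr_gt0.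
have N1 : \forall y \near x, `|sigma x - sigma y| < - sigma x by exact: cs.
have N2 : \forall y \near x, `|y - x0| < r.
  apply/nbhs_ballP; exists (r - `|x - x0|) => /=; first by rewrite subr_gt0.
  move=> y; rewrite -ball_normE /= => xy.
  rewrite -(subrKA x); apply: le_lt_trans (ler_normD _ _) _.
  by rewrite -ltrBrDr distrC.
have [y [Uy [y1 y2]]] := cx _ (filterI N1 N2).
have /(chart_in C y2) sy := Uy.
by move: y1; rewrite ltr_norml => /andP[y1 _]; move: y1 sy sx; lra.
Qed.

Lemma chart_boundary z : boundary U z -> `|z - x0| < r -> sigma z = 0.
Proof.
rewrite (boundaryE oU) => -[cz Uz] zr; apply/eqP; rewrite eq_le (chart_closure cz) // andbT.
by rewrite leNgt; apply/negP => /(chart_in C zr).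
Qed.

Lemma chart_lipschitz x y : `|x - x0| < r -> `|y - x0| < r ->
  `|sigma y - sigma x| <= n%:R * L * `|y - x|.
Proof.
apply: (@coord_lipschitz _ _ sigma (fun z k => gs z 0 k)) => z zr k.
have [h [d _ _]] := chart_jet C (x := z) I.
split; first exact: d.
by apply: le_trans (rV_coord_le _ _) _; have [] := chart_bounds C zr.
Qed.

End Chart.

(** * Local barriers *)

Section SquaredDistance.
Context {R : realType} {n : nat}.
Implicit Types (x y z : 'rV[R]_n).

Lemma norm_sqr_le x : `|x| ^+ 2 <= \sum_k x 0 k ^+ 2.
Proof.
have S0 : 0 <= \sum_k x 0 k ^+ 2 by apply: sumr_ge0 => k _; exact: sqr_ge0.
have <- : norm2 x ^+ 2 = \sum_k x 0 k ^+ 2 by rewrite /norm2 sqr_sqrtr.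
by rewrite ler_pXn2r ?nnegrE ?norm2_ge_norm ?sqrtr_ge0.
Qed.

Lemma sqdist_ge z x : `|x - z| ^+ 2 <= sqdist z x.
Proof.
apply: le_trans (norm_sqr_le _) _; rewrite le_eqVlt; apply/orP; left; apply/eqP.
by apply: eq_bigr => k _; rewrite !mxE.
Qed.

Lemma sqdist_le z x : sqdist z x <= n%:R * `|x - z| ^+ 2.
Proof.
apply: (@le_trans _ _ (\sum_(k < n) `|x - z| ^+ 2)); last by rewrite sumr_const card_ord mulr_natl.
apply: ler_sum => k _; rewrite -real_normK ?num_real //.
by rewrite ler_pXn2r ?nnegrE //; have := rV_coord_le (x - z) k; rewrite !mxE.
Qed.

Lemma continuous_sqdist z : continuous (sqdist z).
Proof.
move=> x; apply: (@cvg_big _ _ _ _ _ _ _ (nbhs x)) => [|k _]; first exact: add_continuous.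
have cc : {for x, continuous (fun y : 'rV[R]_n => y 0 k - z 0 k)}.
  apply: (@cvgB _ _ _ (nbhs x) (nbhs_filter x) (fun y : 'rV[R]_n => y 0 k) (cst (z 0 k))).
    exact: coord_continuous.
  exact: (@cvg_cst _ _ _ (nbhs x) (nbhs_filter x)).
by apply: (@cvgM _ _ (nbhs x) (nbhs_filter x) (fun y => y 0 k - z 0 k) (fun y => y 0 k - z 0 k)).
Qed.

Lemma continuous_lin (a b : R) (f g : 'rV[R]_n -> R) :
  continuous f -> continuous g -> continuous (fun x => a * f x + b * g x).
Proof.
move=> cf cg x.
have cz (c : R) (h : 'rV[R]_n -> R) : continuous h -> (fun y => c * h y) y @[y --> x] --> c * h x.
  move=> ch; apply: (@cvgM _ _ (nbhs x) (nbhs_filter x) (cst c) h c (h x)); last exact: ch.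
  exact: (@cvg_cst _ _ _ (nbhs x) (nbhs_filter x)).
exact: (@cvgD _ _ _ (nbhs x) (nbhs_filter x) _ _ _ _ (cz a f cf) (cz b g cg)).
Qed.

End SquaredDistance.

(** The local barrier A (sigma - k sigma^2) + B |x - z|^2: the quadratic term
    in sigma makes it as concave as wanted compared to its slope, and the term
    in |x - z|^2 lifts it above 1 away from z. *)
Lemma barrier_exists (R : realType) (n : nat) (U : set 'rV[R]_n)
    (x0 : 'rV[R]_n) (r L : R) (i : 'I_n) (sg : R) (sigma : 'rV[R]_n -> R)
    (gs : 'rV[R]_n -> 'rV[R]_n) (ls : 'rV[R]_n -> R) (m : R) :
  open U -> boundary_chart U x0 r L i sg sigma gs ls -> 0 <= m -> exists rb Cb : R, [/\ 0 < rb, rb <= r, 0 < Cb &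
  forall z : 'rV[R]_n, boundary U z -> `|z - x0| < rb ->
  exists phi gp lp, [/\ continuous phi, has_jet setT phi gp lp &
   forall x : 'rV[R]_n, closure U x -> `|x - z| <= rb ->
    [/\ 0 <= phi x, phi x <= Cb * `|x - z|, `|x - z| = rb -> 1 <= phi x,
        1 <= `|gp x| <= Cb & lp x <= - (m * (1 + `|gp x|))]]].
Proof.
move=> oU C m0.
pose N0 : R := n%:R.
have N0ge : 0 <= N0 by exact: ler0n.
have Lge : 0 <= L by exact: ltW (chart_L C).
have NL : 0 <= N0 * L by exact: mulr_ge0.
(* With 2 k = m + L + 1 the term - 2 k |D sigma|^2 beats the Laplacian of sigma
   and m |D sigma|, as |D sigma| >= 1; on the ball of radius 2 rb, sigma is at
   most 1 / (4 k), so that the slope 1 - 2 k sigma stays above 1/2. *)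
pose k := (m + L + 1) / 2.
have k2 : 2 * k = m + L + 1 by rewrite /k; field.
have kpos : 0 < k by rewrite divr_gt0 //; move: m0 Lge; clear; lra.
pose rb := Num.min (r / 2) (8 * k * (N0 * L + 1))^-1.
have D0 : 0 < 8 * k * (N0 * L + 1).
  apply: mulr_gt0; first by apply: mulr_gt0.
  by move: NL; clear; lra.
have rb0 : 0 < rb by rewrite lt_min divr_gt0 ?(chart_r C) //= invr_gt0.
have rb1 : rb <= r / 2 by rewrite ge_min lexx.
have rb2 : rb * (8 * k * (N0 * L + 1)) <= 1.
  by rewrite -ler_pdivlMr // mul1r ge_min lexx orbT.
pose B := (rb ^+ 2)^-1.
have B0 : 0 < B by rewrite invr_gt0 exprn_gt0.
(* A pays for the Laplacian and the gradient of B |x - z|^2. *)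
pose A := 2 * N0 * B + m * (1 + 2 * B * rb) + 2 + 4 * B * rb.
have Brb : 0 < B * rb by rewrite mulr_gt0.
have NB : 0 <= N0 * B by rewrite mulr_ge0 // ltW.
have mB : 0 <= m * (B * rb) by rewrite mulr_ge0 // ltW.
have A2 : 2 + 4 * (B * rb) <= A.
  by rewrite /A; move: NB mB m0; rewrite mulrDr mulr1 !mulrA; clear; lra.
have A0 : 0 < A by move: A2 Brb; clear; lra.
have AL : 0 <= A * L by rewrite mulr_ge0 // ltW.
have ANL : 0 <= A * (N0 * L) by rewrite mulr_ge0 // ltW.
have NBr : 0 <= N0 * (B * rb) by rewrite mulr_ge0 // ltW.
exists rb, (A * (N0 * L) + N0 * (B * rb) + A * L + 2 * (B * rb) + 1); split=> //.
- by move: rb1 (chart_r C); clear; lra.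
- by move: ANL NBr AL Brb; clear; lra.
move=> z bz zr.
pose phi x := A * (1 * sigma x + (- k) * sigma x ^+ 2) + B * sqdist z x.
have J := jet_lin A B (jet_lin 1 (- k) (chart_jet C) (jet_sqr (chart_jet C))) (@jet_sqdist _ _ setT z).
eexists phi, _, _; split; [|exact: J|].
  apply: continuous_lin; last exact: continuous_sqdist.
  apply: continuous_lin; first exact: chart_cont C.
  move=> x; apply: (@cvgM _ _ (nbhs x) (nbhs_filter x) sigma sigma); exact: (chart_cont C).
move=> x cx xz.
have zr' : `|z - x0| < r by move: zr rb1 (chart_r C); clear; lra.
have xr : `|x - x0| < 2 * rb.
  by have := ler_normD (x - z) (z - x0); rewrite subrKA; move: xz zr; clear; lra.
have xr' : `|x - x0| < r by move: xr rb1; clear; lra.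
have sx0 : 0 <= sigma x := chart_closure C cx xr'.
have sz : sigma z = 0 := chart_boundary oU C bz zr'.
have x00 : `|x0 - x0| < r by rewrite subrr normr0 (chart_r C).
have sxz : sigma x <= N0 * L * `|x - z|.
  by apply: le_trans (chart_lipschitz C zr' xr'); rewrite sz subr0 ler_norm.
have sxk : 4 * (k * sigma x) <= 1.
  have : k * sigma x <= k * (N0 * L * rb).
    by rewrite ler_pM2l //; apply: le_trans sxz _; rewrite ler_wpM2l.
  have : 0 < k * rb by rewrite mulr_gt0.
  have : 0 <= k * (N0 * L * rb) by exact: mulr_ge0 (ltW kpos) (mulr_ge0 NL (ltW rb0)).
  move: rb2; rewrite (_ : rb * _ = 8 * (k * (N0 * L * rb)) + 8 * (k * rb)); last by ring.
  by clear; lra.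
pose t := 1 - 2 * (k * sigma x).
have ks0 : 0 <= k * sigma x by rewrite mulr_ge0 // ltW.
have t1 : 1 / 2 <= t by rewrite /t; move: sxk; clear; lra.
have t2 : t <= 1 by rewrite /t; move: ks0; clear; lra.
have [gL lL] := chart_bounds C xr'.
have E : 1 * sigma x + - k * sigma x ^+ 2 = sigma x * (1 - k * sigma x) by ring.
have s1 : 0 <= sigma x * (1 - k * sigma x) by rewrite mulr_ge0 //; move: sxk ks0; clear; lra.
have s2 : sigma x * (1 - k * sigma x) <= sigma x by rewrite ler_piMr // gerBl.
have As1 : 0 <= A * (sigma x * (1 - k * sigma x)) by rewrite mulr_ge0 // ltW.
have sq0 : 0 <= sqdist z x by apply: le_trans (sqdist_ge z x); exact: exprn_ge0.
have Bsq : 0 <= B * sqdist z x by rewrite mulr_ge0 // ltW.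
have gE : A *: (1 *: gs x + - k *: ((2 * sigma x) *: gs x)) + B *: (2 *: (x - z)) =
   (A * t) *: gs x + (2 * B) *: (x - z).
  rewrite !scalerA -scalerDl scalerA [B * 2]mulrC; congr (_ *: _ + _).
  by rewrite /t; ring.
rewrite gE.
set G := (A * t) *: gs x + (2 * B) *: (x - z).
pose N := `|gs x|.
have N1 : 1 <= N.
  by have := rV_coord_le (gs x) i; rewrite (chart_slope C) (chart_sgE C).
have At0 : 0 <= A * t by rewrite mulr_ge0 //; [exact: ltW|move: t1; clear; lra].
have At1 : A * t <= A by rewrite ler_piMr // ltW.
have At2 : A / 2 <= A * t by rewrite ler_pM2l //; move: t1; clear; lra.
have dB : `|(2 * B) *: (x - z)| <= 2 * (B * rb).
  rewrite normrZ gtr0_norm; last by rewrite mulr_gt0.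
  by rewrite -mulrA ler_pM2l // ler_pM2l.
have GN : `|G| <= A * N + 2 * (B * rb).
  apply: le_trans (ler_normD _ _) _; apply: lerD => //.
  by rewrite normrZ (ger0_norm At0) ler_wpM2r // normr_ge0.
have AN : A * N <= A * L by rewrite ler_pM2l.
have Gge : 1 <= `|G|.
  apply: le_trans (rV_coord_le G i); rewrite mxE mxE (chart_slope C).
  have dBi : `|((2 * B) *: (x - z)) 0 i| <= 2 * (B * rb) by apply: le_trans (rV_coord_le _ _) dB.
  have Ats : `|A * t * sg| = A * t by rewrite normrM (chart_sgE C) mulr1 ger0_norm.
  have := lerB_normD (A * t * sg) (((2 * B) *: (x - z)) 0 i); rewrite Ats.
  by move: At2 A2 dBi Brb; clear; lra.
split.
- by rewrite /phi E addr_ge0.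
- rewrite /phi E.
  have h1 : A * (sigma x * (1 - k * sigma x)) <= A * (N0 * L) * `|x - z|.
    by rewrite -mulrA ler_pM2l //; apply: le_trans s2 sxz.
  have h2 : B * sqdist z x <= N0 * (B * rb) * `|x - z|.
    apply: (@le_trans _ _ (B * (N0 * `|x - z| ^+ 2))); first by rewrite ler_pM2l // sqdist_le.
    rewrite (_ : B * _ = N0 * B * `|x - z| * `|x - z|); last by ring.
    rewrite (_ : N0 * (B * rb) * _ = N0 * B * `|x - z| * rb); last by ring.
    by rewrite ler_wpM2l // mulr_ge0.
  have h3 : 0 <= (A * L + 2 * (B * rb) + 1) * `|x - z|.
    by rewrite mulr_ge0 //; move: AL Brb; clear; lra.
  by rewrite !mulrDl; move: h1 h2 h3; rewrite !mulrDl; clear; lra.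
- move=> xE; rewrite /phi E.
  have : 1 <= B * sqdist z x.
    rewrite /B mulrC ler_pdivlMr ?exprn_gt0 // mul1r -xE; exact: sqdist_ge.
  by move: As1; clear; lra.
- rewrite Gge /=; move: GN AN ANL NBr; clear; lra.
- have SN : N ^+ 2 <= \sum_l gs x 0 l ^+ 2 by exact: norm_sqr_le.
  set S := \sum_l _ in SN *.
  have -> : A * (1 * ls x + - k * (2 * sigma x * ls x + 2 * S)) + B * (2 * n%:R) =
    A * (t * ls x) - A * (2 * k * S) + 2 * N0 * B by rewrite /t /N0; ring.
  have tl : t * ls x <= L.
    apply: le_trans (_ : t * L <= _); last by rewrite ler_piMl.
    by rewrite ler_wpM2l //; [move: t1; clear; lra|apply: le_trans (ler_norm _) lL].
  have Atl : A * (t * ls x) <= A * L by rewrite ler_pM2l.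
  have NN : N <= N ^+ 2 by rewrite expr2 ler_peMr //; move: N1; clear; lra.
  have h : (m + L + 1) * N ^+ 2 - L - m * N >= 1.
    have : m * N <= m * N ^+ 2 by rewrite ler_wpM2l.
    have : L * 1 <= L * N ^+ 2 by rewrite ler_wpM2l //; move: NN N1; clear; lra.
    by move: NN N1; rewrite !mulrDl; clear; lra.
  have hk : (m + L + 1) * N ^+ 2 <= 2 * k * S.
    by rewrite k2 ler_wpM2l //; move: m0 Lge; clear; lra.
  have h5 : A * 1 <= A * (2 * k * S - L - m * N).
    by rewrite ler_pM2l //; move: h hk; clear; lra.
  have h6 : m * `|G| <= m * (A * N + 2 * (B * rb)) by rewrite ler_wpM2l.
  have AE : A = 2 * N0 * B + m + 2 * (m * (B * rb)) + 2 + 4 * (B * rb) by rewrite /A; ring.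
  have {}h5 : A <= A * (2 * k * S) - A * L - m * (A * N).
    by move: h5; rewrite mulr1 !mulrBr [A * (m * N)]mulrCA.
  have {}h6 : m * `|G| <= m * (A * N) + 2 * (m * (B * rb)).
    by move: h6; rewrite mulrDr [m * (2 * _)]mulrCA.
  rewrite mulrDr mulr1.
  move: Atl Brb h5 h6 AE; clear.
  move: (A * (t * ls x)) (A * L) (A * (2 * k * S)) (m * (A * N)) (m * `|G|) (m * (B * rb)) (B * rb) (2 * N0 * B) (A) => a1 a2 a3 a4 a5 a6 a7 a8 a9.
  by lra.
Qed.

(** * Neighbourhoods of boundary points *)

Section LocalRegion.
Context {R : realType} {n : nat} (U : set 'rV[R]_n) (oU : open U) (bU : bounded_set U).
Implicit Types (x y z : 'rV[R]_n).

Definition region z (d : R) : set 'rV[R]_n := closure U `&` [set x : 'rV[R]_n | `|x - z| <= d].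
Definition inner_region z (d : R) : set 'rV[R]_n := U `&` [set x : 'rV[R]_n | `|x - z| < d].

Lemma compact_region z d : compact (region z d).
Proof.
apply: (@subclosed_compact _ _ (closure U)); last by move=> x [].
  by apply: closedI; [exact: closed_closure|exact: closed_rV_ball].
exact: compact_closure.
Qed.

Lemma open_inner_region z d : open (inner_region z d).
Proof.
apply: openI => //.
have [d0|d0] := leP d 0.
  rewrite (_ : [set x : 'rV[R]_n | `|x - z| < d] = set0); first exact: open0.
  by apply/seteqP; split=> // x /= /(le_lt_trans (normr_ge0 _)); rewrite ltNge d0.
rewrite (_ : [set x : 'rV[R]_n | `|x - z| < d] = ball z d); first exact: ball_open.
by apply/seteqP; split=> x; rewrite -ball_normE /= distrC.
Qed.

Lemma inner_region_sub z d : inner_region z d `<=` region z d.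
Proof. by move=> x [Ux xz]; split; [exact: subset_closure|exact: ltW]. Qed.

Lemma region_edge z d x : region z d x -> ~ inner_region z d x ->
  boundary U x \/ `|x - z| = d.
Proof.
move=> [cx /= xd] nx; have [Ux|] := closure_inside_or_boundary oU cx; last by left.
right; apply/eqP; rewrite eq_le xd /= leNgt; apply/negP => xd'.
by apply: nx.
Qed.

Lemma within_region f z d : {within closure U, continuous (f : 'rV[R]_n -> R)} ->
  {within region z d, continuous f}.
Proof. by apply: continuous_subspaceW => x []. Qed.

(** Integrate dF along the axis of the chart, from the boundary point below x up
    to x. The derivative may fail to exist at that point, where F is only
    continuous. *)
Lemma chart_vertical_bound x0 r L i sg sigma gs ls (F : 'rV[R]_n -> R) dF (om : R) :
  boundary_chart U x0 r L i sg sigma gs ls ->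
  {within closure U, continuous F} -> (forall x, boundary U x -> `|x - x0| < r -> F x = 0) ->
  (forall y, U y -> `|y - x0| < r ->
     is_derive y (delta_mx 0 i) F (dF y) /\ `|dF y| <= om) ->
  forall x, U x -> `|x - x0| < r -> `|x - x0| + sigma x < r -> `|F x| <= om * sigma x.
Proof.
move=> C cF F0 dFb x Ux xr0 xr.
have sx : 0 < sigma x by apply/(chart_in C xr0).
pose t := sigma x * sg.
have tn : `|t| = sigma x by rewrite normrM (chart_sgE C) mulr1 gtr0_norm.
pose w : 'rV[R]_n := t *: delta_mx 0 i.
have wn : `|w| <= sigma x.
  apply: rV_norm_le => [|k]; first exact: ltW.
  by rewrite !mxE eqxx normrM tn ler_piMr ?(ltW sx) //; case: (_ == _); rewrite ?normr1 ?normr0.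
pose y := x - w.
have yw (s : R) : y + s *: w = x + (s * t - t) *: delta_mx 0 i.
  by rewrite /y /w scalerBl scalerA -addrA [- _ + _]addrC.
have sy (s : R) : sigma (y + s *: w) = s * sigma x.
  rewrite yw (chart_axis C) /t.
  have -> : sg * (s * (sigma x * sg) - sigma x * sg) = sg ^+ 2 * (s * sigma x - sigma x) by ring.
  by rewrite (chart_sg C); ring.
have yb (s : R) : 0 <= s <= 1 -> `|y + s *: w - x0| < r.
  move=> /andP[s0 s1]; rewrite (_ : y + s *: w - x0 = (x - x0) - (1 - s) *: w); last first.
    by rewrite /y scalerBl scale1r opprB -!addrA; congr (x + _); rewrite addrCA [RHS]addrCA [- w + _]addrC.
  apply: le_lt_trans (ler_normB _ _) _; apply: le_lt_trans xr; rewrite lerD2l.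
  rewrite normrZ ger0_norm ?subr_ge0 //; apply: le_trans wn.
  by rewrite ler_piMl // gerBl.
have yU (s : R) : 0 < s <= 1 -> U (y + s *: w).
  move=> /andP[s0 s1]; have s01 : 0 <= s <= 1 by rewrite ltW.
  by apply/(chart_in C (yb s s01)); rewrite sy mulr_gt0.
have y0 : y = y + 0 *: w by rewrite scale0r addr0.
have nyU : ~ U y.
  have : `|y - x0| < r by rewrite y0 yb // lexx ler01.
  by move=> yr /(chart_in C yr); rewrite y0 sy mul0r ltxx.
have cy : closure U y.
  move=> B /nbhs_ballP[e /= e0 eB].
  pose s := Num.min 1 (e / (sigma x + 1)) .
  have sx1 : 0 < sigma x + 1 by rewrite addr_gt0.
  have s0 : 0 < s by rewrite lt_min ltr01 divr_gt0.
  have s1 : s <= 1 by rewrite ge_min lexx.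
  exists (y + s *: w); split; first by apply: yU; rewrite s0.
  apply: eB; rewrite -ball_normE /= opprD addrA subrr sub0r normrN normrZ gtr0_norm //.
  apply: (@le_lt_trans _ _ (s * sigma x)); first by rewrite ler_pM2l.
  have : s <= e / (sigma x + 1) by rewrite ge_min lexx orbT.
  by rewrite ler_pdivlMr // mulrDr mulr1; move: s0; clear; lra.
have by_ : boundary U y by rewrite (boundaryE oU).
have cyw (s : R) : 0 <= s <= 1 -> closure U (y + s *: w).
  move=> /andP[s0 s1]; move: s0; rewrite le_eqVlt => /predU1P[<-|s0].
    by rewrite -y0.
  by apply/subset_closure/yU; rewrite s0.
have [||s s01] := @line_MVT _ _ F (fun s => t * dF (y + s *: w)) y w.
- move=> s /andP[s0 s1].
  have s01 : 0 <= s <= 1 by rewrite !ltW.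
  have s01' : 0 < s <= 1 by rewrite s0 ltW.
  by apply: is_derive_dirZ; have [] := dFb _ (yU s s01') (yb s s01).
- apply/subspace_continuousP => s; rewrite /= in_itv /= => s01.
  apply/cvgrPdist_lt => e e0.
  have /nbhs_ballP[d /= d0 Hd] := within_continuous_near cF (cyw s s01) e0.
  rewrite near_withinE; apply/nbhs_ballP; exists (d / (sigma x + 1)) => /=.
    by rewrite divr_gt0 // addr_gt0.
  move=> s' /=; rewrite /ball /= => ss; rewrite in_itv /= => s'01.
  rewrite distrC; apply: Hd; last exact: cyw.
  rewrite -ball_normE /= opprD addrACA subrr add0r -scalerBl normrZ.
  move: ss; rewrite ltr_pdivlMr ?addr_gt0 //.
  apply: le_lt_trans; rewrite ler_wpM2l //.
  by apply: le_trans wn _; rewrite lerDl.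
- have -> : y + w = x by rewrite /y subrK.
  have yr : `|y - x0| < r by rewrite y0 yb // lexx ler01.
  rewrite (F0 y by_ yr) subr0 => ->.
  case/andP: s01 => s0 s1.
  have s01 : 0 <= s <= 1 by rewrite !ltW.
  have s01' : 0 < s <= 1 by rewrite s0 ltW.
  rewrite normrM tn mulrC ler_wpM2r ?(ltW sx) //.
  by have [] := dFb _ (yU s s01') (yb s s01).
Qed.

End LocalRegion.

(** * The penalty *)

Section Penalty.
Context {R : realType} (gam : R -> R) (gamP : penalty_function gam).

Lemma penalty_eq0 (s : R) : s <= 0 -> gam s = 0.
Proof. by have [_ _ + _ _] := gamP; apply. Qed.

Lemma penalty_ge0 (s : R) : 0 <= gam s.
Proof.
have [s0|s0] := leP s 0; first by rewrite penalty_eq0.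
by have [_ _ _ /(_ s s0)[/ltW]] := gamP.
Qed.

Lemma penalty_is_derive (s : R) : is_derive s 1 gam (derive1 gam s).
Proof.
have [/(_ 0%N s) d _ _ _ _] := gamP.
by apply: DeriveDef => //; rewrite derive1E.
Qed.

(** For s <= 0 the derivative vanishes because gam attains its minimum there. *)
Lemma penalty_derive_bounds (s : R) : 0 <= derive1 gam s <= 1.
Proof.
have [s0|s0] := leP s 0; last first.
  by have [_ _ _ /(_ s s0)[_ /ltW -> ->]] := gamP.
suff -> : derive1 gam s = 0 by rewrite lexx ler01.
have ab : s - 1 <= s + 1 by rewrite lerD2l -subr_ge0 opprK addr_ge0.
have := @derive1_at_min _ gam (s - 1) (s + 1) s ab.
have der t : t \in `](s - 1), (s + 1)[%R -> derivable gam t 1.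
  by move=> _; have [] := penalty_is_derive t.
have sab : s \in `](s - 1), (s + 1)[%R by rewrite in_itv /= ltrDl gtrBl ltr01.
move=> /(_ der sab) [|_]; last by rewrite derive1E.
by move=> t _; rewrite penalty_eq0 // penalty_ge0.
Qed.

Lemma penalty_MVT (s t : R) : s <= t -> exists2 c, 0 <= c <= 1 & gam t - gam s = c * (t - s).
Proof.
move=> st.
have [||c _ ->] := @MVT_segment _ gam (derive1 gam) s t st.
- by move=> x _; exact: penalty_is_derive.
- apply: derivable_within_continuous => x _.
  by have [] := penalty_is_derive x.
- by exists (derive1 gam c); first exact: penalty_derive_bounds.
Qed.

Lemma penalty_homo : {homo gam : s t / s <= t}.
Proof.
move=> s t st; have [c /andP[c0 _] E] := penalty_MVT st.
by rewrite -subr_ge0 E mulr_ge0 // subr_ge0.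
Qed.

Lemma penalty_lipschitz (s t : R) : `|gam t - gam s| <= `|t - s|.
Proof.
wlog st : s t / s <= t.
  by move=> W; have [/W//|/ltW/W] := leP s t; rewrite distrC [leRHS]distrC.
have [c /andP[c0 c1] ->] := penalty_MVT st.
by rewrite normrM ger0_norm // ler_piMl.
Qed.

(** gam is 1-Lipschitz and vanishes on the negative half-line, so an upper bound
    of b alone controls the effect of changing eps. *)
Lemma penalty_rescale (b D es eps : R) : 0 < es -> es / 2 <= eps -> 0 <= D -> b <= D ->
  gam (b / eps) <= gam (b / es) + 2 * D / es ^+ 2 * `|eps - es|.
Proof.
move=> es0 he D0 bD.
have eps0 : 0 < eps by apply: lt_le_trans he; rewrite divr_gt0.
have rhs0 : 0 <= 2 * D / es ^+ 2 * `|eps - es|.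
  by rewrite !mulr_ge0 // invr_ge0 exprn_ge0 // ltW.
have [b0|b0] := leP b 0.
  rewrite [gam (b / eps)]penalty_eq0; first by rewrite addr_ge0 // penalty_ge0.
  by rewrite pmulr_lle0 // invr_gt0.
rewrite -lerBlDl; apply: le_trans (ler_norm _) _; apply: le_trans (penalty_lipschitz _ _) _.
have -> : b / eps - b / es = b / (eps * es) * (es - eps) by field; rewrite !gt_eqF.
rewrite normrM distrC ler_wpM2r // ger0_norm; last first.
  by rewrite divr_ge0 ?(ltW b0) // mulr_ge0 // ltW.
rewrite ler_pdivrMr ?mulr_gt0 //.
have -> : 2 * D / es ^+ 2 * (eps * es) = D * (2 * eps / es) by field; rewrite gt_eqF.
apply: le_trans bD _; rewrite ler_peMr // ler_pdivlMr // mul1r mulrC -ler_pdivrMr //.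
Qed.

End Penalty.

(** The strict inequality behind continuity in eps: the slack m (1 + N) of the
    barrier pays for the convexity error 2 S N and for the change of eps. *)
Lemma perturbation_arith (R : realType)
  (v Hw Hv gw gv lv lphi phi th m N S D1 D2 eps es : R) :
  0 < th -> 0 <= N -> 0 <= S -> 0 <= phi -> 0 <= m ->
  Hw <= Hv + 2 * S * (th * N) -> v + Hv + gv = es * lv ->
  gw <= gv + D1 * `|eps - es| -> `|lv| <= D2 -> (D1 + D2) * `|eps - es| < th ->
  lphi <= - (m * (1 + N)) -> 0 < es -> es / 2 <= eps -> es / 2 * m = 2 * S + 1 ->
  (v - th * phi) + Hw + gw < eps * (lv - th * lphi).
Proof.
move=> th0 N0 S0 phi0 m0 hH hE hg hl hD hphi es0 hes hm.
have h1 : - (D2 * `|eps - es|) <= (eps - es) * lv.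
  rewrite lerNl; apply: le_trans (ler_norm _) _.
  by rewrite normrN normrM mulrC ler_wpM2r.
have eps0 : 0 < eps by apply: lt_le_trans hes; rewrite divr_gt0.
have h2 : eps * (th * (m * (1 + N))) <= - (eps * (th * lphi)).
  by rewrite -mulrN ler_pM2l // -mulrN ler_pM2l // -lerNr.
have h3 : es / 2 * (th * (m * (1 + N))) <= eps * (th * (m * (1 + N))).
  by rewrite ler_wpM2r // mulr_ge0 ?(ltW th0) // mulr_ge0 // addr_ge0.
have h4 : es / 2 * (th * (m * (1 + N))) = (2 * S + 1) * (th * (1 + N)) by rewrite -hm; ring.
have h5 : 0 <= th * phi by rewrite mulr_ge0 // ltW.
have h6 : 0 <= th * N by rewrite mulr_ge0 // ltW.
have h7 : 0 <= S * th by rewrite mulr_ge0 // ltW.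
have h8 : (2 * S + 1) * (th * (1 + N)) = 2 * S * (th * N) + th + 2 * (S * th) + th * N by ring.
have h9 : eps * (lv - th * lphi) = es * lv + (eps - es) * lv - eps * (th * lphi) by ring.
rewrite h9 -hE; rewrite h4 h8 in h3; rewrite mulrDl in hD.
move: hH hg hD h1 h2 h3 h5 h6 h7; clear.
by lra.
Qed.

(** * Comparison principles and the sup bound *)

(** The components are indexed by a boolean, ~~ j being the other component, so
    that each argument serves both equations. *)
Definition solves (R : realType) (n : nat) (U : set 'rV[R]_n)
    (H : bool -> 'rV[R]_n -> 'rV[R]_n -> R) (psi : bool -> 'rV[R]_n -> R)
    (gam : R -> R) (eps : R) (v : bool -> 'rV[R]_n -> R) : Prop :=
  forall j, [/\ smooth_closure U (v j),
    forall x, U x -> v j x + H j x (grad (v j) x)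
      + gam ((v j x - v (~~ j) x - psi j x) / eps) = eps * laplacian (v j) x &
    forall x, boundary U x -> v j x = 0].

Lemma bool_uniform (R : realType) (P : bool -> R -> Prop) :
  (forall j C C', C <= C' -> P j C -> P j C') ->
  (forall j, exists C, 0 < C /\ P j C) -> exists C, 0 < C /\ forall j, P j C.
Proof.
move=> mono ex; have [C1 [C10 P1]] := ex true; have [C2 [C20 P2]] := ex false.
exists (C1 + C2); split=> [|[]]; first exact: addr_gt0.
  by apply: mono P1; rewrite lerDl ltW.
by apply: mono P2; rewrite lerDr ltW.
Qed.

Lemma ord_uniform (R : realType) (n : nat) (P : 'I_n -> R -> Prop) :
  (forall j C C', C <= C' -> P j C -> P j C') ->
  (forall j, exists C, 0 < C /\ P j C) -> exists C, 0 < C /\ forall j, P j C.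
Proof.
move=> mono /choice[c Hc]; exists (1 + \sum_j c j); split.
  by rewrite ltr_pwDl // sumr_ge0 // => j _; have [/ltW] := Hc j.
move=> j; have [cj] := Hc j; apply: mono.
rewrite (bigD1 j) //= addrCA lerDl addr_ge0 // sumr_ge0 // => k _.
by have [/ltW] := Hc k.
Qed.

Section SmoothBounds.
Context {R : realType} {n : nat} (U : set 'rV[R]_n) (oU : open U) (bU : bounded_set U).

Lemma grad_bounded f : Ck_closure U 1 f ->
  exists C : R, 0 < C /\ forall x, U x -> `|grad f x| <= C.
Proof.
move=> fC.
have [|i|C [C0 HC]] := @ord_uniform R n (fun i C => forall x, U x -> `|pder [:: i] f x| <= C).
- by move=> i C C' CC HC x /HC /le_trans; apply.
- exact: (Ck_closure_bounded oU bU fC).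
- exists C; split=> // x Ux; apply: rV_norm_le => [|i]; first exact: ltW.
  by rewrite mxE; exact: HC.
Qed.

Lemma laplacian_bounded f : Ck_closure U 2 f ->
  exists C : R, 0 < C /\ forall x, U x -> `|laplacian f x| <= C.
Proof.
move=> fC.
have [|i|C [C0 HC]] := @ord_uniform R n (fun i C => forall x, U x -> `|pder [:: i; i] f x| <= C).
- by move=> i C C' CC HC x /HC /le_trans; apply.
- exact: (Ck_closure_bounded oU bU fC).
- exists (1 + \sum_(i < n) C); split.
    by rewrite ltr_pwDl // sumr_ge0 // => *; exact: ltW.
  move=> x Ux; apply: le_trans (ler_norm_sum _ _ _) _.
  by apply: ler_wpDl => //; apply: ler_sum => i _; exact: HC.
Qed.

End SmoothBounds.

Section Bounds.
Context {R : realType} {n : nat} (U : set 'rV[R]_n) (oU : open U) (bU : bounded_set U).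
Context (H : bool -> 'rV[R]_n -> 'rV[R]_n -> R) (psi : bool -> 'rV[R]_n -> R) (gam : R -> R).
Context (HH : forall j, hamiltonian_assumptions U (H j)) (gamP : penalty_function gam).
Context (psi_ge0 : forall j x, closure U x -> 0 <= psi j x).
Implicit Types (x y z p : 'rV[R]_n) (v w : bool -> 'rV[R]_n -> R).

Lemma solves_jet eps v j : solves U H psi gam eps v ->
  has_jet U (v j) (grad (v j)) (laplacian (v j)).
Proof. by move=> /(_ j)[/(_ 2%N)[vC _ _] _ _]; exact: jet_Ck. Qed.

Lemma solves_continuous eps v j : solves U H psi gam eps v ->
  {within closure U, continuous (v j)}.
Proof. by move=> /(_ j)[/(_ 0%N) vC _ _]; exact: Ck_closure_continuous vC. Qed.

Lemma solves_boundary eps v j x : solves U H psi gam eps v -> boundary U x -> v j x = 0.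
Proof. by move=> /(_ j)[_ _]; apply. Qed.

Lemma solves_eq eps v j x : solves U H psi gam eps v -> U x ->
  v j x + H j x (grad (v j) x)
      + gam ((v j x - v (~~ j) x - psi j x) / eps) = eps * laplacian (v j) x.
Proof. by move=> /(_ j)[_ + _]; apply. Qed.

Lemma solves_subsolution eps v j x : solves U H psi gam eps v -> U x ->
  v j x + H j x (grad (v j) x) <= eps * laplacian (v j) x.
Proof.
move=> sv Ux; rewrite -(solves_eq j sv Ux) lerDl; exact: (penalty_ge0 gamP).
Qed.

Lemma ham_bounded2 (P : R) : exists S : R, 0 < S /\
  forall j x p, closure U x -> `|p| <= P -> `|H j x p| <= S.
Proof.
apply: (@bool_uniform R (fun j S => forall x p, closure U x -> `|p| <= P -> `|H j x p| <= S)).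
  by move=> j C C' CC HC x p cx pP; apply: le_trans CC; exact: HC.
by move=> j; exact: (ham_bounded bU (HH j) P).
Qed.

Lemma ham_coercive2 (M : R) : 0 <= M -> exists rho : R, 0 < rho /\
  forall j x p, closure U x -> rho <= `|p| -> M * `|p| <= H j x p.
Proof.
move=> M0.
apply: (@bool_uniform R (fun j rho => forall x p, closure U x -> rho <= `|p| -> M * `|p| <= H j x p)).
  by move=> j C C' CC HC x p cx pP; apply: HC => //; exact: le_trans pP.
by move=> j; exact: (ham_coercive (HH j) M0).
Qed.

(** On the edge |x - z| = d of the region the order has to be known beforehand; on
    the boundary of U it follows from the boundary values. *)
Lemma local_lower_comparison eps v w gw lw z d :
  0 < eps -> solves U H psi gam eps v ->
  (forall j, {within region U z d, continuous (w j)}) ->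
  (forall j, has_jet (inner_region U z d) (w j) (gw j) (lw j)) ->
  (forall j x, U x -> `|x - z| < d -> w j x + H j x (gw j x)
     + gam ((w j x - w (~~ j) x - psi j x) / eps) < eps * lw j x) ->
  (forall j x, boundary U x -> `|x - z| <= d -> w j x <= 0) ->
  (forall j x, closure U x -> `|x - z| = d -> w j x <= v j x) ->
  forall j x, closure U x -> `|x - z| <= d -> w j x <= v j x.
Proof.
move=> eps0 sv cw Jw subw bd1 bd2 j x cx xd.
apply: (@system_comparison _ _ (region U z d) (inner_region U z d) H psi gam eps v w
  (fun j => grad (v j)) (fun j => laplacian (v j)) gw lw) => //.
- exact: penalty_homo.
- exact: compact_region.
- exact: open_inner_region.
- exact: inner_region_sub.
- by move=> k; apply: within_region; exact: solves_continuous sv.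
- by move=> k; apply: jet_subset (solves_jet k sv) => y [].
- by move=> k y [Uy _]; exact: solves_eq.
- by move=> k y [Uy yd]; exact: subw.
- move=> k y Ky nVy; have [cy yd] := Ky.
  have [by_|yE] := region_edge oU Ky nVy; last exact: bd2.
  by rewrite (solves_boundary k sv by_) bd1.
Qed.

Lemma global_lower_comparison eps v w gw lw :
  0 < eps -> solves U H psi gam eps v ->
  (forall j, {within closure U, continuous (w j)}) ->
  (forall j, has_jet U (w j) (gw j) (lw j)) ->
  (forall j x, U x -> w j x + H j x (gw j x)
     + gam ((w j x - w (~~ j) x - psi j x) / eps) < eps * lw j x) ->
  (forall j x, boundary U x -> w j x <= 0) ->
  forall j x, closure U x -> w j x <= v j x.
Proof.
move=> eps0 sv cw Jw subw bd1 j x cx.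
apply: (@system_comparison _ _ (closure U) U H psi gam eps v w
  (fun j => grad (v j)) (fun j => laplacian (v j)) gw lw) => //.
- exact: penalty_homo.
- exact: compact_closure.
- exact: subset_closure.
- by move=> k; exact: solves_continuous sv.
- by move=> k; exact: solves_jet sv.
- by move=> k y Uy; exact: solves_eq.
- move=> k y cy nUy; have [//|by_] := closure_inside_or_boundary oU cy.
  by rewrite (solves_boundary k sv by_) bd1.
Qed.

(** Large constants are strict sub- and supersolutions: the lower one makes the
    penalty vanish because psi is nonnegative, and the penalty helps the upper
    one. *)
Lemma sup_bound : exists C0 : R, 0 < C0 /\ forall eps v, 0 < eps ->
  solves U H psi gam eps v -> forall j x, closure U x -> `|v j x| <= C0.
Proof.
have [S [S0 HS]] := ham_bounded2 0.
have HS0 j x : closure U x -> `|H j x 0| <= S by move=> cx; apply: HS; rewrite ?normr0.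
exists (S + 1); split; first by rewrite addr_gt0.
move=> eps v eps0 sv j x cx; rewrite ler_norml; apply/andP; split.
  apply: (@global_lower_comparison eps v (fun=> cst (- (S + 1))) (fun=> fun=> 0) (fun=> fun=> 0)) => //.
  - by move=> k; exact/continuous_subspaceT/cst_continuous.
  - by move=> k; exact: jet_cst.
  - move=> k y Uy; have cy := subset_closure Uy.
    rewrite (penalty_eq0 gamP); last first.
      by rewrite subrr sub0r mulNr oppr_le0 divr_ge0 ?psi_ge0 // ltW.
    have := HS0 k y cy; rewrite ler_norml => /andP[_ h].
    by rewrite mulr0 /=; move: h; lra.
  - by move=> k y _ /=; rewrite oppr_le0 addr_ge0 // ltW.
apply: (@scalar_comparison _ _ (closure U) U (H j) eps (v j) (cst (S + 1))
   (grad (v j)) (laplacian (v j)) (fun=> 0) (fun=> 0)) => //.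
- exact: compact_closure.
- exact: subset_closure.
- exact: solves_continuous sv.
- exact/continuous_subspaceT/cst_continuous.
- exact: solves_jet sv.
- exact: jet_cst.
- by move=> y Uy; exact: solves_subsolution.
- move=> y Uy; have cy := subset_closure Uy.
  have := HS0 j y cy; rewrite ler_norml => /andP[h _].
  by rewrite mulr0 /=; move: h; lra.
- move=> y cy nUy; have [//|by_] := closure_inside_or_boundary oU cy.
  by rewrite (solves_boundary j sv by_) /= addr_ge0 // ltW.
Qed.

End Bounds.

(** * Boundary barriers for all eps and for large eps *)

Section BoundaryBarriers.
Context {R : realType} {n : nat} (U : set 'rV[R]_n) (oU : open U) (bU : bounded_set U).
Context (sU : smooth_boundary U).
Context (H : bool -> 'rV[R]_n -> 'rV[R]_n -> R) (psi : bool -> 'rV[R]_n -> R) (gam : R -> R).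
Context (HH : forall j, hamiltonian_assumptions U (H j)) (gamP : penalty_function gam).
Context (psi_ge0 : forall j x, closure U x -> 0 <= psi j x).
Implicit Types (x y z p : 'rV[R]_n) (v w : bool -> 'rV[R]_n -> R).

Lemma jet_scale (V : set 'rV[R]_n) (a : R) f g l : has_jet V f g l ->
  has_jet V (fun x => a * f x) (fun x => a *: g x) (fun x => a * l x).
Proof.
move=> J; have := jet_lin a 0 J J; congr has_jet; apply/funext => x.
- by rewrite mul0r addr0.
- by rewrite scale0r addr0.
- by rewrite mul0r addr0.
Qed.

Lemma far_bound (C0 d c : R) x z : 0 < d -> 0 <= C0 -> c <= C0 -> d <= `|x - z| ->
  c <= C0 / d * `|x - z|.
Proof.
move=> d0 C00 cC dx; apply: le_trans cC _.
rewrite -mulrA ler_peMr // -(mulVf (lt0r_neq0 d0)).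
by rewrite ler_pM2l // invr_gt0.
Qed.

(** A multiple of the barrier is a strict supersolution for every eps at once: it
    is superharmonic, and its slope is large enough for H to be positive. *)
Lemma upper_bound_local x0 : boundary U x0 -> exists C d : R, [/\ 0 < C, 0 < d &
  forall eps v z, 0 < eps -> solves U H psi gam eps v -> boundary U z -> `|z - x0| < d ->
  forall j x, U x -> v j x <= C * `|x - z|].
Proof.
move=> bx0.
have [r [L [i [sg [sigma [gs [ls C]]]]]]] := chart_exists sU bx0.
have [rb [Cb [rb0 rbr Cb0 Hb]]] := barrier_exists oU C (lexx 0).
have [C0 [C00 HC0]] := sup_bound oU bU HH gamP psi_ge0.
have [rho [rho0 Hrho]] := ham_coercive2 HH ler01.
pose Lam := C0 + rho + 1.
have Lam0 : 0 < Lam by rewrite /Lam !addr_gt0.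
have LamC : C0 <= Lam by rewrite /Lam -addrA lerDl addr_ge0 // ltW.
have Lamr : rho <= Lam by rewrite /Lam [C0 + _]addrC -addrA lerDl addr_ge0 // ltW.
exists (Lam * Cb + C0 / rb), rb; split=> //.
  by rewrite addr_gt0 // ?divr_gt0 // mulr_gt0.
move=> eps v z eps0 sv bz zx0 j x Ux.
have [phi [gp [lp [cphi Jphi Hphi]]]] := Hb z bz zx0.
have cx := subset_closure Ux.
have [xz|xz] := leP `|x - z| rb; last first.
  apply: le_trans (far_bound rb0 (ltW C00) _ (ltW xz)) _.
    by apply: le_trans (ler_norm _) _; exact: (HC0 eps v eps0 sv j x cx).
  by rewrite ler_wpM2r // lerDr mulr_ge0 ?ltW.
have [_ phiC _ _ _] := Hphi x cx xz.
apply: (@le_trans _ _ (Lam * phi x)); last first.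
  apply: (@le_trans _ _ (Lam * (Cb * `|x - z|))); first by rewrite ler_pM2l.
  by rewrite mulrA ler_wpM2r // lerDl divr_ge0 ?ltW.
apply: (@scalar_comparison _ _ (region U z rb) (inner_region U z rb) (H j) eps (v j)
   (fun x => Lam * phi x) (grad (v j)) (laplacian (v j)) (fun x => Lam *: gp x) (fun x => Lam * lp x)) => //.
- exact: compact_region.
- exact: open_inner_region.
- exact: inner_region_sub.
- by apply: within_region; exact: solves_continuous sv.
- apply: continuous_subspaceT => y.
  apply: (@cvgM _ _ (nbhs y) (nbhs_filter y) (cst Lam) phi); last exact: cphi.
  exact: (@cvg_cst _ _ _ (nbhs y) (nbhs_filter y)).
- by apply: jet_subset (solves_jet j sv) => y [].
- by apply: jet_scale; apply: jet_subset Jphi.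
- by move=> y [Uy _]; exact: (solves_subsolution gamP j sv Uy).
- move=> y Vy; have [cy yd] := inner_region_sub Vy.
  have [phi0 _ _ /andP[g1 _] l1] := Hphi y cy yd.
  have N : `|Lam *: gp y| = Lam * `|gp y| by rewrite normrZ gtr0_norm.
  have LN : Lam <= `|Lam *: gp y| by rewrite N ler_peMr // ltW.
  have := Hrho j y (Lam *: gp y) cy (le_trans Lamr LN); rewrite mul1r => hH.
  have h1 : eps * (Lam * lp y) <= 0.
    rewrite pmulr_rle0 // pmulr_rle0 //; apply: le_trans l1 _.
    by rewrite mul0r oppr0.
  have h2 : 0 <= Lam * phi y by rewrite mulr_ge0 // ltW.
  apply: le_lt_trans h1 _; apply: ltr_wpDl => //.
  by apply: lt_le_trans hH; exact: lt_le_trans LN.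
- move=> y Ky nVy; have [cy yd] := Ky.
  have [phi0 _ phi1 _ _] := Hphi y cy yd.
  have [by_|yE] := region_edge oU Ky nVy.
    by rewrite (solves_boundary j sv by_) mulr_ge0 // ltW.
  apply: le_trans (ler_norm _) _; apply: le_trans (HC0 eps v eps0 sv j y cy) _.
  by apply: le_trans LamC _; rewrite ler_peMr ?phi1 // ltW.
Qed.

(** For large eps the Laplacian of a fixed barrier dominates the Hamiltonian. *)
Lemma lower_bound_large x0 : boundary U x0 -> exists C d E : R, [/\ 0 < C, 0 < d, 0 < E &
  forall eps v z, E < eps -> solves U H psi gam eps v -> boundary U z -> `|z - x0| < d ->
  forall j x, U x -> - (C * `|x - z|) <= v j x].
Proof.
move=> bx0.
have [r [L [i [sg [sigma [gs [ls C]]]]]]] := chart_exists sU bx0.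
have [rb [Cb [rb0 rbr Cb0 Hb]]] := barrier_exists oU C ler01.
have [C0 [C00 HC0]] := sup_bound oU bU HH gamP psi_ge0.
pose Lam := C0 + 1.
have Lam0 : 0 < Lam by rewrite /Lam !addr_gt0.
have Lam1 : 1 <= Lam by rewrite /Lam lerDr ltW.
have LamC : C0 <= Lam by rewrite /Lam lerDl.
have [S [S0 HS]] := ham_bounded2 bU HH (Lam * Cb).
exists (Lam * Cb + C0 / rb), rb, S; split=> //.
  by rewrite addr_gt0 // ?divr_gt0 // mulr_gt0.
move=> eps v z Eeps sv bz zx0 j x Ux.
have eps0 : 0 < eps by apply: lt_trans Eeps.
have [phi [gp [lp [cphi Jphi Hphi]]]] := Hb z bz zx0.
have cx := subset_closure Ux.
have [xz|xz] := leP `|x - z| rb; last first.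
  rewrite lerNl.
  apply: le_trans (far_bound rb0 (ltW C00) _ (ltW xz)) _.
    by apply: le_trans (ler_norm _) _; rewrite normrN; exact: (HC0 eps v eps0 sv j x cx).
  by rewrite ler_wpM2r // lerDr mulr_ge0 ?ltW.
have [_ phiC _ _ _] := Hphi x cx xz.
apply: (@le_trans _ _ (- Lam * phi x)).
  rewrite mulNr lerN2; apply: (@le_trans _ _ (Lam * (Cb * `|x - z|))); first by rewrite ler_pM2l.
  by rewrite mulrA ler_wpM2r // lerDl divr_ge0 ?ltW.
apply: (@local_lower_comparison _ _ _ oU bU H psi gam gamP eps v (fun=> fun x => - Lam * phi x)
   (fun=> fun x => - Lam *: gp x) (fun=> fun x => - Lam * lp x) z rb) => //.
- move=> _; apply: continuous_subspaceT => y.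
  apply: (@cvgM _ _ (nbhs y) (nbhs_filter y) (cst (- Lam)) phi); last exact: cphi.
  exact: (@cvg_cst _ _ _ (nbhs y) (nbhs_filter y)).
- by move=> _; apply: jet_scale; apply: jet_subset Jphi.
- move=> k y Uy /ltW yd; have cy := subset_closure Uy.
  have [phi0 _ _ /andP[g1 g2] l1] := Hphi y cy yd.
  have N : `|- Lam *: gp y| <= Lam * Cb.
    by rewrite normrZ normrN gtr0_norm // ler_pM2l.
  have := HS k y _ cy N; rewrite ler_norml => /andP[_ hH].
  rewrite (penalty_eq0 gamP); last first.
    by rewrite subrr sub0r mulNr oppr_le0 divr_ge0 ?psi_ge0 // ltW.
  have h2 : 0 <= Lam * phi y by rewrite mulr_ge0 // ltW.
  have h3 : 1 <= - (Lam * lp y).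
    rewrite -mulrN; apply: le_trans Lam1 _; rewrite ler_peMr ?(ltW Lam0) //.
    by move: l1 g1; rewrite mul1r; lra.
  rewrite addr0 mulNr mulNr.
  apply: (@le_lt_trans _ _ S); first by move: h2 hH; lra.
  by apply: lt_le_trans Eeps _; rewrite ler_peMr // ltW.
- move=> k y by_ yd; have [phi0 _ _ _ _] := Hphi y (boundary_closure by_) yd.
  by rewrite mulNr oppr_le0 mulr_ge0 // ltW.
- move=> k y cy yE.
  have yd : `|y - z| <= rb by rewrite yE.
  have [_ _ /(_ yE) phi1 _ _] := Hphi y cy yd.
  rewrite mulNr lerNl; apply: le_trans (ler_norm _) _; rewrite normrN.
  apply: le_trans (HC0 eps v eps0 sv k y cy) _.
  by apply: le_trans LamC _; rewrite ler_peMr // ltW.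
Qed.

(** Integrate the bounded derivative along the axis of a chart, from the boundary
    up to x. *)
Lemma boundary_lipschitz (f : 'rV[R]_n -> R) x0 : Ck_closure U 1 f ->
  (forall x, boundary U x -> f x = 0) -> boundary U x0 ->
  exists C d : R, [/\ 0 < C, 0 < d & forall x z, U x -> boundary U z ->
    `|z - x0| < d -> `|x - z| < d -> `|f x| <= C * `|x - z|].
Proof.
move=> fC f0 bx0.
have [r [L [i [sg [sigma [gs [ls C]]]]]]] := chart_exists sU bx0.
have [P [P0 HP]] := Ck_closure_bounded oU bU fC (s := [:: i]) isT.
have L0 := chart_L C; have r0 := chart_r C.
have NL : 0 <= n%:R * L by rewrite mulr_ge0 // ltW.
pose d := r / (n%:R * L + 2).
have D0 : 0 < n%:R * L + 2 by rewrite ltr_wpDl.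
have d0 : 0 < d by rewrite divr_gt0.
have dE : n%:R * L * d + 2 * d = r by rewrite -mulrDl /d mulrC divfK // gt_eqF.
have NLd : 0 <= n%:R * L * d by rewrite mulr_ge0 // ltW.
exists (P * (n%:R * L) + 1), d; split=> //; first by rewrite ltr_wpDl // mulr_ge0 // ltW.
move=> x z Ux bz zd xd.
have xr : `|x - x0| < 2 * d.
  by have := ler_normD (x - z) (z - x0); rewrite subrKA; move: xd zd; lra.
have xr' : `|x - x0| < r by move: xr dE NLd d0; lra.
have zr' : `|z - x0| < r by move: zd dE NLd d0; lra.
have sx : sigma x <= n%:R * L * `|x - z|.
  apply: le_trans (chart_lipschitz C zr' xr').
  by rewrite (chart_boundary oU C bz zr') subr0 ler_norm.
have sx2 : sigma x <= n%:R * L * d.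
  by apply: le_trans sx _; rewrite ler_wpM2l // ltW.
have dfb y : U y -> `|y - x0| < r ->
    is_derive y (delta_mx 0 i) f (pder [:: i] f y) /\ `|pder [:: i] f y| <= P.
  move=> Uy _; split; last exact: HP.
  by have [fC1 _ _] := fC; apply: derivableP; have [_] := fC1 [::]; apply.
have hF : `|f x| <= P * sigma x.
  apply: (chart_vertical_bound oU C (Ck_closure_continuous fC) (fun y by_ _ => f0 y by_) dfb Ux xr').
  by move: xr sx2 dE; lra.
apply: (le_trans hF); apply: (@le_trans _ _ (P * (n%:R * L * `|x - z|))); first by rewrite ler_pM2l.
by rewrite mulrA ler_wpM2r // lerDl.
Qed.

End BoundaryBarriers.

(** * Uniformity, boundary gradients, and continuity in eps *)

Section Uniformity.
Context {R : realType}.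

(** Monotonicity in T lets the largest of finitely many local constants serve
    everywhere. *)
Lemma compact_uniform (X : topologicalType) (K : set X) (P : R -> X -> Prop) :
  compact K -> (forall T T' x, T <= T' -> P T x -> P T' x) ->
  (forall x0, K x0 -> exists T, \forall x \near x0, K x -> P T x) ->
  exists T, 0 < T /\ forall x, K x -> P T x.
Proof.
move=> cK mono loc.
have /near_covering_withinP cov := (compact_near_coveringP K).1 cK.
have : (\forall T \near +oo_R, K `<=` P T).
  apply: cov => x0 Kx0; have [T HT] := loc x0 Kx0.
  exists ([set x | K x -> P T x], [set i | T <= i]).
    by split=> //=; apply: nbhs_pinfty_ge; exact: num_real.
  by move=> [x i] [/= h1 h2] Kx; exact: mono h2 (h1 Kx).
move=> [M [Mr HM]]; exists (`|M| + 1); split; first by rewrite ltr_wpDl.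
by apply: HM; rewrite (le_lt_trans (ler_norm M)) // ltrDl.
Qed.

Lemma within_lin (X : topologicalType) (K : set X) (a b : R) (f g : X -> R) :
  {within K, continuous f} -> {within K, continuous g} ->
  {within K, continuous (fun x => a * f x + b * g x)}.
Proof.
move=> cf cg y.
apply: cvgD; apply: cvgM; [exact: cvg_cst|exact: cf|exact: cvg_cst|exact: cg].
Qed.

End Uniformity.

Section BoundaryGradient.
Context {R : realType} {n : nat} (U : set 'rV[R]_n) (oU : open U) (bU : bounded_set U).
Implicit Types (x y z p : 'rV[R]_n).
Local Notation e_ i := (delta_mx (0 : 'I_1) i).

(** Take x near x0, with nearest boundary point z at distance D. The values of F at
    x and x + (D/2) e_k are at most kap D and (3/2) kap D, so the derivative at
    some point in between is at most 5 kap. *)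
Lemma boundary_gradient (F dF : 'rV[R]_n -> R) (k : 'I_n) x0 (q kap d : R) :
  boundary U x0 -> 0 < d ->
  (forall y, U y -> `|y - x0| < d -> is_derive y (e_ k) F (dF y)) ->
  (forall y z, U y -> boundary U z -> `|y - x0| < d -> `|z - x0| < d ->
     `|F y| <= kap * `|y - z|) ->
  (forall e : R, 0 < e -> \forall x \near x0, U x -> `|dF x - q| < e) ->
  `|q| <= 5 * kap.
Proof.
move=> bx0 d0 der bd lim; apply/ler_addgt0Pl => e e0.
have /nbhs_ballP[d1 /= d10 Hd1] := lim e e0.
pose d' := Num.min d d1.
have d'0 : 0 < d' by rewrite lt_min d0.
have d'd : d' <= d by rewrite ge_min lexx.
have d'd1 : d' <= d1 by rewrite ge_min lexx orbT.
have n0 : (0 < n)%N by apply: leq_ltn_trans (ltn_ord k).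
have [cx0 nUx0] : closure U x0 /\ ~ U x0 by move: bx0; rewrite (boundaryE oU).
have [x [Ux]] : U `&` ball x0 (d' / 4) !=set0.
  by apply: cx0; apply: nbhsx_ballx; rewrite divr_gt0.
rewrite -ball_normE /= distrC => xx0.
have [z [bz xz0 inU]] := nearest_boundary_point oU bU n0 Ux.
set D := `|x - z| in xz0 inU.
have Dx : D <= `|x - x0|.
  by rewrite leNgt; apply/negP; rewrite distrC => /inU.
have ek : `|e_ k : 'rV[R]_n| <= 1.
  by apply: rV_norm_le => // l; rewrite mxE; case: (_ && _); rewrite ?normr1 ?normr0.
pose w : 'rV[R]_n := (D / 2) *: e_ k.
have D20 : 0 < D / 2 by rewrite divr_gt0.
have wn : `|w| <= D / 2 by rewrite normrZ gtr0_norm // ler_piMr // ltW.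
have sw (s : R) : 0 <= s <= 1 -> `|s *: w| <= D / 2.
  by move=> /andP[s0 s1]; rewrite normrZ ger0_norm //; apply: le_trans wn; rewrite ler_piMl.
have swU (s : R) : 0 <= s <= 1 -> U (x + s *: w).
  move=> s01; apply: inU; rewrite addrAC subrr add0r.
  by apply: le_lt_trans (sw s s01) _; move: xz0; lra.
have swx (s : R) : 0 <= s <= 1 -> `|x + s *: w - x0| < d'.
  move=> s01; rewrite addrAC; apply: le_lt_trans (ler_normD _ _) _.
  by have := sw s s01; move: Dx xx0 d'0; lra.
have derw (s : R) : 0 <= s <= 1 -> is_derive (x + s *: w) w F (D / 2 * dF (x + s *: w)).
  move=> s01; apply: is_derive_dirZ; apply: der; first exact: swU.
  exact: lt_le_trans (swx s s01) d'd.
have [s /andP[s0 s1] E] := line_MVT_der derw.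
have s01 : 0 <= s <= 1 by rewrite !ltW.
have zd : `|z - x0| < d.
  have := ler_normD (z - x) (x - x0); rewrite subrKA (distrC z x) -/D.
  by move: Dx xx0 d'0 d'd; lra.
have xd : `|x - x0| < d by move: xx0 d'0 d'd; lra.
have i01 : 0 <= (1 : R) <= (1 : R) by rewrite ler01 lexx.
have Uxw : U (x + w) by have := swU 1 i01; rewrite scale1r.
have xwd : `|x + w - x0| < d.
  by have := swx 1 i01; rewrite scale1r => h; apply: lt_le_trans h d'd.
have B1 : `|F x| <= kap * D := bd x z Ux bz xd zd.
have B2 : `|F (x + w)| <= kap * `|x + w - z| := bd (x + w) z Uxw bz xwd zd.
have kap0 : 0 <= kap.
  by have := le_trans (normr_ge0 _) B1; rewrite pmulr_lge0.
have B3 : kap * `|x + w - z| <= kap * (D + D / 2).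
  rewrite ler_wpM2l // addrAC; apply: le_trans (ler_normD _ _) _.
  by rewrite lerD2l.
have B4 : `|dF (x + s *: w)| <= 5 * kap.
  have : D / 2 * `|dF (x + s *: w)| <= D / 2 * (5 * kap).
    rewrite -[X in X * `|_|](gtr0_norm D20) -normrM -E.
    apply: le_trans (ler_normB _ _) _.
    have -> : D / 2 * (5 * kap) = kap * (D + D / 2) + kap * D by field.
    exact: lerD (le_trans B2 B3) B1.
  by rewrite ler_pM2l.
have B5 : `|dF (x + s *: w) - q| < e.
  apply: Hd1; last exact: swU.
  by rewrite -ball_normE /= distrC; apply: lt_le_trans (swx s s01) d'd1.
have := ler_normB (dF (x + s *: w)) (dF (x + s *: w) - q).
rewrite opprB addrCA subrr addr0 => h; apply: le_trans h _.
by rewrite addrC; apply: lerD B4; exact: ltW.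
Qed.

End BoundaryGradient.

Section Perturbation.
Context {R : realType} {n : nat} (U : set 'rV[R]_n) (oU : open U) (bU : bounded_set U).
Context (sU : smooth_boundary U).
Context (H : bool -> 'rV[R]_n -> 'rV[R]_n -> R) (psi : bool -> 'rV[R]_n -> R) (gam : R -> R).
Context (HH : forall j, hamiltonian_assumptions U (H j)) (gamP : penalty_function gam).
Context (psi_ge0 : forall j x, closure U x -> 0 <= psi j x).
Implicit Types (x y z p : 'rV[R]_n) (v w : bool -> 'rV[R]_n -> R).

(** The solution vs for es is smooth up to the boundary, so vs - th phi is a strict
    subsolution for eps close to es: the concavity of the barrier phi pays for the
    change of the Hamiltonian, at most 2 S th |D phi| by convexity, and for the
    change of eps. *)
Lemma lower_bound_mid es vs x0 : 0 < es -> solves U H psi gam es vs -> boundary U x0 ->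
  exists C d dl : R, [/\ 0 < C, 0 < d, 0 < dl &
  forall eps v z, 0 < eps -> `|eps - es| < dl -> solves U H psi gam eps v ->
  boundary U z -> `|z - x0| < d -> forall j x, U x -> - (C * `|x - z|) <= v j x].
Proof.
move=> es0 svs bx0.
have [C0 [C00 HC0]] := sup_bound oU bU HH gamP psi_ge0.
have vsC k j : Ck_closure U k (vs j) by have [+ _ _] := svs j; apply.
have [P1 [P10 HP1]] : exists C, 0 < C /\ forall j x, U x -> `|grad (vs j) x| <= C.
  apply: (@bool_uniform R (fun j C => forall x, U x -> `|grad (vs j) x| <= C)).
    by move=> j C C' CC HC x /HC /le_trans; apply.
  by move=> j; exact: grad_bounded.
have [D2 [D20 HD2]] : exists C, 0 < C /\ forall j x, U x -> `|laplacian (vs j) x| <= C.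
  apply: (@bool_uniform R (fun j C => forall x, U x -> `|laplacian (vs j) x| <= C)).
    by move=> j C C' CC HC x /HC /le_trans; apply.
  by move=> j; exact: laplacian_bounded.
have [C1 [C10 HC1]] : exists C, 0 < C /\ forall j, exists d, 0 < d /\
    forall x z, U x -> boundary U z -> `|z - x0| < d -> `|x - z| < d -> `|vs j x| <= C * `|x - z|.
  apply: (@bool_uniform R (fun j C => exists d, 0 < d /\
    forall x z, U x -> boundary U z -> `|z - x0| < d -> `|x - z| < d -> `|vs j x| <= C * `|x - z|)).
    move=> j C C' CC [d [d0 Hd]]; exists d; split=> // x z Ux bz zd xd.
    by apply: le_trans (Hd x z Ux bz zd xd) _; rewrite ler_wpM2r.
  move=> j.
  have [C [d [C0' d0 Hd]]] := boundary_lipschitz oU bU sU (vsC 1%N j)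
    (fun x => solves_boundary j svs) bx0.
  by exists C; split=> //; exists d.
have [d1 [d10 Hd1]] : exists d, 0 < d /\ forall j x z, U x -> boundary U z ->
    `|z - x0| < d -> `|x - z| < d -> `|vs j x| <= C1 * `|x - z|.
  have [da [da0 Ha]] := HC1 true; have [db [db0 Hb]] := HC1 false.
  exists (Num.min da db); split; first by rewrite lt_min da0.
  by move=> j x z Ux bz; rewrite !lt_min => /andP[? ?] /andP[? ?]; case: j; [exact: Ha|exact: Hb].
have [S [S0 HS]] := ham_bounded2 bU HH (P1 + 1).
(* The slack of the barrier: es / 2 is a lower bound of eps, 2 S th |D phi| the
   error from convexity, and the extra 1 absorbs the change of eps. *)
pose m := 2 * (2 * S + 1) / es.
have m0 : 0 <= m by rewrite divr_ge0 ?(ltW es0) // mulr_ge0 // addr_ge0 // mulr_ge0 // ltW.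
have hm : es / 2 * m = 2 * S + 1 by rewrite /m; field; rewrite gt_eqF.
have [r [L [i [sg [sigma [gs [ls C]]]]]]] := chart_exists sU bx0.
have [rb [Cb [rb0 rbr Cb0 Hb]]] := barrier_exists oU C m0.
pose th := Cb^-1.
have th0 : 0 < th by rewrite invr_gt0.
have thC : th * Cb = 1 by rewrite mulVf // gt_eqF.
pose D1 := 2 * (2 * C0) / es ^+ 2.
have D10 : 0 <= D1.
  by rewrite /D1 divr_ge0 ?exprn_ge0 ?(ltW es0) // mulr_ge0 // mulr_ge0 // ltW.
pose dl := Num.min (es / 2) (th / (D1 + D2)).
have DD0 : 0 < D1 + D2 by rewrite ltr_wpDl.
pose d2 := Num.min rb d1.
have d20 : 0 < d2 by rewrite lt_min rb0.
exists (C1 + 1 + C0 / d2), d2, dl; split=> //.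
- by rewrite addr_gt0 ?divr_gt0 // addr_gt0.
- by rewrite lt_min !divr_gt0.
move=> eps v z eps0; rewrite lt_min => /andP[e1 e2] sv bz; rewrite lt_min => /andP[zrb zd1] j x Ux.
have cx := subset_closure Ux.
have hes : es / 2 <= eps by move: e1; rewrite ltr_norml => /andP[]; lra.
have hD : (D1 + D2) * `|eps - es| < th by rewrite mulrC -ltr_pdivlMr.
have gdiff k y : U y -> gam ((vs k y - vs (~~ k) y - psi k y) / eps) <=
    gam ((vs k y - vs (~~ k) y - psi k y) / es) + D1 * `|eps - es|.
  move=> Uy; have cy := subset_closure Uy.
  apply: penalty_rescale => //; first by rewrite mulr_ge0 // ltW.
  have := HC0 es vs es0 svs k y cy; rewrite ler_norml => /andP[_ h1].
  have := HC0 es vs es0 svs (~~ k) y cy; rewrite ler_norml => /andP[h2 _].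
  by have := psi_ge0 k cy; move: h1 h2; lra.
have glob k y : closure U y -> vs k y - th <= v k y.
  move=> cy.
  suff : 1 * vs k y + (- th) * 1 <= v k y by rewrite mul1r mulr1.
  apply: (@global_lower_comparison _ _ _ oU bU H psi gam gamP eps v
    (fun k y => 1 * vs k y + (- th) * 1) (fun k y => 1 *: grad (vs k) y + (- th) *: 0)
    (fun k y => 1 * laplacian (vs k) y + (- th) * 0)) => //.
  - move=> l; apply: (@within_lin _ _ (closure U) 1 (- th) (vs l) (fun=> 1)); first exact: solves_continuous svs.
    exact/continuous_subspaceT/cst_continuous.
  - by move=> l; apply: jet_lin; [exact: solves_jet svs|exact: jet_cst].
  - move=> l y' Uy'; rewrite !mul1r !mulr1 mulr0 addr0 scale1r scaler0 addr0.
    have E : vs l y' - th - (vs (~~ l) y' - th) = vs l y' - vs (~~ l) y' by ring.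
    rewrite E; have := gdiff l y' Uy'; have := solves_eq l svs Uy'; have := HD2 l y' Uy'.
    move: hD; rewrite mulrDl.
    move: (laplacian _ y') (H l y' _) (gam _) (gam _) => a b g1 g2 hD ha hE hg.
    have ha' : - (D2 * `|eps - es|) <= (eps - es) * a.
      rewrite lerNl; apply: le_trans (ler_norm _) _.
      by rewrite normrN normrM mulrC ler_wpM2r.
    by move: hD hE hg ha'; rewrite mulrBl; lra.
  - by move=> l y' by_; rewrite mul1r mulr1 (solves_boundary l svs by_) add0r oppr_le0 ltW.
have [xz|xz] := ltP `|x - z| d2; last first.
  rewrite lerNl; apply: le_trans (far_bound d20 (ltW C00) _ xz) _.
    by apply: le_trans (ler_norm _) _; rewrite normrN; exact: (HC0 eps v eps0 sv j x cx).
  by rewrite ler_wpM2r // lerDr addr_ge0 // ltW.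
move: xz; rewrite lt_min => /andP[/ltW xz xz1].
have [phi [gp [lp [cphi Jphi Hphi]]]] := Hb z bz zrb.
suff hw : 1 * vs j x + (- th) * phi x <= v j x.
  apply: le_trans hw; rewrite mul1r mulNr.
  have [_ phiC _ _ _] := Hphi x cx xz.
  have h1 : th * phi x <= `|x - z|.
    by apply: le_trans (_ : th * (Cb * `|x - z|) <= _); [rewrite ler_pM2l|rewrite mulrA thC mul1r].
  have := Hd1 j x z Ux bz zd1 xz1; rewrite ler_norml => /andP[h2 _].
  have h3 : 0 <= C0 / d2 * `|x - z| by rewrite mulr_ge0 // divr_ge0 // ltW.
  by rewrite !mulrDl mul1r; move: h1 h2 h3; lra.
apply: (@local_lower_comparison _ _ _ oU bU H psi gam gamP eps v
   (fun k y => 1 * vs k y + (- th) * phi y) (fun k y => 1 *: grad (vs k) y + (- th) *: gp y)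
   (fun k y => 1 * laplacian (vs k) y + (- th) * lp y) z rb) => //.
- move=> k; apply: within_region.
  by apply: within_lin; [exact: solves_continuous svs|exact: continuous_subspaceT].
- move=> k; apply: jet_lin; last by apply: jet_subset Jphi.
  by apply: jet_subset (solves_jet k svs) => y' [].
- move=> k y Uy /ltW yd; have cy := subset_closure Uy.
  have [phi0 _ _ /andP[N1 N2] l1] := Hphi y cy yd.
  have N0 : 0 < `|gp y| by apply: lt_le_trans N1.
  have tN : th * `|gp y| <= 1 by rewrite -thC ler_pM2l.
  have tN0 : 0 <= th * `|gp y| by rewrite mulr_ge0 // ltW.
  pose q := - (`|gp y|^-1 *: gp y).
  have qn : `|q| = 1 by rewrite normrN normrZ normfV normr_id mulVf // gt_eqF.
  have gE : 1 *: grad (vs k) y + - th *: gp y = grad (vs k) y + (th * `|gp y|) *: q.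
    by rewrite scale1r /q scalerN scalerA -mulrA divff ?mulr1 ?gt_eqF // scaleNr.
  rewrite gE.
  have hH := ham_convex (HH k) (grad (vs k) y) q cy tN0 tN.
  have hH2 : H k y (grad (vs k) y + (th * `|gp y|) *: q) <=
      H k y (grad (vs k) y) + 2 * S * (th * `|gp y|).
    apply: le_trans hH _; rewrite lerD2l mulrC ler_wpM2r //.
    have b1 : `|grad (vs k) y| <= P1 + 1 by apply: le_trans (HP1 k y Uy) _; rewrite lerDl.
    have b2 : `|grad (vs k) y + q| <= P1 + 1.
      by apply: le_trans (ler_normD _ _) _; rewrite qn lerD2r; exact: HP1.
    have := HS k y _ cy b1; rewrite ler_norml => /andP[c1 _].
    have := HS k y _ cy b2; rewrite ler_norml => /andP[_ c2].
    by rewrite mulr_natl mulr2n; apply: lerD c2 _; rewrite lerNl.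
  have E : 1 * vs k y + - th * phi y - (1 * vs (~~ k) y + - th * phi y) - psi k y =
     vs k y - vs (~~ k) y - psi k y by ring.
  rewrite E !mul1r !mulNr.
  exact: (perturbation_arith th0 (ltW N0) (ltW S0) phi0 m0 hH2 (solves_eq k svs Uy)
    (gdiff k y Uy) (HD2 k y Uy) hD l1 es0 hes hm).
- move=> k y by_ yd; have [phi0 _ _ _ _] := Hphi y (boundary_closure by_) yd.
  by rewrite (solves_boundary k svs by_) mulr0 add0r mulNr oppr_le0 mulr_ge0 // ltW.
- move=> k y cy yE.
  have yd : `|y - z| <= rb by rewrite yE.
  have [_ _ /(_ yE) phi1 _ _] := Hphi y cy yd.
  apply: le_trans (glob k y cy); rewrite mul1r mulNr lerD2l lerN2.
  by rewrite ler_peMr // ltW.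
Qed.

End Perturbation.

(** * The strict subsolutions at the boundary *)

Lemma linear_defectE (R : realType) (a b c d e : R) :
  1 * a + - c * b - (d - c * e) = (a - d) + c * (e - b).
Proof. by ring. Qed.

Section SmallEps.
Context {R : realType} {n : nat} (U : set 'rV[R]_n) (oU : open U) (bU : bounded_set U).
Context (sU : smooth_boundary U).
Implicit Types (x y z p : 'rV[R]_n) (v w : bool -> 'rV[R]_n -> R).

Lemma chart_shrink x0 r r' L i sg sigma gs ls :
  boundary_chart U x0 r L i sg sigma gs ls -> 0 < r' -> r' <= r ->
  boundary_chart U x0 r' L i sg sigma gs ls.
Proof.
move=> C r'0 r'r; split=> //; try by case: C.
- by move=> x xr; apply: (chart_in C); exact: lt_le_trans r'r.
- by move=> x xr; apply: (chart_bounds C); exact: lt_le_trans r'r.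
Qed.

Section FirstOrder.
Context (x0 : 'rV[R]_n) (r L : R) (i : 'I_n) (sg : R) (sigma : 'rV[R]_n -> R).
Context (gs : 'rV[R]_n -> 'rV[R]_n) (ls : 'rV[R]_n -> R).
Context (C : boundary_chart U x0 r L i sg sigma gs ls).
Context (Phi : 'rV[R]_n -> R) (PhiC : Ck_closure U 1 Phi).
Context (Phi0 : forall x, boundary U x -> Phi x = 0) (bx0 : boundary U x0).

Let p0 := grad_closure U Phi x0.
Let c := sg * p0 0 i.

Let first_order_is_derive y k : U y ->
  is_derive y (delta_mx 0 k) (fun x => 1 * Phi x + (- c) * sigma x)
    (1 * pder [:: k] Phi y + (- c) * gs y 0 k).
Proof.
move=> Uy; have [PC _ _] := PhiC.
have D1 : is_derive y (delta_mx 0 k) Phi (pder [:: k] Phi y).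
  by apply: derivableP; have [_] := PC [::]; apply.
have [h [D2 _ _]] := chart_jet C (x := y) I.
exact: (is_deriveD (is_deriveZ 1 D1) (is_deriveZ (- c) (D2 k))).
Qed.

(** Phi - c sigma vanishes on the boundary and its derivative along the axis of the
    chart vanishes at x0, by the choice of c and because sg^2 = 1. *)
Lemma chart_first_order (om : R) : 0 < om -> exists d : R, [/\ 0 < d, d <= r &
  forall x, U x -> `|x - x0| < d -> `|Phi x - c * sigma x| <= om * sigma x].
Proof.
move=> om0.
have c0 : closure U x0 := boundary_closure bx0.
have /nbhs_ballP[r1 /= r10 Hr1] := Ck_closure_near oU PhiC (s := [:: i]) isT c0 om0.
pose r2 := Num.min r r1.
have r20 : 0 < r2 by rewrite lt_min (chart_r C).
have r2r : r2 <= r by rewrite ge_min lexx.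
have r2r1 : r2 <= r1 by rewrite ge_min lexx orbT.
have C2 := chart_shrink C r20 r2r.
have NL : 0 <= n%:R * L by rewrite mulr_ge0 // ltW // (chart_L C).
have NL1 : 0 < n%:R * L + 1 by rewrite ltr_wpDl.
pose d := r2 / (n%:R * L + 1).
have d0 : 0 < d by rewrite divr_gt0.
have dE : d * (n%:R * L + 1) = r2 by rewrite divfK // gt_eqF.
exists d; split=> //.
  by apply: le_trans r2r; rewrite -dE ler_peMr ?(ltW d0) // lerDr.
move=> x Ux xd.
have xr2 : `|x - x0| < r2.
  by apply: lt_le_trans xd _; rewrite -dE ler_peMr ?(ltW d0) // lerDr.
have x00 : `|x0 - x0| < r2 by rewrite subrr normr0.
have sx : sigma x <= n%:R * L * d.
  apply: (@le_trans _ _ (n%:R * L * `|x - x0|)); last by rewrite ler_wpM2l // ltW.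
  apply: le_trans (chart_lipschitz C2 x00 xr2).
  by rewrite (chart_boundary oU C2 bx0 x00) subr0 ler_norm.
have cF : {within closure U, continuous (fun x => 1 * Phi x + (- c) * sigma x)}.
  apply: within_lin; first exact: (Ck_closure_continuous PhiC).
  exact/continuous_subspaceT/(chart_cont C).
have F0 y : boundary U y -> `|y - x0| < r2 -> 1 * Phi y + (- c) * sigma y = 0.
  by move=> by_ yr; rewrite (Phi0 by_) (chart_boundary oU C2 by_ yr) !mulr0 addr0.
have dF y : U y -> `|y - x0| < r2 ->
    is_derive y (delta_mx 0 i) (fun x => 1 * Phi x + (- c) * sigma x)
      (1 * pder [:: i] Phi y + (- c) * gs y 0 i) /\
    `|1 * pder [:: i] Phi y + (- c) * gs y 0 i| <= om.
  move=> Uy yr; split; first exact: first_order_is_derive.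
  rewrite (chart_slope C) mul1r mulNr /c mulrAC -expr2 (chart_sg C) mul1r /p0 mxE.
  apply: ltW; apply: Hr1 => //; rewrite -ball_normE /= distrC.
  exact: lt_le_trans r2r1.
have := chart_vertical_bound oU C2 cF F0 dF Ux xr2.
rewrite mul1r mulNr; apply.
by move: xd sx dE; rewrite mulrDr mulr1 [d * _]mulrC; lra.
Qed.

(** Phi - c sigma is o(sigma) near x0, hence small compared with the distance to
    the boundary, and [boundary_gradient] bounds all its derivatives at x0. *)
Lemma chart_boundary_gradient : p0 = c *: gs x0.
Proof.
apply/rowP => k; rewrite [RHS]mxE; apply/eqP; rewrite -subr_eq0 -normr_le0.
have L0 := chart_L C.
have NL : 0 <= n%:R * L by rewrite mulr_ge0 // ltW.
apply/ler_addgt0Pl => e e0; rewrite addr0.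
pose om := e / (5 * (n%:R * L + 1)).
have D0 : 0 < 5 * (n%:R * L + 1) by rewrite mulr_gt0 // ltr_wpDl.
have om0 : 0 < om by rewrite divr_gt0.
have [d [d0 dr Hd]] := chart_first_order om0.
apply: (@le_trans _ _ (5 * (om * (n%:R * L)))); last first.
  have E : om * (5 * (n%:R * L + 1)) = e by rewrite divfK // gt_eqF.
  by rewrite -E; move: om0; nra.
apply: (@boundary_gradient _ _ U oU bU (fun x => 1 * Phi x + (- c) * sigma x)
  (fun y => 1 * pder [:: k] Phi y + (- c) * gs y 0 k) k x0 _ _ d) => //.
- by move=> y Uy _; exact: first_order_is_derive.
- move=> y z Uy bz yd zd; rewrite mul1r mulNr; apply: le_trans (Hd y Uy yd) _.
  rewrite -[om * _ * _]mulrA; rewrite ler_pM2l //.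
  have yr := lt_le_trans yd dr; have zr := lt_le_trans zd dr.
  apply: le_trans (chart_lipschitz C zr yr).
  by rewrite (chart_boundary oU C bz zr) subr0 ler_norm.
- move=> e' e'0.
  have e'2 : 0 < e' / 2 by rewrite divr_gt0.
  have N1 := Ck_closure_near oU PhiC (s := [:: k]) isT (boundary_closure bx0) e'2.
  have e'3 : 0 < e' / 2 / (`|c| + 1) by rewrite divr_gt0 // ltr_wpDl.
  have N2 := chart_grad_cont C e'3.
  apply: filterS2 N1 N2 => x h1 h2 Ux.
  have {}h1 := h1 Ux.
  rewrite /p0 mxE linear_defectE.
  apply: le_lt_trans (ler_normD _ _) _; rewrite [e']splitr; apply: ltr_leD h1 _.
  rewrite normrM distrC.
  have h3 : `|gs x 0 k - gs x0 0 k| <= e' / 2 / (`|c| + 1).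
    by apply: le_trans (ltW h2); have := rV_coord_le (gs x - gs x0) k; rewrite !mxE.
  apply: (@le_trans _ _ (`|c| * (e' / 2 / (`|c| + 1)))); first by rewrite ler_wpM2l.
  by rewrite mulrCA ler_piMr ?(ltW e'2) // ler_pdivrMr ?mul1r ?lerDl // ltr_wpDl.
Qed.

End FirstOrder.
End SmallEps.

Lemma bool_uniform_small (R : realType) (P : bool -> R -> Prop) :
  (forall j d d', d' <= d -> P j d -> P j d') ->
  (forall j, exists d, 0 < d /\ P j d) -> exists d, 0 < d /\ forall j, P j d.
Proof.
move=> mono ex; have [d1 [d10 P1]] := ex true; have [d2 [d20 P2]] := ex false.
exists (Num.min d1 d2); split=> [|[]]; first by rewrite lt_min d10.
  by apply: mono P1; rewrite ge_min lexx.
by apply: mono P2; rewrite ge_min lexx orbT.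
Qed.

Section SmallEps.
Context {R : realType} {n : nat} (U : set 'rV[R]_n) (oU : open U) (bU : bounded_set U).
Context (sU : smooth_boundary U).
Context (H : bool -> 'rV[R]_n -> 'rV[R]_n -> R) (psi : bool -> 'rV[R]_n -> R) (gam : R -> R).
Context (HH : forall j, hamiltonian_assumptions U (H j)) (gamP : penalty_function gam).
Context (alpha : R) (alpha0 : 0 < alpha).
Context (psi_ge : forall j x, closure U x -> alpha <= psi j x).
Context (Phi : bool -> 'rV[R]_n -> R) (PhiS : forall j, strict_subsolution U (H j) (Phi j)).
Context (Phi_psi : forall j x, closure U x -> Phi j x - Phi (~~ j) x <= psi j x).
Implicit Types (x y z p w : 'rV[R]_n) (v : bool -> 'rV[R]_n -> R).

Lemma Phi_C1 j : Ck_closure U 1 (Phi j). Proof. by have [] := PhiS j. Qed.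
Lemma Phi_boundary j x : boundary U x -> Phi j x = 0.
Proof. by have [_ _ + _] := PhiS j; apply. Qed.

Definition excess_le (M : R) v := forall j x, closure U x -> Phi j x - v j x <= M.

(** Near a boundary point both Phi_j are close to c_j sigma, a smooth strict
    subsolution vanishing on the boundary. Comparison with
    c_j sigma - k |x - y|^2 - max(0, M - q) first shows that a positive maximum
    of Phi - v near x0 is small, then gives a lower barrier at z. *)
Lemma small_eps_local x0 (kap : R) : boundary U x0 -> 0 < kap ->
  exists r q C E : R, [/\ 0 < r, 0 < q, q <= kap, 0 < C & 0 < E] /\
  forall eps v M, 0 < eps -> eps < E -> solves U H psi gam eps v -> excess_le M v ->
  (forall j x, U x -> `|x - x0| < r / 2 -> Phi j x - v j x = M -> M <= kap) /\
  (M <= q -> forall z, boundary U z -> `|z - x0| < r / 2 ->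
    forall j x, U x -> `|x - z| < r / 2 -> - (C * `|x - z|) <= v j x).
Proof.
move=> bx0 kap0.
have cx0 := boundary_closure bx0.
have [r0 [L [i [sg [sigma [gs [ls C]]]]]]] := chart_exists sU bx0.
have r00 := chart_r C; have L0 := chart_L C.
(* The slopes c_j are kept abstract, with the two facts that characterize them. *)
have [c Hc] : exists c : bool -> R, forall j,
    grad_closure U (Phi j) x0 = c j *: gs x0 /\
    forall om : R, 0 < om -> exists d : R, [/\ 0 < d, d <= r0 &
      forall x, U x -> `|x - x0| < d -> `|Phi j x - c j * sigma x| <= om * sigma x].
  exists (fun j => sg * grad_closure U (Phi j) x0 0 i) => j; split.
    exact: (chart_boundary_gradient oU bU C (Phi_C1 j) (@Phi_boundary j) bx0).
  by move=> om om0; exact: (chart_first_order oU C (Phi_C1 j) (@Phi_boundary j) bx0 om0).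
have Hneg j : H j x0 (c j *: gs x0) < 0.
  have [_ _ _ /(_ x0 cx0)] := PhiS j.
  by rewrite (Phi_boundary j bx0) add0r (Hc j).1.
have [del [del0 Hdel]] : exists del, 0 < del /\ forall j, 2 * del <= - H j x0 (c j *: gs x0).
  apply: (@bool_uniform_small R (fun j del => 2 * del <= - H j x0 (c j *: gs x0))).
    by move=> j d d' dd; apply: le_trans; rewrite ler_pM2l.
  move=> j; exists (- H j x0 (c j *: gs x0) / 2); split; first by rewrite divr_gt0 // oppr_gt0 Hneg.
  by rewrite mulrC divfK.
have [eta [eta0 Heta]] : exists eta, 0 < eta /\ forall j x q, closure U x ->
    `|x - x0| < eta -> `|q - c j *: gs x0| < eta -> H j x q < - del.
  apply: (@bool_uniform_small R (fun j eta => forall x q, closure U x ->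
    `|x - x0| < eta -> `|q - c j *: gs x0| < eta -> H j x q < - del)).
    by move=> j d d' dd Hd x q cx xd qd; apply: Hd => //; exact: lt_le_trans dd.
  move=> j; have [d [d0 Hd]] := ham_continuous (HH j) (c j *: gs x0) cx0 del0.
  exists d; split=> // x q cx xd qd; have := Hd x q cx xd qd.
  rewrite ltr_norml => /andP[_ h]; have := Hdel j; move: h.
  by move: (H j x q) (H j x0 (c j *: gs x0)) => a b; lra.
pose NL : R := n%:R * L.
have NL0 : 0 <= NL by rewrite mulr_ge0 // ltW.
pose om := eta / (32 * (NL + 1)).
have NL1 : 0 < NL + 1 by rewrite ltr_wpDl.
have om0 : 0 < om by rewrite divr_gt0 // mulr_gt0.
have omE : om * (32 * (NL + 1)) = eta by rewrite divfK // gt_eqF // mulr_gt0.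
have [d1 [d10 Hd1']] : exists d, 0 < d /\ forall j, d <= r0 /\ forall x, U x -> `|x - x0| < d ->
    `|Phi j x - c j * sigma x| <= om * sigma x.
  apply: (@bool_uniform_small R (fun j d => d <= r0 /\ forall x, U x -> `|x - x0| < d ->
    `|Phi j x - c j * sigma x| <= om * sigma x)).
    move=> j d d' dd [dr Hd]; split; first exact: le_trans dr.
    by move=> x Ux xd; apply: Hd => //; exact: lt_le_trans dd.
  move=> j.
  by have [d [d0 dr Hd]] := (Hc j).2 om om0; exists d.
have d1r : d1 <= r0 by have [] := Hd1' true.
have Hd1 j x : U x -> `|x - x0| < d1 -> `|Phi j x - c j * sigma x| <= om * sigma x.
  by have [_] := Hd1' j; exact.
have [cc [/ltW cc0 cle]] : exists cc, 0 < cc /\ forall j, `|c j| <= cc.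
  apply: (@bool_uniform R (fun j cc => `|c j| <= cc)).
    by move=> j C1 C2 CC; move=> /le_trans; apply.
  by move=> j; exists (`|c j| + 1); split; [rewrite ltr_wpDl|rewrite lerDl].
have cc1 : 0 < cc + 1 by rewrite ltr_wpDl.
have e2 : 0 < eta / 2 / (cc + 1) by rewrite divr_gt0 // divr_gt0.
have /nbhs_ballP[d2 /= d20 Hd2] := chart_grad_cont C e2.
(* The radius: inside the chart and the first-order ball, with the gradient of
   sigma nearly constant, and with sigma as small as needed. *)
pose D := (cc + 1) * (NL + 1).
have D0 : 0 < D by rewrite mulr_gt0.
pose r := Num.min (Num.min (Num.min d1 d2) (Num.min eta (alpha / 2 / D)))
   (Num.min (del / 2 / D) (32 / 3 * kap / eta)).
have r_pos : 0 < r by rewrite !lt_min !divr_gt0 ?mulr_gt0 // d10 d20 eta0.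
have rd1 : r <= d1 by rewrite /r !ge_min lexx.
have rd2 : r <= d2 by rewrite /r !ge_min lexx !orbT.
have reta : r <= eta by rewrite /r !ge_min lexx !orbT.
have ralpha : r <= alpha / 2 / D by rewrite /r !ge_min lexx !orbT.
have rdel : r <= del / 2 / D by rewrite /r !ge_min lexx !orbT.
have rkap : r <= 32 / 3 * kap / eta by rewrite /r !ge_min lexx !orbT.
have ccNL : cc * (NL * r) <= D * r.
  rewrite mulrA ler_pM2r //; apply: ler_pM => //; first by rewrite lerDl.
  by rewrite lerDl.
have h_alpha : cc * (NL * r) <= alpha / 2.
  by apply: le_trans ccNL _; rewrite mulrC -ler_pdivlMr.
have h_del : cc * (NL * r) <= del / 2.
  by apply: le_trans ccNL _; rewrite mulrC -ler_pdivlMr.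
(* On the edge |x - y| = r / 2 the quadratic term is at least eta r / 8, that is
   4 q / 3, while Phi_j and c_j sigma differ by at most q / 3: the gain is q. *)
pose q := 3 / 32 * (eta * r).
have er0 : 0 < eta * r by rewrite mulr_gt0.
have q0 : 0 < q by rewrite mulr_gt0.
have qkap : q <= kap.
  have : eta * r <= 32 / 3 * kap by rewrite mulrC -ler_pdivlMr.
  by rewrite /q; lra.
pose k2 := eta / (2 * r).
have k20 : 0 < k2 by rewrite divr_gt0 // mulr_gt0.
have k2r : k2 * r = eta / 2 by rewrite /k2; field; rewrite gt_eqF.
have r0d : r <= r0 by apply: le_trans d1r.
have x00 : `|x0 - x0| < r0 by rewrite subrr normr0.
(* Uniform facts on the ball of radius r. *)
have sig x : closure U x -> `|x - x0| < r -> 0 <= sigma x /\ sigma x <= NL * r.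
  move=> cx xr; have xr0 := lt_le_trans xr r0d.
  split; first exact: (chart_closure C cx xr0).
  apply: (@le_trans _ _ (NL * `|x - x0|)); last by rewrite ler_wpM2l // ltW.
  apply: le_trans (chart_lipschitz C x00 xr0).
  by rewrite (chart_boundary oU C bx0 x00) subr0 ler_norm.
have csig j x : closure U x -> `|x - x0| < r -> `|c j * sigma x| <= cc * (NL * r).
  move=> cx xr; have [s0 s1] := sig x cx xr.
  by rewrite normrM ler_pM // ger0_norm.
have Phisig j x : closure U x -> `|x - x0| < r -> `|Phi j x - c j * sigma x| <= q / 3.
  move=> cx xr; have [Ux|by_] := closure_inside_or_boundary oU cx; last first.
    rewrite (Phi_boundary j by_) (chart_boundary oU C by_ (lt_le_trans xr r0d)).
    by rewrite mulr0 subr0 normr0 divr_ge0 // ltW.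
  apply: le_trans (Hd1 j x Ux (lt_le_trans xr rd1)) _.
  have [s0 s1] := sig x cx xr.
  apply: (@le_trans _ _ (om * (NL * r))); first by rewrite ler_pM2l.
  have -> : q / 3 = om * ((NL + 1) * r) by rewrite /q -omE; field.
  by rewrite ler_pM2l // ler_pM2r // lerDl.
pose E := del / 2 / (cc * L + 2 * n%:R * k2 + 1).
have E1 : 0 < cc * L + 2 * n%:R * k2 + 1.
  apply: ltr_wpDl => //; apply: addr_ge0; first exact: mulr_ge0 cc0 (ltW L0).
  by apply: mulr_ge0 (ltW k20); exact: mulr_ge0.
have E0 : 0 < E by rewrite divr_gt0 // divr_gt0.
exists r, q, (cc * NL + k2 * (n%:R * r) + 1), E; split.
  split=> //; apply: ltr_wpDl => //; apply: addr_ge0; first exact: mulr_ge0.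
  by apply: mulr_ge0 (ltW k20) _; apply: mulr_ge0 (ltW r_pos).
move=> eps v M eps0 epsE sv HM.
(* The comparison, centred at an arbitrary point y near x0. *)
have core y : `|y - x0| < r / 2 -> forall j x, closure U x -> `|x - y| <= r / 2 ->
    c j * sigma x - k2 * sqdist y x - Num.max 0 (M - q) <= v j x.
  move=> yr j x cx xy.
  set s := Num.max 0 (M - q).
  have s0 : 0 <= s by rewrite le_max lexx.
  have sM : M - q <= s by rewrite le_max lexx orbT.
  have inr w : `|w - y| <= r / 2 -> `|w - x0| < r.
    by move=> wy; have := ler_normD (w - y) (y - x0); rewrite subrKA; move: wy yr; lra.
  pose W k w := 1 * (c k * sigma w + (- k2) * sqdist y w) + (- s) * 1.
  suff : W j x <= v j x by rewrite /W mul1r mulr1 mulNr.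
  apply: (@local_lower_comparison _ _ _ oU bU H psi gam gamP eps v W
    (fun k w => 1 *: (c k *: gs w + (- k2) *: (2 *: (w - y))) + (- s) *: 0)
    (fun k w => 1 * (c k * ls w + (- k2) * (2 * n%:R)) + (- s) * 0) y (r / 2)) => //.
  - move=> k; apply: continuous_subspaceT; apply: continuous_lin; last exact: cst_continuous.
    by apply: continuous_lin; [exact: chart_cont C|exact: continuous_sqdist].
  - move=> k; apply: jet_lin; last exact: jet_cst.
    by apply: jet_lin; [apply: jet_subset (chart_jet C)|exact: jet_sqdist].
  - move=> k w Uw /ltW wy; have cw := subset_closure Uw; have wr := inr w wy.
    have sq0 : 0 <= k2 * sqdist y w.
      by rewrite mulr_ge0 ?(ltW k20) //; apply: le_trans (sqdist_ge y w); exact: exprn_ge0.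
    have hg : `|1 *: (c k *: gs w + - k2 *: (2 *: (w - y))) + - s *: 0 - c k *: gs x0| < eta.
      rewrite scale1r scaler0 addr0 addrAC -scalerBr.
      apply: le_lt_trans (ler_normD _ _) _; rewrite [eta]splitr; apply: ltr_leD.
        rewrite normrZ; apply: (@le_lt_trans _ _ (cc * (eta / 2 / (cc + 1)))).
          apply: ler_pM; [exact: normr_ge0|exact: normr_ge0|exact: cle|apply/ltW/Hd2].
          by rewrite -ball_normE /= distrC; exact: lt_le_trans wr rd2.
        rewrite mulrCA gtr_pMr ?divr_gt0 // ltr_pdivrMr // mul1r ltrDl; exact: ltr01.
      have -> : eta / 2 = k2 * 2 * (r / 2) by rewrite -k2r; field.
      have k22 : 0 < k2 * 2 by exact: mulr_gt0.
      by rewrite scalerA normrZ mulNr normrN (gtr0_norm k22) ler_pM2l.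
    have hH := Heta k w _ cw (lt_le_trans wr reta) hg.
    have hc := csig k w cw wr; have hc' := csig (~~ k) w cw wr.
    have hW : W k w - W (~~ k) w - psi k w <= 0.
      rewrite /W; have := psi_ge k cw; move: hc hc'; rewrite !ler_norml => /andP[_ a1] /andP[a2 _] a3.
      by move: h_alpha a1 a2 a3; lra.
    rewrite (penalty_eq0 gamP); last by rewrite pmulr_lle0 // invr_gt0.
    have hl : `|1 * (c k * ls w + - k2 * (2 * n%:R)) + - s * 0| <= cc * L + 2 * n%:R * k2.
      rewrite mul1r mulr0 addr0; apply: le_trans (ler_normD _ _) _; apply: lerD.
        by rewrite normrM; apply: ler_pM => //; have [] := chart_bounds C (lt_le_trans wr r0d).
      have k2n : 0 <= k2 * (2 * n%:R) by apply: mulr_ge0 (ltW k20) _; exact: mulr_ge0.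
      by rewrite mulNr normrN (ger0_norm k2n) mulrC.
    have hel : - (del / 2) < eps * (1 * (c k * ls w + - k2 * (2 * n%:R)) + - s * 0).
      rewrite ltrNl -mulrN; apply: le_lt_trans (ler_norm _) _.
      rewrite normrM normrN gtr0_norm //.
      apply: (@le_lt_trans _ _ (eps * (cc * L + 2 * n%:R * k2 + 1))).
        by rewrite ler_pM2l //; apply: le_trans hl _; rewrite lerDl.
      by rewrite -ltr_pdivlMr.
    apply: lt_trans hel; rewrite addr0 /W.
    move: hc; rewrite ler_norml => /andP[_ a1].
    by move: hH a1 h_del sq0 s0; move: (H k w _) => b; lra.
  - move=> k w bw wy; have cw := boundary_closure bw; have wr := inr w wy.
    rewrite /W (chart_boundary oU C bw (lt_le_trans wr r0d)) mulr0 add0r mul1r mulr1 mulNr -opprD oppr_le0.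
    rewrite addr_ge0 // mulr_ge0 ?(ltW k20) //; apply: le_trans (sqdist_ge y w); exact: exprn_ge0.
  - move=> k w cw wy; have wy' : `|w - y| <= r / 2 by rewrite wy.
    have wr := inr w wy'.
    have hsq : 4 / 3 * q <= k2 * sqdist y w.
      apply: (@le_trans _ _ (k2 * (r / 2) ^+ 2)).
        rewrite (_ : k2 * (r / 2) ^+ 2 = k2 * r * r / 4); last by field.
        by rewrite k2r /q le_eqVlt; apply/orP; left; apply/eqP; field.
      by rewrite ler_pM2l // -wy; exact: sqdist_ge.
    have := Phisig k w cw wr; rewrite ler_norml => /andP[a1 _].
    have a2 := HM k w cw.
    by rewrite /W; move: hsq a1 a2 sM; lra.
split.
- move=> j x Ux xr PM; apply: le_trans qkap.
  have cx := subset_closure Ux.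
  have xx : `|x - x| <= r / 2 by rewrite subrr normr0 divr_ge0 // ltW.
  have := core x xr j x cx xx.
  have xr' : `|x - x0| < r by move: xr r_pos; lra.
  have := Phisig j x cx xr'; rewrite ler_norml => /andP[_ a1].
  rewrite (_ : sqdist x x = 0); last by rewrite /sqdist big1 // => l _; rewrite subrr expr0n.
  rewrite mulr0 subr0 => a2; rewrite leNgt; apply/negP => Mq.
  rewrite max_r in a2; last by rewrite subr_ge0 ltW.
  by move: a1 a2 PM q0; lra.
move=> Mq z bz zr j x Ux xz.
have cx := subset_closure Ux.
have := core z zr j x cx (ltW xz).
rewrite max_l ?subr_le0 // subr0; apply: le_trans.
have xr : `|x - x0| < r.
  by have := ler_normD (x - z) (z - x0); rewrite subrKA; move: xz zr; lra.
have zr' : `|z - x0| < r by move: zr r_pos; lra.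
have sx : sigma x <= NL * `|x - z|.
  apply: le_trans (chart_lipschitz C (lt_le_trans zr' r0d) (lt_le_trans xr r0d)).
  by rewrite (chart_boundary oU C bz (lt_le_trans zr' r0d)) subr0 ler_norm.
have [s0 _] := sig x cx xr.
have a1 : - (cc * NL * `|x - z|) <= c j * sigma x.
  rewrite lerNl; apply: le_trans (ler_norm _) _; rewrite normrN normrM -mulrA.
  by apply: ler_pM => //; rewrite ger0_norm.
have a2 : k2 * sqdist z x <= k2 * (n%:R * r) * `|x - z|.
  rewrite -mulrA ler_pM2l //; apply: le_trans (sqdist_le z x) _.
  rewrite expr2 mulrA -mulrA -[X in _ <= X]mulrA ler_wpM2l //.
  by rewrite ler_wpM2r //; move: xz r_pos; lra.
apply: le_trans (lerB a1 a2).
by rewrite [(_ + 1) * _]mulrDl [(_ + k2 * _) * _]mulrDl mul1r -opprD lerN2 lerDl.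
Qed.

End SmallEps.

(** * Small eps on the whole domain *)

Lemma max_gap_arith (R : realType) (a b c d s : R) :
  a - b <= s -> b - d <= a - c -> c - d - s <= 0.
Proof. by lra. Qed.

Lemma max_excess_arith (R : realType) (h h1 f1 f v T L del : R) :
  h - h1 < del -> - del < f1 - f -> f1 + h1 = - (3 * del) -> L < del ->
  - L <= T -> v + h = T -> f - v <= 0.
Proof. by lra. Qed.

Lemma dist_lt1_arith (R : realType) (a b : R) : `|a - b| < 1 -> `|b| <= `|a| + 1.
Proof.
by move=> ab; have := ler_normB a (a - b); rewrite opprB addrC subrK; lra.
Qed.

Section SmallEpsGlobal.
Context {R : realType} {n : nat} (U : set 'rV[R]_n) (oU : open U) (bU : bounded_set U).
Context (sU : smooth_boundary U).
Context (H : bool -> 'rV[R]_n -> 'rV[R]_n -> R) (psi : bool -> 'rV[R]_n -> R) (gam : R -> R).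
Context (HH : forall j, hamiltonian_assumptions U (H j)) (gamP : penalty_function gam).
Context (alpha : R) (alpha0 : 0 < alpha).
Context (psi_ge : forall j x, closure U x -> alpha <= psi j x).
Context (Phi : bool -> 'rV[R]_n -> R) (PhiS : forall j, strict_subsolution U (H j) (Phi j)).
Context (Phi_psi : forall j x, closure U x -> Phi j x - Phi (~~ j) x <= psi j x).
Implicit Types (x y z p w : 'rV[R]_n) (v : bool -> 'rV[R]_n -> R).

(** At an interior maximum of Phi - v the penalty of v vanishes, and the strict
    inequality for Phi absorbs eps times its locally bounded Laplacian. *)
Lemma small_eps_interior x1 : U x1 -> exists d : R, 0 < d /\ forall j eps v,
  0 < eps -> eps < d -> solves U H psi gam eps v -> forall x, U x -> `|x - x1| < d ->
  (forall j' x', closure U x' -> Phi j' x' - v j' x' <= Phi j x - v j x) ->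
  Phi j x - v j x <= 0.
Proof.
move=> Ux1.
apply: (@bool_uniform_small R (fun j d => forall eps v,
  0 < eps -> eps < d -> solves U H psi gam eps v -> forall x, U x -> `|x - x1| < d ->
  (forall j' x', closure U x' -> Phi j' x' - v j' x' <= Phi j x - v j x) ->
  Phi j x - v j x <= 0)).
  move=> j d d' dd Hd eps v eps0 ed sv x Ux xd; apply: (Hd eps) => //.
    exact: lt_le_trans dd.
  exact: lt_le_trans dd.
move=> j; have [PC2 PC1 _ Pneg] := PhiS j.
have cx1 := subset_closure Ux1.
have gradE x : U x -> grad_closure U (Phi j) x = grad (Phi j) x.
  by move=> Ux; apply/rowP => i; rewrite !mxE (Ck_closure_pderE oU PC1).
have neg1 := Pneg x1 cx1; rewrite (gradE x1 Ux1) in neg1.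
pose del := - (Phi j x1 + H j x1 (grad (Phi j) x1)) / 3.
have del0 : 0 < del by rewrite divr_gt0 // oppr_gt0.
have delE : Phi j x1 + H j x1 (grad (Phi j) x1) = - (3 * del).
  by rewrite /del mulrC divfK // opprK.
have [d1 [d10 Hd1]] := ham_continuous (HH j) (grad (Phi j) x1) cx1 del0.
have pcont s : (size s <= 2)%N -> forall e : R, 0 < e ->
    \forall x \near x1, `|pder s (Phi j) x1 - pder s (Phi j) x| < e.
  move=> s2 e e0; have := Ck_continuous PC2 s2 Ux1.
  by move/(@cvgrPdist_lt _ _ _ (nbhs x1) (nbhs_filter _)); apply.
have N1 : \forall x \near x1, forall i, `|pder [:: i] (Phi j) x1 - pder [:: i] (Phi j) x| < d1.
  by apply: (@filter_forall _ _ _ (nbhs x1)) => i; apply: pcont.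
have N2 : \forall x \near x1, forall i, `|pder [:: i; i] (Phi j) x1 - pder [:: i; i] (Phi j) x| < 1.
  by apply: (@filter_forall _ _ _ (nbhs x1)) => i; apply: pcont.
have N3 := pcont [::] isT del del0.
have /nbhs_ballP[d2 /= d20 Hd2] : \forall x \near x1,
   [/\ forall i, `|pder [:: i] (Phi j) x1 - pder [:: i] (Phi j) x| < d1,
       forall i, `|pder [:: i; i] (Phi j) x1 - pder [:: i; i] (Phi j) x| < 1 &
       `|Phi j x1 - Phi j x| < del].
  by apply: filterS3 N1 N2 N3 => x.
pose Lp := 1 + \sum_i (`|pder [:: i; i] (Phi j) x1| + 1).
have Lp0 : 0 < Lp by rewrite ltr_pwDl // sumr_ge0 // => i _; rewrite addr_ge0.
exists (Num.min (Num.min d1 d2) (del / Lp)); split; first by rewrite !lt_min d10 d20 divr_gt0.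
move=> eps v eps0; rewrite lt_min => /andP[_ epsL] sv x Ux; rewrite !lt_min => /andP[/andP[xd1 xd2] _] mx.
have cx := subset_closure Ux.
have [g1 l1 f1] : [/\ forall i, `|pder [:: i] (Phi j) x1 - pder [:: i] (Phi j) x| < d1,
       forall i, `|pder [:: i; i] (Phi j) x1 - pder [:: i; i] (Phi j) x| < 1 &
       `|Phi j x1 - Phi j x| < del].
  by apply: Hd2; rewrite -ball_normE /= distrC.
have gd : `|grad (Phi j) x - grad (Phi j) x1| < d1.
  by apply: rV_norm_lt => // i; have := g1 i; rewrite distrC !mxE.
have hH := Hd1 x (grad (Phi j) x) cx xd1 gd.
have hl : - Lp <= laplacian (Phi j) x.
  rewrite lerNl; apply: le_trans (ler_norm _) _; rewrite normrN.
  apply: le_trans (ler_norm_sum _ _ _) _; apply: ler_wpDl => //.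
  by apply: ler_sum => i _; exact: dist_lt1_arith (l1 i).
have [y Uy|/eqP gE lE] := jet_max oU (jet_lin 1 (-1) (jet_Ck PC2) (solves_jet j sv)) Ux.
  by rewrite !mul1r !mulN1r; apply: mx; exact: subset_closure.
have {}gE : grad (Phi j) x = grad (v j) x.
  by apply/eqP; rewrite -subr_eq0; move: gE; rewrite scale1r scaleN1r.
rewrite mul1r mulN1r subr_le0 in lE.
have hpsi := Phi_psi j cx.
have hm := mx (~~ j) x cx.
have := solves_eq j sv Ux; rewrite (penalty_eq0 gamP); last first.
  by rewrite pmulr_lle0 ?invr_gt0 //; exact: max_gap_arith hpsi hm.
rewrite -gE addr0 => E.
have e1 : eps * Lp < del by rewrite -ltr_pdivlMr.
have e2 : - (eps * Lp) <= eps * laplacian (v j) x.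
  by have := le_trans hl lE; rewrite -(ler_pM2l eps0) mulrN.
move: hH f1; rewrite !ltr_norml => /andP[_ h1] /andP[h2 _].
exact: (max_excess_arith h1 h2 delE e1 e2 E).
Qed.

(** Wherever the largest value of Phi - v is attained, inside or near the boundary,
    one of the two local lemmas bounds it by kap; compactness makes the threshold
    for eps uniform in the position of the maximum. *)
Lemma small_eps_global (kap : R) : 0 < kap -> U !=set0 -> exists E : R, 0 < E /\
  forall eps v, 0 < eps -> eps < E -> solves U H psi gam eps v -> excess_le U Phi kap v.
Proof.
move=> kap0 U0.
pose P (T : R) x := forall eps v, 0 < eps -> eps * T < 1 -> solves U H psi gam eps v ->
  forall j, (forall j' x', closure U x' -> Phi j' x' - v j' x' <= Phi j x - v j x) ->
  Phi j x - v j x <= kap.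
have [| x1 cx1|T [T0 HT]] := @compact_uniform R _ (closure U) P (compact_closure bU).
- move=> T T' x TT' PT eps v eps0 eT; apply: (PT eps v eps0).
  by apply: le_lt_trans eT; rewrite ler_pM2l.
- have [Ux1|bx1] := closure_inside_or_boundary oU cx1.
    have [d [d0 Hd]] := small_eps_interior Ux1.
    exists d^-1; apply/nbhs_ballP; exists d => //= x; rewrite -ball_normE /= distrC => xd cx.
    move=> eps v eps0; rewrite ltr_pdivrMr // mul1r => eT sv j mx.
    have [Ux|bx] := closure_inside_or_boundary oU cx.
      by apply: le_trans (ltW kap0); exact: (Hd j eps v eps0 eT sv x Ux xd mx).
    by rewrite (Phi_boundary PhiS j bx) (solves_boundary j sv bx) subr0 ltW.
  have [r [q [C [E [[r0 q0 qk C0 E0] Hloc]]]]] :=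
    small_eps_local oU bU sU HH gamP alpha0 psi_ge PhiS bx1 kap0.
  exists E^-1; apply/nbhs_ballP; exists (r / 2) => /=; first by rewrite divr_gt0.
  move=> x; rewrite -ball_normE /= distrC => xd cx eps v eps0; rewrite ltr_pdivrMr // mul1r => eT sv j mx.
  have [Ux|bx] := closure_inside_or_boundary oU cx; last first.
    by rewrite (Phi_boundary PhiS j bx) (solves_boundary j sv bx) subr0 ltW.
  have [H1 _] := Hloc eps v (Phi j x - v j x) eps0 eT sv mx.
  exact: (H1 j x Ux xd erefl).
- exists T^-1; split; first by rewrite invr_gt0.
  move=> eps v eps0 eT sv j x cx.
  have [i [c [cc cm]]] : exists i c, closure U c /\ forall j' t, closure U t ->
      1 * Phi j' t + (-1) * v j' t <= 1 * Phi i c + (-1) * v i c.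
    apply: (@bool_max _ _ (closure U) (fun j x => 1 * Phi j x + (-1) * v j x)).
    - by exists x.
    - exact: compact_closure.
    - move=> k; apply: within_lin; last exact: solves_continuous sv.
      exact: (Ck_closure_continuous (Phi_C1 PhiS k)).
  have mm j' x' : closure U x' -> Phi j' x' - v j' x' <= Phi i c - v i c.
    by move=> /(cm j'); rewrite !mul1r !mulN1r.
  apply: le_trans (mm j x cx) _; apply: (HT c cc eps v eps0 _ sv i mm).
  by rewrite -ltr_pdivlMr // mul1r.
Qed.

Lemma lower_bound_small x0 : boundary U x0 -> exists C d E : R, [/\ 0 < C, 0 < d, 0 < E &
  forall eps v z, 0 < eps -> eps < E -> solves U H psi gam eps v -> boundary U z ->
  `|z - x0| < d -> forall j x, U x -> - (C * `|x - z|) <= v j x].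
Proof.
move=> bx0.
have U0 : U !=set0.
  have [x [Ux _]] : U `&` setT !=set0 by have := boundary_closure bx0; apply; exact: filterT.
  by exists x.
have psi_ge0 j x : closure U x -> 0 <= psi j x by move=> /(psi_ge j); apply: le_trans; exact: ltW.
have [C0 [C00 HC0]] := sup_bound oU bU HH gamP psi_ge0.
have [r [q [C [E [[r0 q0 qk C1 E0] Hloc]]]]] :=
    small_eps_local oU bU sU HH gamP alpha0 psi_ge PhiS bx0 ltr01.
have [E2 [E20 HE2]] := small_eps_global q0 U0.
have r20 : 0 < r / 2 by rewrite divr_gt0.
exists (C + C0 / (r / 2)), (r / 2), (Num.min E E2); split=> //.
- by rewrite addr_gt0 // divr_gt0.
- by rewrite lt_min E0.
move=> eps v z eps0; rewrite lt_min => /andP[eE eE2] sv bz zr j x Ux.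
have [_ /(_ (lexx q)) H2] := Hloc eps v q eps0 eE sv (HE2 eps v eps0 eE2 sv).
have [xz|xz] := ltP `|x - z| (r / 2).
  apply: le_trans (H2 z bz zr j x Ux xz); rewrite lerN2 ler_wpM2r // lerDl.
  by rewrite divr_ge0 // ltW.
rewrite lerNl; apply: le_trans (far_bound r20 (ltW C00) _ xz) _.
  apply: le_trans (ler_norm _) _; rewrite normrN.
  exact: (HC0 eps v eps0 sv j x (subset_closure Ux)).
by rewrite ler_wpM2r // lerDr ltW.
Qed.

End SmallEpsGlobal.

(** * Boundary Lipschitz bound for all eps *)

Section Lipschitz.
Context {R : realType} {n : nat} (U : set 'rV[R]_n) (oU : open U) (bU : bounded_set U).
Context (sU : smooth_boundary U).
Context (H : bool -> 'rV[R]_n -> 'rV[R]_n -> R) (psi : bool -> 'rV[R]_n -> R) (gam : R -> R).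
Context (HH : forall j, hamiltonian_assumptions U (H j)) (gamP : penalty_function gam).
Context (alpha : R) (alpha0 : 0 < alpha).
Context (psi_ge : forall j x, closure U x -> alpha <= psi j x).
Context (Phi : bool -> 'rV[R]_n -> R) (PhiS : forall j, strict_subsolution U (H j) (Phi j)).
Context (Phi_psi : forall j x, closure U x -> Phi j x - Phi (~~ j) x <= psi j x).
Context (u : R -> bool -> 'rV[R]_n -> R).
Context (su : forall eps, 0 < eps -> solves U H psi gam eps (u eps)).
Implicit Types (x y z p w : 'rV[R]_n) (v : bool -> 'rV[R]_n -> R).

Let psi_ge0 j x : closure U x -> 0 <= psi j x.
Proof. by move=> /(psi_ge j); apply: le_trans; exact: ltW. Qed.

Let below eps (T : R) z := forall j x, U x -> - (T * `|x - z|) <= u eps j x.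

Let below_le eps (T T' : R) z : T <= T' -> below eps T z -> below eps T' z.
Proof. by move=> TT B j x Ux; apply: le_trans (B j x Ux); rewrite lerN2 ler_wpM2r. Qed.

(** The range of eps splits into a neighbourhood of 0, one of infinity, and a
    compact interval covered by neighbourhoods of finitely many values. *)
Lemma lower_distance_bound : exists C : R, 0 < C /\ forall eps, 0 < eps ->
  forall z, boundary U z -> below eps C z.
Proof.
have cB := compact_boundary oU bU.
have [||Ts [Ts0 Hs]] := @compact_uniform R _ (boundary U)
  (fun T z => forall eps, 0 < eps -> eps * T < 1 -> below eps T z) cB.
- move=> T T' z TT PT eps eps0 eT.
  have eT' : eps * T < 1 by apply: le_lt_trans eT; rewrite ler_pM2l.
  exact: (below_le TT (PT eps eps0 eT')).
- move=> x0 bx0.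
  have [C [d [E [C0 d0 E0 HE]]]] := lower_bound_small oU bU sU HH gamP alpha0 psi_ge PhiS Phi_psi bx0.
  exists (C + E^-1); apply/nbhs_ballP; exists d => //= z; rewrite -ball_normE /= distrC => zd bz.
  move=> eps eps0 eT j x Ux; apply: (@below_le eps C) => //; first by rewrite lerDl invr_ge0 ltW.
  have eE : eps < E.
    rewrite -[E]mul1r -ltr_pdivrMr //; apply: le_lt_trans eT.
    by rewrite ler_pM2l // lerDr ltW.
  by move=> k y Uy; exact: (HE eps _ z eps0 eE (su eps0) bz zd k y Uy).
have [||Tl [Tl0 Hl]] := @compact_uniform R _ (boundary U)
  (fun T z => forall eps, 0 < eps -> T < eps -> below eps T z) cB.
- move=> T T' z TT PT eps eps0 eT.
  exact: (below_le TT (PT eps eps0 (le_lt_trans TT eT))).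
- move=> x0 bx0.
  have [C [d [E [C0 d0 E0 HE]]]] := lower_bound_large oU bU sU HH gamP psi_ge0 bx0.
  exists (C + E); apply/nbhs_ballP; exists d => //= z; rewrite -ball_normE /= distrC => zd bz.
  move=> eps eps0 eT j x Ux; apply: (@below_le eps C) => //; first by rewrite lerDl ltW.
  have eE : E < eps by apply: le_lt_trans eT; rewrite lerDr ltW.
  by move=> k y Uy; exact: (HE eps _ z eE (su eps0) bz zd k y Uy).
have mid es : 0 < es -> exists T, 0 < T /\ forall z, boundary U z ->
    forall eps, 0 < eps -> `|eps - es| * T < 1 -> below eps T z.
  move=> es0; apply: compact_uniform => //.
    move=> T T' z TT PT eps eps0 eT.
    have eT' : `|eps - es| * T < 1 by apply: le_lt_trans eT; rewrite ler_wpM2l.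
    exact: (below_le TT (PT eps eps0 eT')).
  move=> x0 bx0.
  have [C [d [dl [C0 d0 dl0 HE]]]] := lower_bound_mid oU bU sU HH gamP psi_ge0 es0 (su es0) bx0.
  exists (C + dl^-1); apply/nbhs_ballP; exists d => //= z; rewrite -ball_normE /= distrC => zd bz.
  move=> eps eps0 eT j x Ux; apply: (@below_le eps C) => //; first by rewrite lerDl invr_ge0 ltW.
  have eE : `|eps - es| < dl.
    rewrite -[dl]mul1r -ltr_pdivrMr //; apply: le_lt_trans eT.
    by rewrite ler_wpM2l // lerDr ltW.
  by move=> k y Uy; exact: (HE eps _ z eps0 eE (su eps0) bz zd k y Uy).
have [||Tm [Tm0 Hm]] := @compact_uniform R _ (`[Ts^-1, Tl]%classic)
  (fun T es => forall z, boundary U z -> below es T z) (@segment_compact _ _ _).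
- move=> T T' es TT PT z bz; exact: (below_le TT (PT z bz)).
- move=> es; rewrite /= in_itv /= => /andP[es1 es2].
  have es0 : 0 < es by apply: lt_le_trans es1; rewrite invr_gt0.
  have [T [T0 HT]] := mid es es0.
  exists T; apply/nbhs_ballP; exists T^-1 => /=; first by rewrite invr_gt0.
  move=> e; rewrite /ball /= distrC => ee; rewrite in_itv /= => /andP[e1 e2] z bz.
  apply: HT => //; first by apply: lt_le_trans e1; rewrite invr_gt0.
  by rewrite -ltr_pdivlMr // mul1r.
exists (Ts + Tl + Tm); split; first by rewrite !addr_gt0.
move=> eps eps0 z bz.
have [es|es] := ltP (eps * Ts) 1.
  by apply: below_le (Hs z bz eps eps0 es); rewrite -addrA lerDl addr_ge0 // ltW.
have [el|el] := ltP Tl eps.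
  by apply: below_le (Hl z bz eps eps0 el); rewrite addrAC lerDr addr_ge0 // ltW.
apply: below_le (Hm eps _ z bz); first by rewrite lerDr addr_ge0 // ltW.
by rewrite /= in_itv /= el andbT -[leLHS]mul1r ler_pdivrMr.
Qed.

Lemma distance_bound : exists C : R, 0 < C /\ forall eps, 0 < eps ->
  forall j x z, U x -> boundary U z -> `|u eps j x| <= C * `|x - z|.
Proof.
have [C1 [C10 H1]] := lower_distance_bound.
have [||C2 [C20 H2]] := @compact_uniform R _ (boundary U)
  (fun T z => forall eps, 0 < eps -> forall j x, U x -> u eps j x <= T * `|x - z|)
  (compact_boundary oU bU).
- move=> T T' z TT PT eps eps0 j x Ux; apply: le_trans (PT eps eps0 j x Ux) _.
  by rewrite ler_wpM2r.
- move=> x0 bx0.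
  have [C [d [C0 d0 HE]]] := upper_bound_local oU bU sU HH gamP psi_ge0 bx0.
  exists C; apply/nbhs_ballP; exists d => //= z; rewrite -ball_normE /= distrC => zd bz.
  by move=> eps eps0 j x Ux; exact: (HE eps _ z eps0 (su eps0) bz zd j x Ux).
exists (C1 + C2); split; first exact: addr_gt0.
move=> eps eps0 j x z Ux bz; rewrite ler_norml; apply/andP; split.
  apply: le_trans (H1 eps eps0 z bz j x Ux); rewrite lerN2 ler_wpM2r // lerDl; exact: ltW.
by apply: le_trans (H2 z bz eps eps0 j x Ux) _; rewrite ler_wpM2r // lerDr ltW.
Qed.

(** Both barriers give |u| <= C |x - z| for every boundary point z, so the
    gradient at the boundary is at most 5 C. *)
Lemma boundary_gradient_bound : exists C : R, 0 < C /\ forall eps, 0 < eps ->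
  forall j x k, boundary U x -> `|closure_ext U (pder [:: k] (u eps j)) x| <= C.
Proof.
have [C [C0 HC]] := distance_bound.
exists (5 * C); split; first exact: mulr_gt0.
move=> eps eps0 j x k bx.
have [uC _ _] := su eps0 j.
have [uC1 _ _] := uC 1%N.
apply: (@boundary_gradient _ _ U oU bU (u eps j) (pder [:: k] (u eps j)) k x _ _ 1) => //.
- by move=> y Uy _; apply: derivableP; have [_] := uC1 [::]; apply.
- by move=> y z Uy bz _ _; exact: HC.
- exact: (Ck_closure_near oU (uC 1%N) (s := [:: k]) isT (boundary_closure bx)).
Qed.

End Lipschitz.

(** * Bernstein's interior estimate *)

Section Bernstein.
Context {R : realType} {n : nat} (U : set 'rV[R]_n) (oU : open U).
Implicit Types (x y z p w : 'rV[R]_n).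
Local Notation e_ i := (delta_mx (0 : 'I_1) i).

Lemma pder_cat (s t : seq 'I_n) (f : 'rV[R]_n -> R) : pder s (pder t f) = pder (s ++ t) f.
Proof. by elim: s => [//|i s /= ->]. Qed.

Lemma Ck_pder k s f : Ck U (size s + k) f -> Ck U k (pder s f).
Proof.
move=> fC t; rewrite pder_cat; have [c d] := fC (t ++ s).
by rewrite size_cat addnC in c d; split=> h; [apply: c; rewrite leq_add2l|apply: d; rewrite ltn_add2l].
Qed.

Lemma jet_sum (V : set 'rV[R]_n) f g l :
  (forall k : 'I_n, has_jet V (f k) (g k) (l k)) ->
  has_jet V (fun x => \sum_k f k x) (fun x => \sum_k g k x) (fun x => \sum_k l k x).
Proof.
move=> J x Vx.
have [h Hh] := choice (fun k => J k x Vx).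
exists (fun i => \sum_k h k i); split=> [i|i|].
- rewrite (_ : (fun x => \sum_k f k x) = \sum_k f k); last by apply/funext => y; rewrite fct_sumE.
  rewrite summxE; apply: is_derive_sum => k.
  by have [+ _ _] := Hh k; apply.
- rewrite (_ : (fun y => (\sum_k g k y) 0 i) = \sum_k (fun y => g k y 0 i)); last first.
    by apply/funext => y; rewrite fct_sumE summxE.
  by apply: is_derive_sum => k; have [_ + _] := Hh k; apply.
- by rewrite exchange_big /=; apply: eq_bigr => k _; have [_ _] := Hh k.
Qed.

(** Schwarz's theorem is used twice, first at x for a first derivative of u, then
    near x for u itself, since a derivative is taken afterwards. *)
Lemma pder_laplacian u x k : Ck U 3 u -> U x ->
  is_derive x (e_ k) (laplacian u) (laplacian (pder [:: k] u) x).
Proof.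
move=> uC Ux.
have -> : laplacian u = \sum_i pder [:: i; i] u by apply/funext => y; rewrite fct_sumE.
apply: is_derive_sum => i.
have d : derivable (pder [:: i; i] u) x (e_ k) by have [_] := uC [:: i; i]; apply.
have uC2 : Ck U 2 u by move=> s; have [a b] := uC s; split=> h; [apply: a; exact: leqW|apply: b; exact: leqW].
have := derivableP d; move=> D; apply: (is_derive_eq D).
have -> : 'D_(e_ k) (pder [:: i; i] u) x = pder [:: k; i] (pder [:: i] u) x by [].
rewrite (pder_swap k i oU (@Ck_pder 2 [:: i] u uC) Ux).
have -> : pder [:: i; k] (pder [:: i] u) x = 'D_(e_ i) (pder [:: k; i] u) x by [].
have -> : pder [:: i; i] (pder [:: k] u) x = 'D_(e_ i) (pder [:: i; k] u) x by [].
apply: near_eq_derive.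
have := open_nbhs_nbhs (conj oU Ux); apply: filterS => y Uy.
exact: (pder_swap k i oU uC2 Uy).
Qed.

(** Here N is the sup norm of the gradient, S its squared length and T the squared
    length of the Hessian. Multiplied by m, the trace inequality turns eps T into
    N^2 / eps, which beats the term in P / eps, while N^2 beats the one in K. *)
Lemma bernstein_arith (m eps N S T A K P h dot1 dot2 pl lap : R) :
  1 <= m -> 0 < eps -> 0 <= N -> N ^+ 2 <= S -> 0 <= K -> 0 <= P -> 0 <= h -> h <= 1 ->
  T + pl <= 0 -> lap ^+ 2 <= m * T ->
  eps * pl = S + A + h / eps * (S - dot1 - dot2) ->
  `|A| <= m * K * N -> `|dot2| <= m * P * N -> dot1 <= S ->
  N <= eps * lap ->
  N <= m ^+ 2 * (K + P).
Proof.
move=> m1 eps0 N0 NS K0 P0 h0 h1 Tp lT E hA hd2 hd1 hl.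
have m0 : 0 < m by apply: lt_le_trans m1.
rewrite leNgt; apply/negP => NB.
have Npos : 0 < N by apply: le_lt_trans NB; rewrite mulr_ge0 ?addr_ge0 // exprn_ge0 // ltW.
have he : 0 <= h / eps by rewrite divr_ge0 // ltW.
have q1 : - (eps^-1 * (m * P * N)) <= h / eps * (S - dot1 - dot2).
  apply: (@le_trans _ _ (h / eps * (- (m * P * N)))).
    rewrite mulrN lerN2 ler_wpM2r //; first by rewrite !mulr_ge0 // ltW.
    by rewrite ler_piMl // invr_ge0 ltW.
  rewrite ler_wpM2l //; move: hd2; rewrite ler_norml => /andP[_ d2].
  by move: hd1 d2; lra.
have q2 : N ^+ 2 <= eps ^+ 2 * (m * T).
  apply: (@le_trans _ _ ((eps * lap) ^+ 2)); last by rewrite exprMn ler_pM2l ?exprn_gt0.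
  by rewrite ler_pXn2r ?nnegrE //; exact: le_trans hl.
have q3 : eps * T + eps * pl <= 0 by rewrite -mulrDr pmulr_rle0.
have q4 : eps^-1 * N ^+ 2 <= m * (eps * T).
  rewrite ler_pdivrMl //; apply: le_trans q2 _.
  by rewrite le_eqVlt; apply/orP; left; apply/eqP; ring.
have q5 : - (m * K * N) <= A by move: hA; rewrite ler_norml => /andP[].
have q6 : m * (eps * T) + m * (N ^+ 2 - m * K * N - eps^-1 * (m * P * N)) <= 0.
  rewrite -mulrDr pmulr_rle0 //; rewrite E in q3.
  by move: q1 q3 q5 NS; move: (h / eps * _) (eps^-1 * _) => *; lra.
have q7 : m * (m * K * N) < m * N ^+ 2.
  rewrite ltr_pM2l // expr2 ltr_pM2r //; apply: le_lt_trans NB.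
  rewrite mulrDr; apply: ler_wpDr; first by rewrite mulr_ge0 // exprn_ge0 // ltW.
  by rewrite ler_wpM2r // expr2 ler_peMl // ltW.
have q8 : m * (eps^-1 * (m * P * N)) < eps^-1 * N ^+ 2.
  rewrite mulrCA ltr_pM2l ?invr_gt0 // expr2 !mulrA ltr_pM2r //; apply: le_lt_trans NB.
  by rewrite -expr2 mulrDr lerDr mulr_ge0 // exprn_ge0 // ltW.
by move: q4 q6 q7 q8; rewrite !mulrBr; lra.
Qed.

Lemma sqr_sum_le (a : 'I_n -> R) : (\sum_i a i) ^+ 2 <= n%:R * \sum_i a i ^+ 2.
Proof.
have -> : (\sum_i a i) ^+ 2 = \sum_i \sum_j a i * a j.
  by rewrite expr2 mulr_suml; apply: eq_bigr => i _; rewrite mulr_sumr.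
apply: (@le_trans _ _ (\sum_(i < n) \sum_(j < n) (a i ^+ 2 + a j ^+ 2) / 2)).
  apply: ler_sum => i _; apply: ler_sum => j _.
  by rewrite ler_pdivlMr //; have := sqr_ge0 (a i - a j); rewrite sqrrB; lra.
set S := \sum_(i < n) a i ^+ 2.
have inner i : \sum_(j < n) (a i ^+ 2 + a j ^+ 2) / 2 = (n%:R * a i ^+ 2 + S) / 2.
  by rewrite -mulr_suml big_split /= sumr_const card_ord mulr_natl.
rewrite (eq_bigr _ (fun i _ => inner i)) -mulr_suml big_split /= -mulr_sumr.
rewrite sumr_const card_ord -/S -[S *+ n]mulr_natl. by lra.
Qed.

(** Summing the differentiated equations against the gradient kills the drift. *)
Lemma bernstein_sum (p a q s b lap : 'I_n -> R) (D : 'I_n -> 'I_n -> R) (eps c : R) :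
  (forall k, eps * lap k = p k + (a k + \sum_i b i * D k i) + c * (p k - q k - s k)) ->
  (forall i, \sum_k p k * D k i = 0) ->
  eps * (\sum_k p k * lap k) =
    \sum_k p k ^+ 2 + \sum_k a k * p k + c * (\sum_k p k ^+ 2 - \sum_k p k * q k - \sum_k s k * p k).
Proof.
move=> E G.
have drift : \sum_k p k * (\sum_i b i * D k i) = 0.
  under eq_bigr => k _ do rewrite mulr_sumr.
  rewrite exchange_big big1 //= => i _.
  transitivity (b i * \sum_k p k * D k i); last by rewrite G mulr0.
  rewrite mulr_sumr; by apply: eq_bigr => k _; rewrite mulrCA.
rewrite mulr_sumr (eq_bigr (fun k => (p k ^+ 2 + a k * p k
    + c * (p k ^+ 2 - p k * q k - s k * p k)) + p k * (\sum_i b i * D k i))); last first.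
  by move=> k _; rewrite mulrCA E; ring.
by rewrite !big_split /= drift addr0 -mulr_sumr !big_split /= !sumrN.
Qed.

Lemma dot_le_sqr (p q : 'I_n -> R) : \sum_k q k ^+ 2 <= \sum_k p k ^+ 2 ->
  \sum_k p k * q k <= \sum_k p k ^+ 2.
Proof.
move=> qp; apply: (@le_trans _ _ (\sum_k (p k ^+ 2 + q k ^+ 2) / 2)).
  apply: ler_sum => k _.
  by rewrite ler_pdivlMr //; have := sqr_ge0 (p k - q k); rewrite sqrrB; lra.
by rewrite -mulr_suml big_split /=; move: qp; lra.
Qed.

Lemma dot_le_bound (a p : 'I_n -> R) (K N : R) : 0 <= K ->
  (forall k, `|a k| <= K) -> (forall k, `|p k| <= N) -> `|\sum_k a k * p k| <= n%:R * K * N.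
Proof.
move=> K0 aK pN; apply: le_trans (ler_norm_sum _ _ _) _.
rewrite -mulrA mulr_natl -[X in _ *+ X]card_ord -sumr_const; apply: ler_sum => k _.
by rewrite normrM ler_pM.
Qed.

End Bernstein.

Lemma coercive_gap (R : realType) (N C0 rho v h g : R) :
  rho + C0 < N -> 0 < rho -> - C0 <= v -> 2 * N <= h -> 0 <= g -> N <= v + h + g.
Proof. by lra. Qed.

Section Gradient.
Context {R : realType} {n : nat} (n0 : (0 < n)%N) (U : set 'rV[R]_n) (oU : open U) (bU : bounded_set U).
Context (sU : smooth_boundary U).
Context (H : bool -> 'rV[R]_n -> 'rV[R]_n -> R) (psi : bool -> 'rV[R]_n -> R) (gam : R -> R).
Context (HH : forall j, hamiltonian_assumptions U (H j)) (gamP : penalty_function gam).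
Context (psiC : forall j, smooth_closure U (psi j)).
Context (psi_ge0 : forall j x, closure U x -> 0 <= psi j x).
Implicit Types (x y z p w : 'rV[R]_n) (v : bool -> 'rV[R]_n -> R).
Local Notation e_ i := (delta_mx (0 : 'I_1) i).

Lemma penalty_chain eps v j x k : 0 < eps -> solves U H psi gam eps v -> U x ->
  is_derive x (e_ k) (fun y => gam ((v j y - v (~~ j) y - psi j y) / eps))
   (derive1 gam ((v j x - v (~~ j) x - psi j x) / eps) / eps *
     (pder [:: k] (v j) x - pder [:: k] (v (~~ j)) x - pder [:: k] (psi j) x)).
Proof.
move=> eps0 sv Ux.
have d f : smooth_closure U f -> is_derive x (e_ k) f (pder [:: k] f x).
  move=> /(_ 1%N)[fC _ _]; apply: derivableP; have [_] := fC [::]; apply => //.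
have dv i : is_derive x (e_ k) (v i) (pder [:: k] (v i) x) by apply: d; have [] := sv i.
have D := is_deriveZ (eps^-1) (is_deriveB (is_deriveB (dv j) (dv (~~ j))) (d _ (psiC j))).
apply: is_derive_line0.
set G := eps^-1 \*: _ in D.
have DG : is_derive (0 : R) 1 (fun s : R => G (x + s *: e_ k))
    (eps^-1 *: (pder [:: k] (v j) x - pder [:: k] (v (~~ j)) x - pder [:: k] (psi j) x)).
  by apply: is_derive_line; rewrite scale0r addr0.
have Dg : is_derive (G (x + 0 *: e_ k)) 1 gam (derive1 gam (G (x + 0 *: e_ k))).
  exact: penalty_is_derive.
have := @is_derive1_comp R gam (fun s : R => G (x + s *: e_ k)) 0 _ _ Dg DG.
rewrite scale0r addr0.
have GE y : G y = (v j y - v (~~ j) y - psi j y) / eps by rewrite /G /= mulrC.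
rewrite (_ : gam \o _ = fun s : R => gam ((v j (x + s *: e_ k) - v (~~ j) (x + s *: e_ k) - psi j (x + s *: e_ k)) / eps)); last first.
  by apply/funext => s; rewrite /= GE.
move=> D1; apply: (is_derive_eq D1).
by rewrite GE -mulrA.
Qed.

(** Bernstein's method: differentiating the equation along Dv_j removes the drift, the
    coupling term has a sign up to |D psi| / eps, and eps |D^2 v_j|^2, which the
    equation bounds below through eps times the Laplacian, absorbs it. *)
Lemma interior_gradient_bound : exists B : R, 0 < B /\ forall eps v j c,
  0 < eps -> solves U H psi gam eps v -> U c ->
  (forall j' x, U x -> \sum_k pder [:: k] (v j') x ^+ 2 <= \sum_k pder [:: k] (v j) c ^+ 2) ->
  `|grad (v j) c| <= B.
Proof.
have [C0 [C00 HC0]] := sup_bound oU bU HH gamP psi_ge0.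
have [K [K0 HK]] : exists K, 0 < K /\ forall j x p (k : 'I_n), U x ->
   `|pder [:: lshift n k] (fun z : 'rV[R]_(n + n) => H j (lsubmx z) (rsubmx z)) (row_mx x p)| <= K.
  apply: (@bool_uniform R (fun j K => forall x p (k : 'I_n), U x ->
   `|pder [:: lshift n k] (fun z : 'rV[R]_(n + n) => H j (lsubmx z) (rsubmx z)) (row_mx x p)| <= K)).
    by move=> j C C' CC HC x p k Ux; exact: le_trans (HC x p k Ux) CC.
  by move=> j; exact: (ham_Dx_bounded oU (HH j)).
have [P [P0 HP]] : exists P, 0 < P /\ forall j x, U x -> `|grad (psi j) x| <= P.
  apply: (@bool_uniform R (fun j P => forall x, U x -> `|grad (psi j) x| <= P)).
    by move=> j C C' CC HC x Ux; exact: le_trans (HC x Ux) CC.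
  by move=> j; exact: (grad_bounded oU bU (psiC j 1%N)).
have [rho [rho0 Hrho]] := ham_coercive2 HH (ler0n R 2).
have m1 : 1 <= (n%:R : R) by rewrite ler1n.
exists (rho + C0 + n%:R ^+ 2 * (K + P)); split.
  by rewrite ltr_pwDl ?addr_gt0 // mulr_ge0 ?exprn_ge0 // addr_ge0 // ltW.
move=> eps v j c eps0 sv Uc mx.
have [small|large] := leP `|grad (v j) c| (rho + C0).
  by apply: le_trans small _; rewrite lerDl mulr_ge0 ?exprn_ge0 // addr_ge0 ?ltW.
have cc := subset_closure Uc.
have [vC vEq _] := sv j.
have [vC3 _ _] := vC 3%N.
have [vC2 _ _] := vC 2%N.
pose p k := pder [:: k] (v j) c.
(* First- and second-order conditions at the maximum of |Dv_j|^2. *)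
have J := jet_sum (fun k => jet_sqr (jet_Ck (@Ck_pder _ _ _ 2 [:: k] (v j) vC3))).
have [G L] := jet_max oU J Uc (mx j).
have G0 i : \sum_k p k * pder [:: k; i] (v j) c = 0.
  move/rowP: G => /(_ i); rewrite summxE mxE => G.
  apply: (mulfI (_ : (2 : R) != 0)); first by rewrite pnatr_eq0.
  rewrite mulr0 mulr_sumr -[RHS]G; apply: eq_bigr => k _.
  by rewrite !mxE (pder_swap k i oU vC2 Uc) mulrA.
pose T := \sum_k \sum_i pder [:: i; k] (v j) c ^+ 2.
have L0 : T + \sum_k p k * laplacian (pder [:: k] (v j)) c <= 0.
  rewrite -(ler_pM2l (ltr0n R 2)) mulr0; apply: le_trans L.
  rewrite mulrDr !mulr_sumr -big_split /= le_eqVlt; apply/orP; left; apply/eqP.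
  apply: eq_bigr => k _; rewrite addrC mulrA; congr (_ + _ * _).
  by apply: eq_bigr => i _; rewrite mxE.
(* The equation differentiated along the k-th axis. *)
have [a [b [aE Hchain]]] := ham_chain_rule oU (HH j) vC2 Uc.
set h := derive1 gam ((v j c - v (~~ j) c - psi j c) / eps).
have Deq k : eps * laplacian (pder [:: k] (v j)) c =
    p k + (a k + \sum_i b i * pder [:: k; i] (v j) c) +
    h / eps * (p k - pder [:: k] (v (~~ j)) c - pder [:: k] (psi j) c).
  have dv : is_derive c (e_ k) (v j) (p k).
    by apply: derivableP; have [_] := vC2 [::]; apply.
  have D1 := is_deriveD (is_deriveD dv (Hchain k)) (penalty_chain j k eps0 sv Uc).
  have D2 := is_deriveZ eps (@pder_laplacian _ _ U oU (v j) c k vC3 Uc).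
  have [_ <-] := D1; have [_ E2] := D2; apply: etrans (esym E2) _.
  apply: near_eq_derive; have := open_nbhs_nbhs (conj oU Uc).
  by apply: filterS => y Uy; rewrite -[LHS]/(eps * laplacian (v j) y) -(vEq y Uy).
have E := bernstein_sum Deq G0.
set N := `|grad (v j) c|.
have pN k : `|p k| <= N by have := rV_coord_le (grad (v j) c) k; rewrite mxE.
have NS : N ^+ 2 <= \sum_k p k ^+ 2.
  apply: le_trans (norm_sqr_le _) _; apply: ler_sum => k _; rewrite mxE; exact: lexx.
have aK k : `|a k| <= K by rewrite aE; exact: HK.
have sP k : `|pder [:: k] (psi j) c| <= P.
  by have := rV_coord_le (grad (psi j) c) k; rewrite mxE => /le_trans; apply; exact: HP.
have lapT : laplacian (v j) c ^+ 2 <= n%:R * T.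
  apply: le_trans (sqr_sum_le _) _; rewrite ler_pM2l ?ltr0n //.
  apply: ler_sum => k _; rewrite [leRHS](bigD1 k) //= lerDl.
  by apply: sumr_ge0 => i _; exact: sqr_ge0.
have Nlap : N <= eps * laplacian (v j) c.
  rewrite -(vEq c Uc).
  have rN : rho <= N by apply: le_trans (ltW large); rewrite lerDl ltW.
  have := HC0 eps v eps0 sv j c cc; rewrite ler_norml => /andP[g1 _].
  have g2 := Hrho j c _ cc rN.
  have g3 := penalty_ge0 gamP ((v j c - v (~~ j) c - psi j c) / eps).
  exact: (coercive_gap large rho0 g1 g2 g3).
have /andP[h0 h1] := penalty_derive_bounds gamP ((v j c - v (~~ j) c - psi j c) / eps).
apply: le_trans (_ : n%:R ^+ 2 * (K + P) <= _); last first.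
  by rewrite lerDr addr_ge0 // ltW.
have N0 : 0 <= N by exact: normr_ge0.
have Z := bernstein_arith m1 eps0 N0 NS (ltW K0) (ltW P0) h0 h1 L0 lapT E.
apply: Z.
- exact: (dot_le_bound (ltW K0) aK pN).
- exact: (dot_le_bound (ltW P0) sP pN).
- by apply: dot_le_sqr; exact: mx (~~ j) c Uc.
- exact: Nlap.
Qed.

End Gradient.

(** * The uniform bound *)

Section UniformGradientBound.
Context {R : realType} {n : nat} (n0 : (0 < n)%N) (U : set 'rV[R]_n) (oU : open U) (bU : bounded_set U).
Context (sU : smooth_boundary U).
Context (H : bool -> 'rV[R]_n -> 'rV[R]_n -> R) (psi : bool -> 'rV[R]_n -> R) (gam : R -> R).
Context (HH : forall j, hamiltonian_assumptions U (H j)) (gamP : penalty_function gam).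
Context (psiC : forall j, smooth_closure U (psi j)).
Context (alpha : R) (alpha0 : 0 < alpha).
Context (psi_ge : forall j x, closure U x -> alpha <= psi j x).
Context (Phi : bool -> 'rV[R]_n -> R) (PhiS : forall j, strict_subsolution U (H j) (Phi j)).
Context (Phi_psi : forall j x, closure U x -> Phi j x - Phi (~~ j) x <= psi j x).
Context (u : R -> bool -> 'rV[R]_n -> R).
Context (su : forall eps, 0 < eps -> solves U H psi gam eps (u eps)).
Implicit Types (x y z : 'rV[R]_n).

(** The squared gradient, extended to the closure, is maximal either on the
    boundary, where the barriers bound it, or inside, where Bernstein's
    argument does. *)
Lemma uniform_gradient_bound : exists C : R, 0 < C /\ forall eps, 0 < eps ->
  forall j x, U x -> norm2 (grad (u eps j) x) <= C.
Proof.
have psi_ge0 j x : closure U x -> 0 <= psi j x by move=> /(psi_ge j); apply: le_trans; exact: ltW.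
have [C [C0 HC]] := boundary_gradient_bound oU bU sU HH gamP alpha0 psi_ge PhiS Phi_psi su.
have [B [B0 HB]] := interior_gradient_bound n0 oU bU HH gamP psiC psi_ge0.
pose D := n%:R * (C + B) ^+ 2.
exists (Num.sqrt D + 1); split; first by rewrite ltr_wpDl // sqrtr_ge0.
move=> eps eps0 j x Ux.
have vC k j' : Ck_closure U k (u eps j') by have [+ _ _] := su eps0 j'; apply.
pose W j' y := \sum_k closure_ext U (pder [:: k] (u eps j')) y ^+ 2.
have WE j' y : U y -> W j' y = \sum_k pder [:: k] (u eps j') y ^+ 2.
  by move=> Uy; apply: eq_bigr => k _; rewrite (Ck_closure_pderE oU (vC 1%N j')).
have cW j' : {within closure U, continuous (W j')}.
  move=> y; apply: cvg_big => [|k _]; first exact: add_continuous.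
  have [_ /(_ [:: k] isT) ck _] := vC 1%N j'.
  by apply: cvgM; exact: ck.
have [i [c [cc cm]]] : exists i c, closure U c /\ forall j' t, closure U t -> W j' t <= W i c.
  apply: bool_max => //; first by exists x; exact: subset_closure.
  exact: compact_closure.
have sumD (a : 'I_n -> R) : (forall k, `|a k| <= C + B) -> \sum_k a k ^+ 2 <= D.
  move=> aD; rewrite /D mulr_natl -[X in _ *+ X]card_ord -sumr_const; apply: ler_sum => k _.
  by rewrite -real_normK ?num_real // ler_pXn2r ?nnegrE // addr_ge0 // ltW.
have WD : W i c <= D.
  have [Uc|bc] := closure_inside_or_boundary oU cc; last first.
    apply: sumD => k; apply: le_trans (HC eps eps0 i c k bc) _.
    by rewrite lerDl ltW.
  rewrite WE //; apply: sumD => k.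
  have mx j' y : U y -> \sum_k pder [:: k] (u eps j') y ^+ 2 <= \sum_k pder [:: k] (u eps i) c ^+ 2.
    by move=> Uy; rewrite -(WE j' y Uy) -(WE i c Uc); exact: cm (subset_closure Uy).
  have := HB eps (u eps) i c eps0 (su eps0) Uc mx.
  have := rV_coord_le (grad (u eps i) c) k; rewrite mxE => h1 h2.
  by apply: le_trans h1 _; apply: le_trans h2 _; rewrite lerDr ltW.
have : Num.sqrt (W j x) <= Num.sqrt D.
  by apply: ler_wsqrtr; exact: le_trans (cm j x (subset_closure Ux)) WD.
rewrite WE // => h; rewrite /norm2; under eq_bigr => k _ do rewrite mxE.
by apply: le_trans h _; rewrite lerDl.
Qed.

End UniformGradientBound.

(** Degenerate boxes suffice; in positive dimension their volume is zero. *)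
Lemma lebesgue_null_set0 (R : realType) (n : nat) : (0 < n)%N ->
  lebesgue_null (set0 : set 'rV[R]_n).
Proof.
move=> n0 delta delta0; exists (fun=> 0), (fun=> 0); split=> //.
rewrite eseries0 ?lee_fin ?ltW // => k _ _.
rewrite (bigD1 (Ordinal n0)) //= subrr mul0r //.
Qed.

Lemma Linfty_norm_le (R : realType) (n : nat) (U : set 'rV[R]_n) F (C : R) :
  (0 < n)%N -> 0 <= C -> (forall x, U x -> norm2 (F x) <= C) -> (Linfty_norm U F <= C%:E)%E.
Proof.
move=> n0 C0 FC; apply: ereal_inf_lbound; split; first by rewrite lee_fin.
rewrite (_ : [set x | _] = set0); first exact: lebesgue_null_set0.
apply/seteqP; split=> // x [Ux]; rewrite lte_fin ltNge => /negP; apply.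
exact: FC.
Qed.

Theorem lemma5p6 (R : realType) (n : nat) (hn : (2 <= n)%N)
    (U : set 'rV[R]_n)
    (Uopen : open U) (Uconn : connected U) (Unonempty : U !=set0)
    (Ubounded : bounded_set U) (Usmooth : smooth_boundary U)
    (H1 H2 : 'rV[R]_n -> 'rV[R]_n -> R)
    (psi1 psi2 : 'rV[R]_n -> R)
    (H1_hyp : hamiltonian_assumptions U H1)
    (H2_hyp : hamiltonian_assumptions U H2)
    (psi_hyp : obstacle_assumptions U psi1 psi2)
    (Phi_hyp : exists Phi1 Phi2 : 'rV[R]_n -> R,
       [/\ strict_subsolution U H1 Phi1,
           strict_subsolution U H2 Phi2 &
           forall x, closure U x ->
             - psi2 x <= Phi1 x - Phi2 x /\ Phi1 x - Phi2 x <= psi1 x])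
    (gamma : R -> R) (gamma_hyp : penalty_function gamma)
    (u1 u2 : R -> 'rV[R]_n -> R)
    (u_hyp : forall eps : R, 0 < eps ->
       penalized_solution U H1 H2 psi1 psi2 gamma eps (u1 eps) (u2 eps)) :
  exists C : R, 0 < C /\
    forall eps : R, 0 < eps ->
      (Linfty_norm U (grad (u1 eps)) <= C%:E)%E /\
      (Linfty_norm U (grad (u2 eps)) <= C%:E)%E.
Proof.
have n0 : (0 < n)%N by apply: leq_trans hn.
have [psi1C psi2C [alpha [alpha0 psi_ge]]] := psi_hyp.
have [Phi1 [Phi2 [Phi1S Phi2S Phi12]]] := Phi_hyp.
pose pick T (a b : T) (j : bool) := if j then a else b.
have HH j : hamiltonian_assumptions U (pick _ H1 H2 j).
  by case: j; [exact: H1_hyp|exact: H2_hyp].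
have psiC j : smooth_closure U (pick _ psi1 psi2 j).
  by case: j; [exact: psi1C|exact: psi2C].
have psi_ge' j x : closure U x -> alpha <= pick _ psi1 psi2 j x.
  by move=> /psi_ge[h1 h2]; case: j; [exact: h1|exact: h2].
have PhiS j : strict_subsolution U (pick _ H1 H2 j) (pick _ Phi1 Phi2 j).
  by case: j; [exact: Phi1S|exact: Phi2S].
have Phi_psi j x : closure U x ->
    pick _ Phi1 Phi2 j x - pick _ Phi1 Phi2 (~~ j) x <= pick _ psi1 psi2 j x.
  move=> /Phi12[h1 h2]; case: j; first exact: h2.
  by move: h1; rewrite lerNl opprB.
have su eps : 0 < eps ->
    solves U (pick _ H1 H2) (pick _ psi1 psi2) gamma eps (pick _ (u1 eps) (u2 eps)).
  move=> /u_hyp[C1 C2 E1 E2 b] [].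
    by split; [exact: C1|exact: E1|move=> x /b[h _]; exact: h].
  by split; [exact: C2|exact: E2|move=> x /b[_ h]; exact: h].
have [C [C0 HC]] := uniform_gradient_bound n0 Uopen Ubounded Usmooth HH gamma_hyp psiC
  alpha0 psi_ge' PhiS Phi_psi su.
exists C; split; first exact: C0.
move=> eps eps0; split.
  exact: (Linfty_norm_le n0 (ltW C0) (HC eps eps0 true)).
exact: (Linfty_norm_le n0 (ltW C0) (HC eps eps0 false)).
Qed.
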